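(* Suppose that the simplicial mesh $\mathcal{T}_h$ of $\Omega\subset\mathbb{R}^d$ satisfies, for every element $K\in\mathcal{T}_h$ and all $i,j\in\{1,\dots,d+1\}$ with $i\neq j$, $$\frac{h_i^K}{\lambda_{\min}(\mathbb{D}_K)}\cdot\frac{\|\boldsymbol{b}\|_{\infty,K}}{d+1}+\frac{h_i^K h_j^K}{\lambda_{\min}(\mathbb{D}_K)}\cdot\frac{\|c\|_{\infty,K}}{(d+1)(d+2)}\;\le\;\cos\big(\alpha_{ij,\mathbb{D}_K^{-1}}\big).$$ Then the linear finite element scheme on $\mathcal{T}_h$ for the boundary value problem $$-\nabla\cdot(\mathbb{D}\nabla u)+\boldsymbol{b}\cdot\nabla u+c\,u=f\ \text{ in }\Omega,\qquad u=g\ \text{ on }\partial\Omega,$$ satisfies the discrete maximum principle.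
   Context: **Problem.** $\Omega\subset\mathbb{R}^d$ ($d\ge1$) is a connected (bounded) polyhedron. $\mathbb{D}=\mathbb{D}(\boldsymbol{x})\in\mathbb{R}^{d\times d}$, $\boldsymbol{b}=\boldsymbol{b}(\boldsymbol{x})\in\mathbb{R}^d$, and the scalar functions $c,f,g$ are given and sufficiently smooth (up to the boundary). For every $\boldsymbol{x}$ the matrix $\mathbb{D}(\boldsymbol{x})$ is symmetric and strictly positive definite, and $c(\boldsymbol{x})-\frac12\nabla\cdot\boldsymbol{b}(\boldsymbol{x})\ge0$ and $c(\boldsymbol{x})\ge0$ for all $\boldsymbol{x}\in\Omega$. **Mesh and scheme.** $\mathcal{T}_h$ is a (conforming) simplicial mesh of $\Omega$ with vertices $\boldsymbol{a}_1,\dots,\boldsymbol{a}_{N_v}$, of which the first $N_{vi}$ are the interior vertices (those not on $\partial\Omega$). $\phi_j$ is the continuous piecewise linear nodal basis function with $\phi_j(\boldsymbol{a}_k)=\delta_{jk}$, and $U_0^h=\mathrm{span}\{\phi_1,\dots,\phi_{N_{vi}}\}$. The linear finite element scheme is: find $u^h=\sum_{j=1}^{N_v}u_j\phi_j$ with $u_j=g(\boldsymbol{a}_j)$ for $j=N_{vi}+1,\dots,N_v$ such that for all $v^h\in U_0^h$, $$\sum_{K\in\mathcal{T}_h}|K|(\nabla v^h)^T\mathbb{D}_K\nabla u^h+\sum_{K\in\mathcal{T}_h}\int_K v^h(\boldsymbol{b}\cdot\nabla u^h)\,d\boldsymbol{x}+\sum_{K\in\mathcal{T}_h}\int_K c\,u^hv^h\,d\boldsymbol{x}=\sum_{K\in\mathcal{T}_h}\int_K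 f\,v^h\,d\boldsymbol{x},$$ where $|K|$ is the volume of $K$ and $\mathbb{D}_K=\frac1{|K|}\int_K\mathbb{D}\,d\boldsymbol{x}$. **Element quantities.** For an element $K$ with (local) vertices $\boldsymbol{a}_1,\dots,\boldsymbol{a}_{d+1}$, $S_i$ is the face opposite to $\boldsymbol{a}_i$, $h_i^K$ is the Euclidean distance from $\boldsymbol{a}_i$ to (the hyperplane of) $S_i$, and $\boldsymbol{q}_i=\nabla\phi_i|_K$ is the gradient of the local linear basis function of $\boldsymbol{a}_i$. $\alpha_{ij,\mathbb{D}_K^{-1}}$ is the dihedral angle between $S_i$ and $S_j$ measured in the metric $\mathbb{D}_K^{-1}$, i.e. the dihedral angle between the faces $\mathbb{D}_K^{-1/2}S_i$ and $\mathbb{D}_K^{-1/2}S_j$ of the simplex $\mathbb{D}_K^{-1/2}K$, where the dihedral angle between two faces of a simplex is the supplement of the angle between their inward unit normals. Equivalently, $$\cos(\alpha_{ij,\mathbb{D}_K^{-1}})=-\frac{\boldsymbol{q}_i^T\mathbb{D}_K\boldsymbol{q}_j}{\sqrt{\boldsymbol{q}_i^T\mathbb{D}_K\boldsymbol{q}_i}\,\sqrt{\boldsymbol{q}_j^T\mathbb{D}_K\boldsymbol{q}_j}}.$$ $\lambda_{\min}(\mathbb{D}_K)$ is the smallest eigenvalue of $\mathbb{D}_K$; $\|\boldsymbol{b}\|_{\infty,K}=\max_{\boldsymbol{x}\in K}\|\boldsymbol{b}(\boldsymbol{x})\|$ with $\|\cdot\|$ the Euclidean norm; $\|c\|_{\infty,K}=\max_{\boldsymbol{x}\in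 K}c(\boldsymbol{x})$. **Discrete maximum principle (DMP).** The scheme satisfies DMP if, for its solution $u^h$, $f\le0$ in $\Omega$ implies $\max_{\boldsymbol{x}\in\overline\Omega}u^h(\boldsymbol{x})\le\max\{0,\max_{\boldsymbol{x}\in\partial\Omega}u^h(\boldsymbol{x})\}$. *)

(* Defs.v *)
From HB Require Import structures.
From mathcomp Require Import all_boot all_order all_algebra.
From mathcomp Require Import all_classical all_reals all_analysis.

Set Implicit Arguments.
Unset Strict Implicit.
Unset Printing Implicit Defensive.

Import Order.TTheory GRing.Theory Num.Theory.
Import numFieldNormedType.Exports.

Local Open Scope classical_set_scope.
Local Open Scope ring_scope.

(* Points and vectors of R^d are row vectors 'rV[R]_d.  The norm `|x| that the
   library puts on 'rV[R]_d is the sup norm; it gives the usual topology, and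
   Euclidean lengths are always written with enorm. *)

Section LebesgueRn.
Context {R : realType}.

Definition tcons n (p : measurableTypeR R * n.-tuple (measurableTypeR R)) :
  n.+1.-tuple (measurableTypeR R) := [tuple of p.1 :: p.2].

Lemma measurable_tcons n : measurable_fun [set: _] (@tcons n).
Proof. exact: measurable_cons. Qed.

Lemma measurable_tbehead n : measurable_fun [set: _]
  (fun t : n.+1.-tuple (measurableTypeR R) => (thead t, [tuple of behead t])).
Proof.
apply/measurable_fun_pairP; split; first exact: measurable_tnth.
exact: measurable_behead.
Qed.

Section step.
Variables (n : nat)
  (mu : {sigma_finite_measure set (n.-tuple (measurableTypeR R)) -> \bar R}).

Definition lebesgue_step : set (n.+1.-tuple (measurableTypeR R)) -> \bar R :=
  pushforward (product_measure1 (@lebesgue_measure R) mu) (@tcons n).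

Let step0 : lebesgue_step set0 = 0%E.
Proof. by rewrite /lebesgue_step /pushforward preimage_set0 measure0. Qed.

Let step_ge0 A : (0 <= lebesgue_step A)%E.
Proof. by rewrite /lebesgue_step /pushforward; apply: measure_ge0. Qed.

Let mtcons (A : set (n.+1.-tuple (measurableTypeR R))) :
  measurable A -> measurable (@tcons n @^-1` A).
Proof. by move=> mA; rewrite -[X in measurable X]setTI; exact: measurable_tcons. Qed.

Let step_sigma_additive : semi_sigma_additive lebesgue_step.
Proof.
move=> F mF tF mUF; rewrite /lebesgue_step /pushforward preimage_bigcup.
apply: measure_semi_sigma_additive.
- by move=> k; exact: mtcons.
- apply/trivIsetP => /= i j _ _ ij; rewrite -preimage_setI.
  by move/trivIsetP : tF => /(_ _ _ _ _ ij) ->//; rewrite preimage_set0.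
- by rewrite -preimage_bigcup; exact: mtcons.
Qed.

HB.instance Definition _ := isMeasure.Build _ _ _
  lebesgue_step step0 step_ge0 step_sigma_additive.

Let step_sigma_finite : sigma_finite setT lebesgue_step.
Proof.
have /sigma_finiteP[F [FT ndF Foo]] := sigma_finiteT (@lebesgue_measure R).
have /sigma_finiteP[G [GT ndG Goo]] := sigma_finiteT mu.
pose u (t : n.+1.-tuple (measurableTypeR R)) := (thead t, [tuple of behead t]).
have uK : cancel (@tcons n) u.
  by case=> a t; rewrite /u /tcons theadE; congr (_, _); exact/val_inj.
exists (fun k => u @^-1` (F k `*` G k)).
  rewrite -preimage_bigcup (_ : \bigcup_k _ = setT) ?preimage_setT//.
  rewrite predeqE => -[x y]; split=> // _.
  have [j _ Fjx] : (\bigcup_k F k) x by rewrite -FT.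
  have [k _ Gky] : (\bigcup_k G k) y by rewrite -GT.
  exists (maxn j k) => //; split => /=.
    by move: x Fjx; exact/subsetPset/ndF/leq_maxl.
  by move: y Gky; exact/subsetPset/ndG/leq_maxr.
move=> k; have [mF Fk] := Foo k; have [mG Gk] := Goo k; split.
  rewrite -[X in measurable X]setTI; apply: measurable_tbehead => //.
  exact: measurableX.
rewrite /lebesgue_step /pushforward -comp_preimage.
rewrite (_ : u \o _ = id) ?preimage_id//; last first.
  by apply/funext => p /=; exact: uK.
by rewrite product_measure1E// lte_mul_pinfty// ge0_fin_numE.
Qed.

HB.instance Definition _ := Measure_isSigmaFinite.Build _ _ _
  lebesgue_step step_sigma_finite.

End step.

(* Lebesgue measure on R^n, as the n-fold product of the one-dimensional one
   transported along R * R^n = R^(n+1). *)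
Fixpoint lebesgue_tuple (n : nat) :
    {sigma_finite_measure set (n.-tuple (measurableTypeR R)) -> \bar R} :=
  match n with
  | 0 => dirac [tuple]
  | m.+1 => lebesgue_step (lebesgue_tuple m)
  end.

End LebesgueRn.

Section Euclidean.
Context {R : realType} {d : nat}.
Implicit Types (x u v : 'rV[R]_d) (A : set 'rV[R]_d).

Definition dot u v : R := \sum_k u 0 k * v 0 k.
Definition enorm u : R := Num.sqrt (dot u u).

Definition grad (f : 'rV[R]_d -> R) x : 'rV[R]_d :=
  \row_k 'D_(delta_mx 0 k) f x.
Definition divergence (b : 'rV[R]_d -> 'rV[R]_d) x : R :=
  \sum_k 'D_(delta_mx 0 k) (fun y => b y 0 k) x.

Definition bdry A : set 'rV[R]_d := closure A `\` interior A.

Definition point_of_tuple (t : d.-tuple (measurableTypeR R)) : 'rV[R]_d :=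
  \row_k tnth t k.

Definition volume A : R := fine (lebesgue_tuple d (point_of_tuple @^-1` A)).
Definition integral_on A (f : 'rV[R]_d -> R) : R :=
  \int[lebesgue_tuple d]_(t in point_of_tuple @^-1` A) f (point_of_tuple t).

(* Continuously differentiable in the open set Omega, with the field and its
   first partial derivatives extending continuously to the closure. *)
Definition C1_up_to_bdry (Omega : set 'rV[R]_d) (b : 'rV[R]_d -> 'rV[R]_d) :=
  [/\ {within closure Omega, continuous b},
      forall x, Omega x -> differentiable b x
    & forall k : 'I_d, exists2 db : 'rV[R]_d -> 'rV[R]_d,
        {within closure Omega, continuous db} &
        forall x, Omega x -> 'D_(delta_mx 0 k) b x = db x].

Definition spd (A : 'M[R]_d) :=
  A^T = A /\ forall x, x != 0 -> 0 < dot (x *m A) x.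

(* The symmetric positive definite square root; meaningful when A is spd. *)
Definition sqrt_spd (A : 'M[R]_d) : 'M[R]_d :=
  get [set S : 'M[R]_d | spd S /\ S *m S = A].

(* A symmetric matrix of positive size has a nonempty finite set of
   eigenvalues, so that the infimum is a minimum. *)
Definition lambda_min (A : 'M[R]_d) : R := inf [set l | eigenvalue A l].

End Euclidean.

Section Simplex.
Context {R : realType} {d : nat}.

Definition convex_hull (I : finType) (p : I -> 'rV[R]_d) (A : {set I}) :
    set 'rV[R]_d :=
  [set x | exists w : I -> R, [/\ forall i, 0 <= w i,
    forall i, i \notin A -> w i = 0, \sum_i w i = 1 & x = \sum_i w i *: p i]].

Definition affine_hull (I : finType) (p : I -> 'rV[R]_d) (A : {set I}) :
    set 'rV[R]_d :=
  [set x | exists w : I -> R, [/\ forall i, i \notin A -> w i = 0,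
    \sum_i w i = 1 & x = \sum_i w i *: p i]].

(* A simplex is given by its d + 1 vertices. *)
Implicit Types p : 'I_d.+1 -> 'rV[R]_d.

Definition simplex p : set 'rV[R]_d := convex_hull p [set: 'I_d.+1].

(* The rows of vertex_mx p are (1, p i). *)
Definition vertex_mx p : 'M[R]_d.+1 := row_mx (const_mx 1 : 'cV_d.+1) (\matrix_i p i).

Definition affinely_independent p := vertex_mx p \in unitmx.

(* The i-th barycentric coordinate: the affine function on R^d that takes the
   value 1 at p i and 0 at the other vertices (bary_vertex below). *)
Definition bary p (i : 'I_d.+1) (x : 'rV[R]_d) : R :=
  ((row_mx 1 x : 'rV[R]_d.+1) *m invmx (vertex_mx p)) 0 i.

Lemma bary_vertex p i j : affinely_independent p ->
  bary p i (p j) = (i == j)%:R.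
Proof.
move=> pU; rewrite /bary.
have -> : (row_mx 1 (p j) : 'rV[R]_d.+1) = row j (vertex_mx p).
  apply/rowP => k; rewrite !mxE; case: splitP => l _.
    by rewrite ord1 !mxE.
  by rewrite !mxE.
by rewrite -row_mul mulmxV// !mxE eq_sym.
Qed.

Lemma bary_convex_combination p (w : 'I_d.+1 -> R) i :
  affinely_independent p -> \sum_j w j = 1 ->
  bary p i (\sum_j w j *: p j) = w i.
Proof.
move=> pU w1; rewrite /bary.
have -> : (row_mx 1 (\sum_j w j *: p j) : 'rV[R]_d.+1) =
    (\row_j w j) *m vertex_mx p.
  rewrite [RHS](mul_mx_row (\row_j w j) (const_mx 1 : 'cV_d.+1)).
  apply: (congr2 (@row_mx R 1 1 d)).
    apply/rowP => k; rewrite !mxE ord1 eqxx -[LHS]w1.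
    by apply: eq_bigr => j _; rewrite !mxE mulr1.
  by apply/rowP => k; rewrite summxE mxE; apply: eq_bigr => j _; rewrite !mxE.
by rewrite mulmxK// mxE.
Qed.

(* bary p i is affine: its gradient does not depend on the base point. *)
Definition bary_grad p i : 'rV[R]_d := grad (bary p i) (p i).

Definition height p (i : 'I_d.+1) : R :=
  inf [set enorm (p i - y) | y in affine_hull p [set~ i]].

(* The unit vector normal to the face opposite to p i and pointing into the
   simplex. *)
Definition inward_normal p (i : 'I_d.+1) : 'rV[R]_d :=
  get [set n | [/\ enorm n = 1,
    forall j k, j != i -> k != i -> dot n (p j - p k) = 0
    & forall j, j != i -> 0 < dot n (p i - p j)]].

Definition dihedral_angle p (i j : 'I_d.+1) : R :=
  pi - acos (dot (inward_normal p i) (inward_normal p j)).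

(* The dihedral angle in the metric M: that of the simplex M^(1/2) K. *)
Definition dihedral_angle_metric (M : 'M[R]_d) p (i j : 'I_d.+1) : R :=
  dihedral_angle (fun k => p k *m (sqrt_spd M)^T) i j.

End Simplex.

(* A bounded connected polyhedral domain.  That Omega is the interior of its
   closure excludes slits. *)
Definition polyhedral_domain {R : realType} {d : nat} (Omega : set 'rV[R]_d) :=
  [/\ Omega !=set0, connected Omega, Omega = interior (closure Omega) &
    exists n (p : 'I_n -> 'I_d.+1 -> 'rV[R]_d),
      (forall k, affinely_independent (p k)) /\
      closure Omega = \bigcup_k simplex (p k)].

(* vertex_of K i is the global index of the i-th vertex of the element K, for
   some arbitrary local numbering of the vertices of each element. *)
Record mesh (R : realType) (d : nat) := Mesh {
  nb_vertices : nat;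
  nb_interior : nat;
  vertex : 'I_nb_vertices -> 'rV[R]_d;
  nb_elements : nat;
  vertex_of : 'I_nb_elements -> 'I_d.+1 -> 'I_nb_vertices }.
Arguments nb_vertices {R d}.
Arguments nb_interior {R d}.
Arguments vertex {R d}.
Arguments nb_elements {R d}.
Arguments vertex_of {R d}.

Section Mesh.
Context {R : realType} {d : nat}.
Variable Th : mesh R d.

Definition element_vertices (K : 'I_(nb_elements Th)) :
    'I_d.+1 -> 'rV[R]_d :=
  fun i => vertex Th (vertex_of Th K i).

Definition element (K : 'I_(nb_elements Th)) : set 'rV[R]_d :=
  simplex (element_vertices K).

Definition vertex_set (K : 'I_(nb_elements Th)) : {set 'I_(nb_vertices Th)} :=
  [set vertex_of Th K i | i : 'I_d.+1].

Record simplicial_mesh (Omega : set 'rV[R]_d) : Prop := {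
  vertex_inj : injective (vertex Th);
  element_nondegenerate : forall K, affinely_independent (element_vertices K);
  vertex_set_inj : injective vertex_set;
  vertex_used : forall j, exists K, j \in vertex_set K;
  mesh_cover : closure Omega = \bigcup_K element K;
  mesh_conforming : forall K L,
    element K `&` element L =
    convex_hull (vertex Th) (vertex_set K :&: vertex_set L);
  nb_interior_le : (nb_interior Th <= nb_vertices Th)%N;
  interior_first : forall j : 'I_(nb_vertices Th),
    (j < nb_interior Th)%N <-> ~ bdry Omega (vertex Th j) }.

(* The nodal basis function phi_j: on an element K containing x, it is the
   barycentric coordinate attached to the vertex j, or 0 if j is not a vertex
   of K.  In a conforming mesh the choice of K is irrelevant. *)
Definition phi (j : 'I_(nb_vertices Th)) (x : 'rV[R]_d) : R :=
  if [pick K | `[< element K x >]] is Some K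
  then \sum_(i | vertex_of Th K i == j) bary (element_vertices K) i x
  else 0.

Lemma vertex_of_inj K : affinely_independent (element_vertices K) ->
  injective (vertex_of Th K).
Proof.
move=> KU i j eij; apply/eqP.
have := bary_vertex j i KU; rewrite /element_vertices eij -/(element_vertices K j).
rewrite bary_vertex// eqxx eq_sym; case: eqP => // _ /eqP.
by rewrite oner_eq0.
Qed.

Lemma sum_bary K (w : 'I_(nb_vertices Th) -> R) j :
  affinely_independent (element_vertices K) ->
  (forall k, k \notin vertex_set K -> w k = 0) -> \sum_k w k = 1 ->
  \sum_(i | vertex_of Th K i == j)
    bary (element_vertices K) i (\sum_k w k *: vertex Th k) = w j.
Proof.
move=> KU w0 w1; have vI := vertex_of_inj KU.
have red (V : lmodType R) (F : 'I_(nb_vertices Th) -> V) :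
    (forall k, k \notin vertex_set K -> F k = 0) ->
    \sum_k F k = \sum_i F (vertex_of Th K i).
  move=> F0; rewrite (bigID (mem (vertex_set K)))/= [X in _ + X]big1 ?addr0.
    rewrite big_imset/=; last by move=> i k _ _; exact: vI.
    by apply: eq_bigl => i; rewrite inE.
  by move=> k kK; exact: F0.
have -> : \sum_k w k *: vertex Th k =
    \sum_i w (vertex_of Th K i) *: element_vertices K i.
  by apply: (red _ (fun k => w k *: vertex Th k)) => k kK; rewrite w0// scale0r.
have w1' : \sum_i w (vertex_of Th K i) = 1.
  by rewrite -w1; apply/esym; exact: (red R^o w).
under eq_bigr => i _ do rewrite (bary_convex_combination i KU w1').
have [/imsetP[i _ ->]|jK] := boolP (j \in vertex_set K).
  by rewrite (big_pred1 i)// => k; rewrite /= (inj_eq vI).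
rewrite w0// big1// => i /eqP ij.
by move: jK; rewrite -ij imset_f.
Qed.

Lemma phi_element (Omega : set 'rV[R]_d) j K x :
  simplicial_mesh Omega -> element K x ->
  phi j x = \sum_(i | vertex_of Th K i == j) bary (element_vertices K) i x.
Proof.
move=> hT Kx; rewrite /phi; case: pickP => [L /asboolP Lx|]; last first.
  by move/(_ K)/asboolPn.
have : (element K `&` element L) x by [].
rewrite (mesh_conforming hT) => -[w [_ w0 w1 ->]].
by rewrite !sum_bary//; first [exact: (element_nondegenerate hT)
  | by move=> k kM; apply: w0; rewrite inE (negbTE kM) ?andbF].
Qed.

Lemma phi_vertex (Omega : set 'rV[R]_d) j k :
  simplicial_mesh Omega -> phi j (vertex Th k) = (j == k)%:R.
Proof.
move=> hT; have [K kK] := vertex_used hT k.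
have sk : \sum_l (l == k)%:R *: vertex Th l = vertex Th k.
  by rewrite (bigD1 k)//= eqxx scale1r big1 ?addr0// => l /negbTE ->; rewrite scale0r.
have s1 : \sum_l (l == k)%:R = 1 :> R.
  by rewrite (bigD1 k)//= eqxx big1 ?addr0// => l /negbTE ->.
have s0 l : l \notin vertex_set K -> (l == k)%:R = 0 :> R.
  by move=> lK; case: eqP => // lk; move: lK; rewrite lk kK.
rewrite (@phi_element Omega j K)//.
  by rewrite -sk sum_bary//; exact: (element_nondegenerate hT).
case/imsetP: kK => i _ ->; exists (fun l => (l == i)%:R); split => //.
- by move=> l; rewrite inE.
- by rewrite (bigD1 i)//= eqxx big1 ?addr0// => l /negbTE ->.
- by rewrite (bigD1 i)//= eqxx scale1r big1 ?addr0// => l /negbTE ->; rewrite scale0r.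
Qed.

(* A finite element function is given by its nodal values U. *)
Implicit Types U V : 'I_(nb_vertices Th) -> R.

Definition fe_fun U (x : 'rV[R]_d) : R := \sum_j U j * phi j x.

(* The constant value on K of the gradient of fe_fun U. *)
Definition fe_grad U (K : 'I_(nb_elements Th)) : 'rV[R]_d :=
  \sum_i U (vertex_of Th K i) *: bary_grad (element_vertices K) i.

Definition vanishes_on_bdry_nodes V :=
  forall j : 'I_(nb_vertices Th), (nb_interior Th <= j)%N -> V j = 0.

Variables (D : 'rV[R]_d -> 'M[R]_d) (b : 'rV[R]_d -> 'rV[R]_d).
Variables (c f g : 'rV[R]_d -> R).

Definition mean_diffusion (K : 'I_(nb_elements Th)) : 'M[R]_d :=
  \matrix_(k, l) ((volume (element K))^-1 *
                  integral_on (element K) (fun x => D x k l)).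

(* D_K is symmetric in all uses: multiplying a row vector by it on the right is
   applying it. *)
Definition fem_lhs U V : R :=
    \sum_K volume (element K) * dot (fe_grad V K *m mean_diffusion K) (fe_grad U K)
  + \sum_K integral_on (element K)
      (fun x => fe_fun V x * dot (b x) (fe_grad U K))
  + \sum_K integral_on (element K) (fun x => c x * fe_fun U x * fe_fun V x).

Definition fem_rhs V : R :=
  \sum_K integral_on (element K) (fun x => f x * fe_fun V x).

Definition fem_solution U :=
  (forall j : 'I_(nb_vertices Th), (nb_interior Th <= j)%N ->
     U j = g (vertex Th j)) /\
  (forall V, vanishes_on_bdry_nodes V -> fem_lhs U V = fem_rhs V).

(* The suprema are maxima: fe_fun U is continuous on the compact sets
   closure Omega and bdry Omega. *)
Definition discrete_maximum_principle (Omega : set 'rV[R]_d) :=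
  forall U, fem_solution U -> (forall x, Omega x -> f x <= 0) ->
  sup (fe_fun U @` closure Omega) <=
  Num.max 0 (sup (fe_fun U @` bdry Omega)).

End Mesh.

(* Maxima over the compact set K, for b and c continuous on K. *)
Definition sup_enorm {R : realType} {d : nat} (b : 'rV[R]_d -> 'rV[R]_d)
  (K : set 'rV[R]_d) : R := sup [set enorm (b x) | x in K].
Definition sup_on {R : realType} {d : nat} (c : 'rV[R]_d -> R)
  (K : set 'rV[R]_d) : R := sup [set c x | x in K].

(* Main.v *)
Require Import Defs.
From HB Require Import structures.
From mathcomp Require Import all_boot all_order all_algebra.
From mathcomp Require Import all_classical all_reals all_analysis.
From mathcomp Require Import perm measurable_realfun ring lra.

Set Implicit Arguments.
Unset Strict Implicit.
Unset Printing Implicit Defensive.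

Import Order.TTheory GRing.Theory Num.Theory.
Import numFieldNormedType.Exports.

Local Open Scope classical_set_scope.
Local Open Scope ring_scope.

(** Let m be the largest nodal value of the discrete solution, suppose that m is
    positive and larger than all boundary values, and let J be the set of the
    nodes where it is attained; they are interior nodes.  The scheme is tested
    with v, the sum of the basis functions of J, which is 1 on the plateau of the
    solution (plateau).

    On each element the stiffness matrix a has row sums equal to the integrals of
    c against the basis functions, which are nonnegative, and off-diagonal entries
    that are at most 0 (stiffness_le0).  For the latter, the mesh condition
    bounds the diffusive part: q_i D q_j is -cos(alpha_ij) times the D-norms of
    the gradients q_i and q_j (cos_dihedral), these norms are at least
    sqrt(lambda_min) times the Euclidean ones (lambda_min_le), and each height is
    at least the inverse of the norm of the gradient (height_grad_ge1).  The
    convective and reactive parts are at most the maxima of the data times the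
    integrals of phi_i and phi_i phi_j, namely |K| / (d + 1) and
    |K| / ((d + 1) (d + 2)) (integral_bary, integral_bary_mul).

    Writing the solution as m minus a nonnegative function that vanishes on J, the
    tested equation says that a sum of nonnegative terms is at most 0.  Hence
    c vanishes on the elements that meet J, and a_ij = 0 whenever i is in J and j
    is not (energy_eq0).  Such zero entries do occur for degenerate data, so that
    irreducibility of the matrix cannot be invoked.  Instead, the case of equality
    in the bounds is analysed (mixed_element): an element with vertices both in
    and outside J has exactly one vertex outside J, and there b is a positive
    multiple of the gradient of the coordinate of that vertex.  The drift is
    constant on the element and flows out of the plateau, orthogonally to the
    opposite face.

    This is impossible.  If d > 1, around a node a outside J all the mixed
    elements share the drift b(a), hence their faces opposite to a are parallel,
    and the level sets of v around a are unions of pieces of hyperplanes without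
    boundary, which cannot be bounded (no_drift_out_of_plateau).  If d = 1, the
    drift points outwards at both ends of an interval where c = 0, but there
    b' <= 2 c = 0 (no_drift_out_of_plateau_dim1).

    The integrals are found without computing any determinant or iterated
    integral: an affine bijection multiplies Lebesgue measure by some constant
    (scaling_unitmx), and the constants that matter follow from the symmetries of
    the simplex under exchanges of vertices and bisections of edges. *)

(** * Affine changes of variables for Lebesgue measure *)

Lemma lebesgue_measure_affine (R : realType) (a b : R) (A : set (measurableTypeR R)) :
  a != 0 -> measurable A ->
  (lebesgue_measure ((fun x => a * x + b)%R @^-1` A) =
   `|a|^-1%:E * lebesgue_measure A)%E.
Proof.
move=> a0 mA; have na : 0 < `|a| by rewrite normr_gt0.
pose f : measurableTypeR R -> measurableTypeR R := (fun x => a * x + b)%R.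
have mf : measurable_fun [set: measurableTypeR R] f.
  apply: (@measurable_funD _ _ R _ ( *%R a) (cst b)); last exact: measurable_cst.
  exact: mulrl_measurable.
(* the image measure agrees with a multiple of Lebesgue measure on intervals;
   a negative slope exchanges the open and the closed end *)
pose nu : {measure set (measurableTypeR R) -> \bar R} :=
  @measure_function_pushforward__canonical__measure_function_Measure
    _ _ _ _ _ (@lebesgue_measure R) f mf.
pose nu' : {measure set (measurableTypeR R) -> \bar R} := mscale (NngNum (ltW na)) nu.
have -> : (lebesgue_measure A = nu' A)%E.
  apply: lebesgue_measure_unique => // X /ocitvP[->|[[x y] /= xy ->]].
    by rewrite !measure0.
  rewrite /nu' /mscale /pushforward /= lebesgue_measure_itv/= lte_fin xy.
  have [a1|a1] := ltP 0 a.
    rewrite [X in (_ * lebesgue_measure X)%E](_ : _ = `](x - b) / a, (y - b) / a]%classic); last first.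
      apply/seteqP; split => z; rewrite /f /= !in_itv/= => /andP[z1 z2].
        by rewrite ltr_pdivrMr// ler_pdivlMr//; apply/andP; split; lra.
      by move: z1 z2; rewrite ltr_pdivrMr// ler_pdivlMr// => ? ?; apply/andP; split; lra.
    rewrite lebesgue_measure_itv/= lte_fin ltr_pM2r ?invr_gt0// ltrD2r xy.
    by rewrite -!EFinD -EFinM gtr0_norm//; congr EFin; field.
  have {}a1 : a < 0 by rewrite lt_neqAle a0.
  rewrite [X in (_ * lebesgue_measure X)%E](_ : _ = `[(y - b) / a, (x - b) / a[%classic); last first.
    apply/seteqP; split => z; rewrite /f /= !in_itv/= => /andP[z1 z2].
      by rewrite ltr_ndivlMr// ler_ndivrMr//; apply/andP; split; lra.
    by move: z1 z2; rewrite ltr_ndivlMr// ler_ndivrMr// => ? ?; apply/andP; split; lra.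
  rewrite lebesgue_measure_itv/= lte_fin ltr_nM2r ?invr_lt0// ltrD2r xy.
  by rewrite -!EFinD -EFinM ltr0_norm//; congr EFin; field.
by rewrite /nu' /mscale /= muleA -EFinM mulVf ?lt0r_neq0// mul1e.
Qed.

Section affine_maps.
Context {R : realType}.
Local Notation T n := (n.-tuple (measurableTypeR R)).
Local Notation lam := (@lebesgue_measure R).

Definition tuple_of_point n (v : 'rV[R]_n) : T n := [tuple v 0 i | i < n].

Lemma tuple_of_pointK n : cancel (@tuple_of_point n) point_of_tuple.
Proof. by move=> v; apply/rowP => i; rewrite mxE tnth_mktuple. Qed.

Lemma point_of_tupleK n : cancel point_of_tuple (@tuple_of_point n).
Proof. by move=> t; apply: eq_from_tnth => i; rewrite tnth_mktuple mxE. Qed.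

Lemma measurable_coord n (i : 'I_n) :
  measurable_fun [set: T n] (fun t : T n => point_of_tuple t 0 i).
Proof.
rewrite (_ : (fun _ => _) = (fun t : T n => tnth t i)); first exact: measurable_tnth.
by apply/funext => t; rewrite mxE.
Qed.

Lemma product_measure12 d1 d2 (T1 : measurableType d1) (T2 : measurableType d2)
    (m1 : {sigma_finite_measure set T1 -> \bar R})
    (m2 : {sigma_finite_measure set T2 -> \bar R}) A :
  measurable A -> (m1 \x m2)%E A = (m1 \x^ m2)%E A.
Proof.
by move=> mA; apply: product_measure_unique => // B C mB mC; exact: product_measure2E.
Qed.

(** For fixed second component the map is a one-dimensional affine map with slope
    a, so the claim follows by integrating the first component first. *)
Lemma product_affine_fst n (a : R) (g : T n -> R) (A : set (measurableTypeR R * T n)) :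
  a != 0 -> measurable_fun setT g -> measurable A ->
  ((lam \x lebesgue_tuple n) ((fun p => (a * p.1 + g p.2, p.2)%R) @^-1` A) =
   `|a|^-1%:E * (lam \x lebesgue_tuple n) A)%E.
Proof.
move=> a0 mg mA.
have mf : measurable_fun [set: measurableTypeR R * T n]
    (fun p => (a * p.1 + g p.2, p.2)%R : measurableTypeR R * T n).
  apply/measurable_fun_pairP; split; last exact: measurable_snd.
  apply: (@measurable_funD _ _ R _ (fun p => a * p.1) (fun p => g p.2)).
    by apply: (measurableT_comp (mulrl_measurable a)); exact: measurable_fst.
  exact: (measurableT_comp mg measurable_snd).
rewrite !product_measure12//; last by rewrite -[X in measurable X]setTI; exact: mf.
rewrite /product_measure2 -ge0_integralZl//.
- apply: eq_integral => t _ /=.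
  by rewrite -(lebesgue_measure_affine (g t))//; last exact: measurable_ysection.
- exact: measurable_fun_ysection.
Qed.

Lemma product_scale_snd n (T' : measurableTypeR R -> T n -> T n) (c : R)
    (A : set (measurableTypeR R * T n)) :
  0 <= c ->
  (forall x B, measurable B ->
     lebesgue_tuple n (T' x @^-1` B) = (c%:E * lebesgue_tuple n B)%E) ->
  measurable A ->
  ((lam \x lebesgue_tuple n) ((fun p => (p.1, T' p.1 p.2)) @^-1` A) =
   c%:E * (lam \x lebesgue_tuple n) A)%E.
Proof.
move=> c0 hT mA; rewrite /product_measure1 -ge0_integralZl//.
- apply: eq_integral => x _ /=; by rewrite -(hT x); last exact: measurable_xsection.
- exact: measurable_fun_xsection.
Qed.

Definition affine_map n (M : 'M[R]_n) (v : 'rV[R]_n) (t : T n) : T n :=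
  tuple_of_point (point_of_tuple t *m M + v).

Lemma measurable_affine_map n (M : 'M[R]_n) v :
  measurable_fun [set: T n] (affine_map M v).
Proof.
apply/measurable_fun_tnthP => i.
rewrite (_ : _ \o _ = (fun t : T n => \sum_j point_of_tuple t 0 j * M j i + v 0 i)).
  apply: measurable_funD => //.
  apply: measurable_sum => j; apply: measurable_funM => //; exact: measurable_coord.
by apply/funext => t; rewrite /= tnth_mktuple !mxE.
Qed.

End affine_maps.

Section affine_scaling.
Context {R : realType}.
Local Notation T n := (n.-tuple (measurableTypeR R)).

Lemma point_of_tuple_tcons n (p : measurableTypeR R * T n) :
  point_of_tuple (tcons p) = row_mx (const_mx p.1 : 'rV_1) (point_of_tuple p.2).
Proof.
apply/rowP => i; rewrite !mxE; case: splitP => j ij.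
  rewrite mxE (_ : i = ord0) ?tnth0//; apply: val_inj => /=.
  by rewrite [val i]ij ord1.
rewrite mxE (_ : i = lift ord0 j) ?tnthS; last by apply: val_inj => /=; rewrite [val i]ij.
by congr tnth; apply: val_inj.
Qed.

Lemma affine_map_tcons n (M : 'M[R]_(1 + n)) (v : 'rV[R]_(1 + n)) p :
  affine_map M v (tcons p) = tcons
    (ulsubmx M 0 0 * p.1 + ((point_of_tuple p.2 *m dlsubmx M) 0 0 + lsubmx v 0 0),
     tuple_of_point (point_of_tuple p.2 *m drsubmx M +
                     (p.1 *: ursubmx M + rsubmx v))).
Proof.
rewrite -[LHS](@point_of_tupleK R (n.+1)) -[RHS](@point_of_tupleK R (n.+1)).
congr tuple_of_point; rewrite /affine_map tuple_of_pointK.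
rewrite [in RHS]point_of_tuple_tcons tuple_of_pointK /=.
rewrite (point_of_tuple_tcons p).
rewrite -{1}[M]submxK -{1}[v]hsubmxK.
rewrite [X in X + _](mul_row_block (const_mx p.1)) [LHS](@add_row_mx _ 1 1 n).
apply: (congr2 (@row_mx R 1 1 n)).
  apply/rowP => i; rewrite ord1 !mxE big_ord1 !mxE.
  by rewrite -addrA mulrC; congr (_ * _ + (_ + _)).
apply/rowP => i; rewrite !mxE big_ord1 !mxE.
by rewrite addrCA -addrA addrA addrC.
Qed.

(** The constant is the inverse of the absolute value of the determinant, but only
    its existence matters.  It has to be the same for all translations v, because
    in the block decomposition below the translation of the tail depends on the
    head. *)
Definition scaling n (M : 'M[R]_n) := exists2 c : R, 0 < c &
  forall v (A : set (T n)), measurable A ->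
    lebesgue_tuple n (affine_map M v @^-1` A) = (c%:E * lebesgue_tuple n A)%E.

Lemma affine_map_mul n (M N : 'M[R]_n) v t :
  affine_map (M *m N) v t = affine_map N v (affine_map M 0 t).
Proof. by rewrite /affine_map tuple_of_pointK addr0 mulmxA. Qed.

Lemma scaling_mul n (M N : 'M[R]_n) : scaling M -> scaling N -> scaling (M *m N).
Proof.
move=> [c c0 hc] [e e0 he]; exists (c * e); first exact: mulr_gt0.
move=> v A mA; rewrite EFinM -muleA -(he v)// -(hc 0).
  by congr (lebesgue_tuple n _); apply/funext => t /=; rewrite affine_map_mul.
by rewrite -[X in measurable X]setTI; exact: measurable_affine_map.
Qed.


Lemma measurable_tcons_preimage n (A : set (T n.+1)) :
  measurable A -> measurable (@tcons R n @^-1` A).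
Proof. by move=> mA; rewrite -[X in measurable X]setTI; exact: measurable_tcons. Qed.

Lemma scaling_lower n (a : R) (s : 'cV[R]_n) : a != 0 -> scaling (1%:M : 'M[R]_n) ->
  scaling (block_mx (const_mx a) 0 s 1%:M : 'M[R]_(1 + n)).
Proof.
move=> a0 [e e0 he]; exists (`|a|^-1 * e).
  by rewrite mulr_gt0// invr_gt0 normr_gt0.
move=> v A mA; rewrite /= /lebesgue_step /pushforward.
pose g (t : T n) : R := (point_of_tuple t *m s) 0 0 + lsubmx (v : 'rV[R]_(1 + n)) 0 0.
pose w : 'rV[R]_n := rsubmx (v : 'rV[R]_(1 + n)).
rewrite EFinM -muleA -(@product_scale_snd _ n (fun=> affine_map 1%:M w) e)//; last 3 first.
- exact: ltW.
- by move=> _ B mB; exact: he.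
- exact: measurable_tcons_preimage.
rewrite -(@product_affine_fst _ n a g)//; last 2 first.
- apply: measurable_funD => //.
  rewrite [X in measurable_fun _ X](_ : _ = fun t : T n => \sum_j point_of_tuple t 0 j * s j 0).
    by apply: measurable_sum => j; apply: measurable_funM => //; exact: measurable_coord.
  by apply/funext => t; rewrite mxE.
- rewrite -[X in measurable X]setTI.
  apply: measurable_fun_pair => //; last exact: measurable_tcons_preimage.
  exact: (measurableT_comp (measurable_affine_map _ _) measurable_snd).
congr (product_measure1 _ _ _); apply/funext => -[x t] /=; congr A.
rewrite affine_map_tcons block_mxKdl block_mxKdr block_mxKur scaler0 add0r.
by rewrite block_mxKul mxE.
Qed.

Lemma scaling_upper n (r : 'rV[R]_n) (M : 'M[R]_n) : scaling M ->
  scaling (block_mx 1%:M r 0 M : 'M[R]_(1 + n)).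
Proof.
move=> [e e0 he]; exists e => //.
move=> v A mA; rewrite /= /lebesgue_step /pushforward.
pose w : 'rV[R]_n := rsubmx (v : 'rV[R]_(1 + n)).
pose b : R := lsubmx (v : 'rV[R]_(1 + n)) 0 0.
rewrite -(@product_scale_snd _ n (fun x => affine_map M ((x - b) *: r + w)) e)//; last 3 first.
- exact: ltW.
- by move=> x B mB; exact: he.
- exact: measurable_tcons_preimage.
rewrite -[RHS]mul1e -[X in (X%:E * _)%E](_ : `|1|^-1 = 1)//; last by rewrite normr1 invr1.
rewrite -(@product_affine_fst _ n 1 (cst b))//; last first.
- rewrite -[X in measurable X]setTI.
  apply: measurable_fun_pair => //; last exact: measurable_tcons_preimage.
  apply/measurable_fun_tnthP => i.
  rewrite [X in measurable_fun _ X](_ : _ = fun p : measurableTypeR R * T n =>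
      \sum_j point_of_tuple p.2 0 j * M j i + ((p.1 - b) * r 0 i + w 0 i)).
    apply: measurable_funD.
      apply: measurable_sum => j; apply: measurable_funM => //.
      exact: (measurableT_comp (measurable_coord j) measurable_snd).
    apply: measurable_funD => //; apply: measurable_funM => //.
    exact: measurable_funB.
  by apply/funext => p; rewrite /= tnth_mktuple !mxE.
congr (product_measure1 _ _ _); apply/funext => -[x t] /=; congr A.
rewrite affine_map_tcons block_mxKdl block_mxKdr block_mxKur block_mxKul.
by rewrite mulmx0 mxE eqxx [X in X + lsubmx _ _ _]mxE add0r !mul1r addrK.
Qed.

(** Multiplying by an upper unitriangular matrix on the left makes the corner
    entry nonzero; then one step of block LU elimination reduces the
    dimension. *)
Lemma scaling_unitmx n (M : 'M[R]_n) : M \in unitmx -> scaling M.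
Proof.
elim: n M => [|n IH] M Mu.
  exists 1 => // v A mA; rewrite mul1e; congr (lebesgue_tuple 0 _).
  by apply/funext => t /=; congr A; apply: eq_from_tnth => -[].
have sc1 : scaling (1%:M : 'M[R]_n) by apply: IH; exact: unitmx1.
(* N = [a 0; s 1] [1 r/a; 0 S], where S is the Schur complement of the corner a *)
have LU (N : 'M[R]_(1 + n)) : N \in unitmx -> ulsubmx N 0 0 != 0 -> scaling N.
  move=> Nu; set a := ulsubmx N 0 0 => a0.
  pose S := drsubmx N - dlsubmx N *m (a^-1 *: ursubmx N).
  have NE : N = block_mx (const_mx a) 0 (dlsubmx N) 1%:M *m
                block_mx 1%:M (a^-1 *: ursubmx N) 0 S.
    rewrite mulmx_block !mulmx1 !mulmx0 !mul0mx !addr0 mul1mx subrKC.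
    rewrite -[LHS]submxK; congr block_mx.
      by apply/matrixP => i j; rewrite !ord1 [RHS]mxE.
    apply/rowP => j; rewrite !mxE big_ord1 !mxE.
    by rewrite mulrA mulfV// mul1r.
  have Su : S \in unitmx.
    move: Nu; rewrite NE unitmx_mul => /andP[_].
    by rewrite !unitmxE det_ublock det1 mul1r.
  rewrite NE; apply: scaling_mul; first exact: scaling_lower.
  by apply: scaling_upper; exact: IH.
pose N : 'M[R]_(1 + n) := M.
have [r r0] : exists r : 'rV[R]_n, (ulsubmx N + r *m dlsubmx N) 0 0 != 0.
  have [a0|a0] := eqVneq (ulsubmx N 0 0) 0; last first.
    by exists 0; rewrite mul0mx addr0.
  have [s0|/cV0Pn[k sk]] := eqVneq (dlsubmx N) 0; last first.
    exists (delta_mx 0 k); rewrite mxE a0 add0r -rowE.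
    by rewrite [X in X != 0]mxE.
  exfalso.
  have : N *m col_mx (const_mx 1 : 'cV_1) 0 = 0.
    rewrite -[N]submxK mul_block_col s0 !mulmx0 mul0mx !addr0.
    rewrite -[RHS]col_mx0; congr col_mx.
    by apply/matrixP => i j; rewrite !ord1 mxE big_ord1 a0 mul0r mxE.
  move/(congr1 (mulmx (invmx N))); rewrite mulKmx// mulmx0.
  by move/matrixP/(_ (lshift n 0) 0)/eqP; rewrite col_mxEu !mxE oner_eq0.
pose P (u : 'rV[R]_n) : 'M[R]_(1 + n) := block_mx 1%:M u 0 1%:M.
have PK : P (- r) *m P r = 1%:M.
  rewrite mulmx_block !mulmx1 !mulmx0 !mul1mx !mul0mx !addr0 add0r subrr.
  by rewrite -scalar_mx_block.
have Pu u : P u \in unitmx by rewrite unitmxE det_ublock !det1 mul1r unitr1.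
rewrite -[M]/N -[N]mul1mx -PK -mulmxA; apply: scaling_mul; first exact: scaling_upper.
apply: LU; first by rewrite unitmx_mul Pu.
have -> : P r *m N = block_mx (ulsubmx N + r *m dlsubmx N)
    (ursubmx N + r *m drsubmx N) (dlsubmx N) (drsubmx N).
  by rewrite -{1}[N]submxK mulmx_block !mul1mx !mul0mx !add0r.
by rewrite block_mxKul.
Qed.

End affine_scaling.

(** * Borel sets, cubes and hyperplanes *)

Section borel.
Context {R : realType}.
Local Notation T n := (n.-tuple (measurableTypeR R)).
Local Notation vec := point_of_tuple.

Lemma rV_norm_leP n (v : 'rV[R]_n) r : 0 <= r ->
  reflect (forall i, `|v 0 i| <= r) (`|v| <= r).
Proof.
move=> r0; rewrite [X in X <= _]/Num.Def.normr /= mx_normrE; apply: (iffP (bigmax_leP _ _ _ _)).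
  by move=> [_ h] i; exact: (h (0, i)).
by move=> h; split => // -[i j] _; rewrite ord1.
Qed.

Lemma rV_norm_ltP n (v : 'rV[R]_n) r : 0 < r ->
  reflect (forall i, `|v 0 i| < r) (`|v| < r).
Proof.
move=> r0; rewrite [X in X < _]/Num.Def.normr /= mx_normrE; apply: (iffP (bigmax_ltP _ _ _ _)).
  by move=> [_ h] i; exact: (h (0, i)).
by move=> h; split => // -[i j] _; rewrite ord1.
Qed.

Lemma rV_ballP n (x y : 'rV[R]_n) r : 0 < r ->
  ball x r y <-> forall i, `|x 0 i - y 0 i| < r.
Proof.
move=> r0; rewrite mx_norm_ball /ball_/=; split.
  by move/(rV_norm_ltP _ r0) => h i; have := h i; rewrite !mxE.
by move=> h; apply/rV_norm_ltP => // i; rewrite !mxE.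
Qed.

Lemma measurable_preimage_ball n (x : 'rV[R]_n) r : 0 < r ->
  measurable (vec @^-1` (ball x r) : set (T n)).
Proof.
move=> r0.
rewrite (_ : _ @^-1` _ = \bigcap_(i in [set: 'I_n]) ((fun t : T n => x 0 i - vec t 0 i) @^-1` `]- r, r[)).
  apply: fin_bigcap_measurable; first exact: finite_finset.
  move=> i _; rewrite -[X in measurable X]setTI.
  have mf : measurable_fun [set: T n] (fun t : T n => x 0 i - vec t 0 i).
    by apply: measurable_funB => //; exact: measurable_coord.
  exact: mf.
apply/seteqP; split => t /=.
  by move/(rV_ballP _ _ r0) => h i _ /=; rewrite in_itv/= -ltr_norml.
by move=> h; apply/rV_ballP => // i; move: (h i I); rewrite /= in_itv/= -ltr_norml.
Qed.

(** Every open set is the union of the balls with rational centre and radius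
    that it contains. *)
Lemma measurable_preimage_open n (U : set 'rV[R]_n) : open U ->
  measurable (vec @^-1` U : set (T n)).
Proof.
move=> oU.
pose c (p : 'rV[rat]_n * nat) : 'rV[R]_n := map_mx ratr p.1.
pose e (p : 'rV[rat]_n * nat) : R := p.2.+1%:R^-1.
have e0 p : 0 < e p by rewrite invr_gt0.
pose F (p : 'rV[rat]_n * nat) : set (T n) :=
  if `[< ball (c p) (e p) `<=` U >] then vec @^-1` (ball (c p) (e p)) else set0.
rewrite (_ : _ @^-1` _ = \bigcup_p F p).
  apply: countable_bigcupT_measurable; first exact: countableP.
  by move=> p; rewrite /F; case: asboolP => _ //; exact: measurable_preimage_ball.
apply/seteqP; split => t /=; last first.
  by move=> [p _]; rewrite /F; case: asboolP => // h /h.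
move=> Ut; have /nbhs_ballP[r /= r0 rU] : nbhs (vec t) U by exact: open_nbhs_nbhs.
have [k k0] : exists k : nat, (k.+1%:R^-1 : R) < r / 2.
  have [k _ hk] := near_infty_natSinv_lt (PosNum (divr_gt0 r0 (ltr0n R 2))).
  by exists k; exact: (hk k (leqnn k)).
have [q hq] : exists q : 'rV[rat]_n, forall i, `|vec t 0 i - ratr (q 0 i)| < k.+1%:R^-1.
  have hq i : exists q : rat, `|vec t 0 i - ratr q| < k.+1%:R^-1.
    have : vec t 0 i - k.+1%:R^-1 < vec t 0 i + k.+1%:R^-1 :> R.
      by rewrite ltrD2l gtrN// invr_gt0.
    move=> /rat_in_itvoo[q]; rewrite in_itv/= => h; exists q.
    by rewrite ltr_distlC.
  exists (\row_i projT1 (cid (hq i))) => i; rewrite mxE; exact: (projT2 (cid (hq i))).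
exists (q, k) => //; rewrite /F.
have ct : ball (c (q, k)) (e (q, k)) (vec t).
  by apply/rV_ballP => // i; rewrite mxE distrC.
case: asboolP => // -[] z hz; apply: rU; apply/rV_ballP => // i.
move/(rV_ballP _ _ (e0 _))/(_ i) : hz; rewrite mxE /e/= => hz.
apply: (le_lt_trans (ler_distD (ratr (q 0 i)) _ _)).
by apply: (lt_trans (ltrD (hq i) hz)); move: k0; rewrite ltr_pdivlMr// mulr_natr mulr2n.
Qed.

Definition cube n (a : 'rV[R]_n) (r : R) : set (T n) :=
  [set t | forall i, tnth t i \in `[a 0 i - r, a 0 i + r]].

Lemma measurable_cube n (a : 'rV[R]_n) r : measurable (cube a r).
Proof.
rewrite (_ : cube a r = \bigcap_(i in [set: 'I_n])
    ((fun t : T n => tnth t i) @^-1` `[a 0 i - r, a 0 i + r])).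
  apply: fin_bigcap_measurable; first exact: finite_finset.
  by move=> i _; rewrite -[X in measurable X]setTI; exact: measurable_tnth.
by apply/seteqP; split => t h i //=; exact: h.
Qed.

Lemma lebesgue_tuple_cube n (a : 'rV[R]_n) r : 0 <= r ->
  lebesgue_tuple n (cube a r) = ((r *+ 2) ^+ n)%:E.
Proof.
move=> r0; elim: n a => [|n IH] a.
  rewrite /= diracE (_ : (_ \in _) = true) ?expr0//.
  by apply/mem_set => -[].
rewrite /= /lebesgue_step /pushforward.
pose a' : 'rV[R]_n := \row_i a 0 (lift ord0 i).
rewrite (_ : _ @^-1` _ = `[a 0 0 - r, a 0 0 + r]%classic `*` cube a' r).
  rewrite product_measure1E//; last exact: measurable_cube.
  rewrite IH -[LHS]/(lebesgue_measure _ * _)%E lebesgue_measure_itv/= lte_fin.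
  case: ifPn => [_|].
    by rewrite -EFinD -EFinM exprS; congr (_ * _)%:E; ring.
  rewrite -leNgt => r1; have -> : r = 0 by lra.
  by rewrite mul0e mul0rn expr0n.
apply/seteqP; split => -[x t] /=.
  move=> h; split; first by have := h ord0; rewrite tnth0.
  move=> i; have := h (lift ord0 i); rewrite tnthS mxE.
  by rewrite (_ : tnth _ i = tnth t i)//; congr tnth; apply: val_inj.
move=> [h0 h] i; have [j ->|->] := unliftP ord0 i.
  have := h j; by rewrite mxE tnthS.
by rewrite tnth0.
Qed.

Lemma lebesgue_tuple_bounded n (A : set 'rV[R]_n) (M : R) :
  (forall x, A x -> `|x| <= M) -> measurable (vec @^-1` A : set (T n)) ->
  (lebesgue_tuple n (vec @^-1` A) < +oo)%E.
Proof.
move=> AM mA; apply: (@le_lt_trans _ _ (lebesgue_tuple n (cube 0 `|M|))).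
  apply: le_measure; rewrite ?inE//; first exact: measurable_cube.
  move=> t /AM tM i; have := tM.
  move=> /le_trans/(_ (ler_norm M))/(rV_norm_leP _ (normr_ge0 M))/(_ i).
  by rewrite ler_norml !mxE sub0r add0r in_itv.
by rewrite lebesgue_tuple_cube// ltry.
Qed.

Lemma lebesgue_tuple_ball_gt0 n (A : set 'rV[R]_n) (a : 'rV[R]_n) r :
  0 < r -> ball a r `<=` A -> measurable (vec @^-1` A : set (T n)) ->
  (0 < lebesgue_tuple n (vec @^-1` A))%E.
Proof.
move=> r0 aA mA; apply: (@lt_le_trans _ _ (lebesgue_tuple n (cube a (r / 2)))).
  by rewrite lebesgue_tuple_cube ?lte_fin ?exprn_gt0 ?mulrn_wgt0//; lra.
apply: le_measure; rewrite ?inE//; first exact: measurable_cube.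
move=> t ht; apply: aA; apply/rV_ballP => // i.
by have := ht i; rewrite in_itv/= mxE => /andP[? ?]; rewrite ltr_norml; lra.
Qed.

Lemma hyperplane_measurable n (w : 'cV[R]_n) (s : R) :
  measurable [set t : T n | (vec t *m w) 0 0 = s].
Proof.
have mf : measurable_fun [set: T n] (fun t : T n => \sum_j vec t 0 j * w j 0).
  by apply: measurable_sum => j; apply: measurable_funM => //; exact: measurable_coord.
rewrite (_ : mkset _ = [set: T n] `&` (fun t : T n => \sum_j vec t 0 j * w j 0) @^-1` [set s]).
  exact: mf.
by apply/seteqP; split => t /=; rewrite mxE// => -[].
Qed.

(** By induction on the dimension: if the normal has a nonzero tail, every section
    at a fixed first coordinate is a hyperplane; otherwise the set is the product
    of a point and a space. *)
Lemma hyperplane_null n (w : 'cV[R]_n) (s : R) : w != 0 ->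
  lebesgue_tuple n [set t | (vec t *m w) 0 0 = s] = 0%E.
Proof.
elim: n w s => [|n IH] w s.
  by move/eqP; case; apply/colP => -[].
pose w' : 'cV[R]_n := dsubmx (w : 'cV[R]_(1 + n)).
pose w0 : R := usubmx (w : 'cV[R]_(1 + n)) 0 0.
have wE p : (vec (tcons p) *m w) 0 0 = p.1 * w0 + (vec p.2 *m w') 0 0.
  have -> : vec (tcons p) *m w =
      const_mx p.1 *m usubmx (w : 'cV[R]_(1 + n)) + vec p.2 *m w'.
    by rewrite point_of_tuple_tcons -mul_row_col vsubmxK.
  by rewrite mxE; congr (_ + _); rewrite mxE big_ord1 mxE.
move=> wN0; rewrite /= /lebesgue_step /pushforward.
have [w'0|w'N0] := eqVneq w' 0; last first.
  rewrite /product_measure1 integral0_eq// => x _ /=.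
  rewrite -[RHS](IH w' (s - x * w0) w'N0); congr (lebesgue_tuple n _).
  rewrite xsectionE; apply/seteqP; split => t /=; rewrite wE/=.
    by move=> <-; rewrite addrC addKr.
  by move=> ->; rewrite subrKC.
have w00 : w0 != 0.
  apply: contra wN0 => /eqP w00; rewrite -[w](@vsubmxK _ 1 n 1) -/w' w'0.
  rewrite (_ : usubmx _ = 0) ?col_mx0//.
  by apply/matrixP => i j; rewrite !ord1 [RHS]mxE.
rewrite (_ : _ @^-1` _ = [set s / w0] `*` setT).
  by rewrite product_measure1E// -[LHS]/(lebesgue_measure _ * _)%E lebesgue_measure_set1 mul0e.
apply/seteqP; split => -[x t] /=; rewrite wE w'0 mulmx0 [X in _ + X]mxE addr0/=.
  by move=> <-; split => //; rewrite mulfK.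
by move=> [-> _]; rewrite divfK.
Qed.

End borel.

(** * Euclidean geometry *)

Section dot_theory.
Context {R : realType} {d : nat}.
Implicit Types (u v w : 'rV[R]_d) (a : R).

Lemma dotE u v : dot u v = (u *m v^T) 0 0.
Proof. by rewrite mxE; apply: eq_bigr => k _; rewrite mxE. Qed.

Lemma dotC u v : dot u v = dot v u.
Proof. by apply: eq_bigr => k _; rewrite mulrC. Qed.

Lemma dotDl u v w : dot (u + v) w = dot u w + dot v w.
Proof. by rewrite !dotE mulmxDl mxE. Qed.

Lemma dotDr u v w : dot w (u + v) = dot w u + dot w v.
Proof. by rewrite dotC dotDl !(dotC w). Qed.

Lemma dotZl a u v : dot (a *: u) v = a * dot u v.
Proof. by rewrite !dotE -scalemxAl mxE. Qed.

Lemma dotZr a u v : dot u (a *: v) = a * dot u v.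
Proof. by rewrite dotC dotZl dotC. Qed.

Lemma dotNl u v : dot (- u) v = - dot u v.
Proof. by rewrite -scaleN1r dotZl mulN1r. Qed.

Lemma dotNr u v : dot u (- v) = - dot u v.
Proof. by rewrite dotC dotNl dotC. Qed.

Lemma dotBl u v w : dot (u - v) w = dot u w - dot v w.
Proof. by rewrite dotDl dotNl. Qed.

Lemma dotBr u v w : dot w (u - v) = dot w u - dot w v.
Proof. by rewrite dotDr dotNr. Qed.

Lemma dot0l v : dot 0 v = 0.
Proof. by rewrite -(scale0r 0) dotZl mul0r. Qed.

Lemma dot0r v : dot v 0 = 0.
Proof. by rewrite dotC dot0l. Qed.

Lemma dot_suml (I : Type) (r : seq I) (P : pred I) (F : I -> 'rV[R]_d) v :
  dot (\sum_(i <- r | P i) F i) v = \sum_(i <- r | P i) dot (F i) v.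
Proof.
by elim/big_rec2: _ => [|i x y _ <-]; rewrite ?dot0l// dotDl.
Qed.

Lemma dot_sumr (I : Type) (r : seq I) (P : pred I) (F : I -> 'rV[R]_d) v :
  dot v (\sum_(i <- r | P i) F i) = \sum_(i <- r | P i) dot v (F i).
Proof. by rewrite dotC dot_suml; apply: eq_bigr => i _; rewrite dotC. Qed.

Lemma dot_mulmx u v (A : 'M[R]_d) : dot (u *m A) v = dot u (v *m A^T).
Proof. by rewrite !dotE trmx_mul trmxK mulmxA. Qed.

Lemma dot_ge0 u : 0 <= dot u u.
Proof. by apply: sumr_ge0 => i _; rewrite -expr2 sqr_ge0. Qed.

Lemma dot_eq0 u : (dot u u == 0) = (u == 0).
Proof.
apply/idP/eqP => [|->]; last by rewrite dot0l.
rewrite psumr_eq0; last by move=> i _; rewrite -expr2 sqr_ge0.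
move/allP => h; apply/rowP => i; rewrite mxE; apply/eqP.
by have := h i (mem_index_enum i); rewrite /= mulf_eq0 orbb.
Qed.

Lemma dot_gt0 u : (0 < dot u u) = (u != 0).
Proof. by rewrite lt_neqAle dot_ge0 andbT eq_sym dot_eq0. Qed.

Lemma enorm_ge0 u : 0 <= enorm u.
Proof. exact: sqrtr_ge0. Qed.

Lemma sqr_enorm u : enorm u ^+ 2 = dot u u.
Proof. by rewrite sqr_sqrtr// dot_ge0. Qed.

Lemma enorm_eq0 u : (enorm u == 0) = (u == 0).
Proof. by rewrite sqrtr_eq0 -dot_eq0 eq_le dot_ge0 andbT. Qed.

Lemma enorm_gt0 u : (0 < enorm u) = (u != 0).
Proof. by rewrite lt_neqAle enorm_ge0 andbT eq_sym enorm_eq0. Qed.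

Lemma enormZ a u : enorm (a *: u) = `|a| * enorm u.
Proof. by rewrite /enorm dotZl dotZr mulrA -expr2 sqrtrM ?sqr_ge0// sqrtr_sqr. Qed.

Lemma dot_le_enorm u v : dot u v <= enorm u * enorm v.
Proof.
have [->|u0] := eqVneq u 0.
  by rewrite dot0l mulr_ge0// enorm_ge0.
have n0 : 0 < enorm u by rewrite enorm_gt0.
have [->|v0] := eqVneq v 0.
  by rewrite dot0r mulr_ge0// enorm_ge0.
have m0 : 0 < enorm v by rewrite enorm_gt0.
have := dot_ge0 (enorm v *: u - enorm u *: v).
rewrite dotBl !dotBr !dotZl !dotZr -!sqr_enorm (dotC v u).
set a := enorm u; set b := enorm v; set s := dot u v => h.
have ab : 0 < a * b by rewrite mulr_gt0.
rewrite -(ler_pM2l ab) -subr_ge0.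
rewrite (_ : _ - _ = (b * (b * a ^+ 2) - b * (a * s) - (a * (b * s) - a * (a * b ^+ 2))) / 2).
  by rewrite divr_ge0.
by field.
Qed.

Lemma normr_dot_le u v : `|dot u v| <= enorm u * enorm v.
Proof.
rewrite ler_norml dot_le_enorm andbT lerNl -dotNl.
by apply: (le_trans (dot_le_enorm _ _)); rewrite -scaleN1r enormZ normrN1 mul1r.
Qed.

End dot_theory.

Lemma dot_continuous {R : realType} {d : nat} (u : 'rV[R]_d) : continuous (dot u).
Proof.
move=> x.
apply: (@cvg_big R 'I_d +%R 0 xpredT add_continuous _ (nbhs x) (index_enum _)
  (fun k y => u 0 k * y 0 k) (fun k => u 0 k * x 0 k)) => k _.
by apply: cvgM; [exact: cvg_cst | exact: coord_continuous].
Qed.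

(** * Barycentric coordinates *)

Section bary_theory.
Context {R : realType} {d : nat}.
Variable p : 'I_d.+1 -> 'rV[R]_d.
Hypothesis pU : affinely_independent p.
Implicit Types (x y : 'rV[R]_d) (i j : 'I_d.+1).

Let bcol i : 'cV[R]_d := dsubmx (col i (invmx (vertex_mx p)) : 'cV[R]_(1 + d)).

Lemma bary_sub_bcol i x y : bary p i x - bary p i y = ((x - y) *m bcol i) 0 0.
Proof.
rewrite /bary.
have E z : ((row_mx 1 z : 'rV[R]_d.+1) *m invmx (vertex_mx p)) 0 i =
    usubmx (col i (invmx (vertex_mx p)) : 'cV[R]_(1 + d)) 0 0 + (z *m bcol i) 0 0.
  transitivity ((row_mx 1 z *m (col i (invmx (vertex_mx p)) : 'cV[R]_(1 + d))) 0 0).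
    by rewrite [LHS]mxE [RHS]mxE; apply: eq_bigr => k _; congr (_ * _); rewrite [RHS]mxE.
  by rewrite -[col i _ in LHS](@vsubmxK _ 1 d 1) mul_row_col mul1mx mxE.
by rewrite !E mulmxBl [in RHS]mxE [X in _ = _ + X]mxE; ring.
Qed.

(** The difference quotients of an affine function are constant. *)
Lemma bary_derive i x v : 'D_v (bary p i) x = (v *m bcol i) 0 0.
Proof.
apply: cvg_lim => //; apply: cvg_near_cst.
near=> h.
have h0 : h != 0 by near: h; exact: nbhs_dnbhs_neq.
rewrite bary_sub_bcol /= addrK -scalemxAl mxE /GRing.scale/=.
by rewrite mulKf.
Unshelve. all: by end_near. Qed.

Lemma bary_grad_bcol i : bary_grad p i = (bcol i)^T.
Proof.
apply/rowP => k; rewrite /bary_grad /grad mxE bary_derive [RHS]mxE.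
by rewrite -rowE mxE.
Qed.

Lemma bary_sub i x y : bary p i x - bary p i y = dot (bary_grad p i) (x - y).
Proof. by rewrite bary_sub_bcol bary_grad_bcol dotC dotE trmxK. Qed.


Lemma bary_continuous i : continuous (bary p i).
Proof.
rewrite (_ : bary p i = fun x => dot (bary_grad p i) x + bary p i 0).
  by move=> x; apply: continuousD; [exact: dot_continuous | exact: cst_continuous].
by apply/funext => x; rewrite -[in LHS](subr0 x) -(subrK (bary p i 0) (bary p i _)) bary_sub !subr0.
Qed.

Lemma bary_lin (t : R) i x y :
  bary p i (x + t *: (y - x)) = bary p i x + t * (bary p i y - bary p i x).
Proof.
have := bary_sub i (x + t *: (y - x)) x.
by rewrite addrAC subrr add0r dotZr -bary_sub => /eqP; rewrite subr_eq [X in _ == X]addrC => /eqP.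
Qed.

Lemma bary_sum_vertex x : \sum_i bary p i x = 1 /\ x = \sum_i bary p i x *: p i.
Proof.
pose w : 'rV[R]_d.+1 := (row_mx 1 x : 'rV[R]_d.+1) *m invmx (vertex_mx p).
have wE : w *m vertex_mx p = row_mx 1 x by rewrite mulmxKV.
have : row_mx (w *m (const_mx 1 : 'cV_d.+1)) (w *m (\matrix_i p i)) = row_mx 1 x.
  by rewrite -mul_mx_row.
move/eq_row_mx => [/matrixP/(_ 0 0) h1 h2]; split.
  have e1 : (1%:M : 'M[R]_1) 0 0 = 1 by rewrite mxE eqxx.
  by move: h1; rewrite [X in _ = X]e1 [LHS]mxE => <-; apply: eq_bigr => j _; rewrite [X in _ * X]mxE mulr1.
rewrite -{1}h2 mulmx_sum_row; apply: eq_bigr => j _; rewrite rowK.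
by [].
Qed.

Lemma sum_bary1 x : \sum_i bary p i x = 1.
Proof. by have [] := bary_sum_vertex x. Qed.

Lemma bary_combination x : x = \sum_i bary p i x *: p i.
Proof. by have [] := bary_sum_vertex x. Qed.

Lemma bary_inj x y : (forall i, bary p i x = bary p i y) -> x = y.
Proof.
move=> h; rewrite (bary_combination x) (bary_combination y).
by apply: eq_bigr => i _; rewrite h.
Qed.

Lemma sum_bary_grad : \sum_i bary_grad p i = 0.
Proof.
apply/eqP; rewrite -dot_eq0; apply/eqP; set q := \sum_i _.
have : \sum_i (bary p i q - bary p i 0) = 0 by rewrite sumrB !sum_bary1 subrr.
by under eq_bigr do rewrite bary_sub subr0; rewrite -dot_suml.
Qed.

Lemma simplexP x : simplex p x <-> forall i, 0 <= bary p i x.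
Proof.
split=> [[w [w0 _ w1 ->] i]|h]; first by rewrite bary_convex_combination.
exists (bary p ^~ x); split => //; first by move=> i; rewrite inE.
  exact: sum_bary1.
exact: bary_combination.
Qed.

Lemma bary_le1 i x : simplex p x -> bary p i x <= 1.
Proof.
move/simplexP => h; rewrite -(sum_bary1 x) (bigD1 i)//= lerDl.
by apply: sumr_ge0 => j _; exact: h.
Qed.

Lemma simplex_vertex i : simplex p (p i).
Proof. by apply/simplexP => j; rewrite bary_vertex// ler0n. Qed.

Lemma simplex_segment t x y : 0 <= t <= 1 -> simplex p x -> simplex p y ->
  simplex p (x + t *: (y - x)).
Proof.
move=> /andP[t0 t1] /simplexP hx /simplexP hy; apply/simplexP => i.
rewrite bary_lin; have := mulr_ge0 t0 (hy i).
by have := mulr_ge0 (_ : 0 <= 1 - t) (hx i); rewrite subr_ge0 => /(_ t1); lra.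
Qed.

Lemma simplex_closed : closed (simplex p).
Proof.
rewrite (_ : simplex p = \bigcap_(i in [set: 'I_d.+1]) [set x | 0 <= bary p i x]).
  apply: closed_bigI => i _.
  apply: (@preimage_closed _ _ (bary p i) [set y | 0 <= y]); last exact: closed_ge.
  by move=> x _; exact: bary_continuous.
by apply/seteqP; split => x; [move=> /simplexP h i _; exact: h | move=> h; apply/simplexP => i; exact: h].
Qed.

Lemma simplex_norm_le x : simplex p x -> `|x| <= \sum_i `|p i|.
Proof.
move=> Kx; rewrite {1}(bary_combination x); apply: (le_trans (ler_norm_sum _ _ _)).
apply: ler_sum => i _; rewrite normrZ ler_piMl// ger0_norm ?bary_le1//.
by move/simplexP : Kx.
Qed.

Lemma simplex_compact : compact (simplex p).
Proof.
apply: bounded_closed_compact; last exact: simplex_closed.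
exists (\sum_i `|p i|); split; first by rewrite num_real.
by move=> M hM x /simplex_norm_le /le_trans; apply; exact: ltW.
Qed.

Lemma near_bary_gt0 i x : 0 < bary p i x -> \forall y \near x, 0 < bary p i y.
Proof.
move=> h; have : nbhs (bary p i x) [set u | 0 < u].
  by apply: (@open_nbhs_nbhs _ (bary p i x)); split => //; exact: open_gt.
exact: bary_continuous.
Qed.

Lemma simplex_near x : (forall i, 0 < bary p i x) -> nbhs x (simplex p).
Proof.
move=> h; have : \forall y \near x, forall i, 0 < bary p i y.
  apply: (@filter_forall _ _ (fun i y => 0 < bary p i y) (nbhs x)) => i.
  exact: near_bary_gt0.
by apply: filterS => y hy; apply/simplexP => i; exact/ltW.
Qed.

Definition centroid : 'rV[R]_d := \sum_i d.+1%:R^-1 *: p i.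

Lemma bary_centroid i : bary p i centroid = d.+1%:R^-1.
Proof.
rewrite (bary_convex_combination (w := fun=> d.+1%:R^-1))// sumr_const card_ord.
by rewrite -[LHS]mulr_natr mulVf// pnatr_eq0.
Qed.

(** The points with positive barycentric coordinates are dense: every segment
    to the centroid enters them at once. *)
Lemma simplex_dense (G : 'rV[R]_d -> R) x : {within simplex p, continuous G} ->
  simplex p x -> (forall y, (forall i, 0 < bary p i y) -> G y = 0) -> G x = 0.
Proof.
move=> cG Kx G0.
apply/eqP/negPn/negP => Gx0.
have : \forall y \near x, simplex p y -> G y != 0.
  have cGx : G y @[y --> within (simplex p) (nbhs x)] --> G x.
    by move/subspace_continuousP : cG; exact.
  have : nbhs (G x) [set u | u != 0].
    by apply: (@open_nbhs_nbhs _ (G x) [set u | u != 0]); split => //; exact: open_neq.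
  exact: cGx.
move=> /nbhs_ballP[r /= r0 rG].
(* this t is at most 1 and keeps the point within distance r of x *)
pose t := r / (r + `|centroid - x|).
have rc : 0 < r + `|centroid - x| by rewrite ltr_wpDr.
have t0 : 0 < t by rewrite divr_gt0.
have t1 : t <= 1 by rewrite ler_pdivrMr// mul1r lerDl.
pose y := x + t *: (centroid - x).
have y0 i : 0 < bary p i y.
  rewrite bary_lin bary_centroid.
  have := mulr_ge0 (_ : 0 <= 1 - t) ((simplexP x).1 Kx i).
  rewrite subr_ge0 => /(_ t1); have : 0 < t * d.+1%:R^-1 by rewrite mulr_gt0.
  by rewrite mulrBr; move: (_^-1) => c; lra.
have xy : ball x r y.
  rewrite mx_norm_ball /ball_/= opprD addrA subrr sub0r normrN normrZ.
  rewrite gtr0_norm// /t mulrAC ltr_pdivrMr// ltr_pM2l// ltrDr//.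
have /(rG _ xy) : simplex p y by apply/simplexP => i; exact/ltW.
by rewrite G0// eqxx.
Qed.

End bary_theory.

(** * Integrals of continuous functions over compact sets *)

Section continuity.
Context {R : realType} {d : nat}.
Variable A : set 'rV[R]_d.
Implicit Types f g : 'rV[R]_d -> R.

Lemma within_cst (k : R) : {within A, continuous (fun=> k)}.
Proof. by apply: continuous_subspaceT; exact: cst_continuous. Qed.

Lemma within_add f g : {within A, continuous f} -> {within A, continuous g} ->
  {within A, continuous (fun x => f x + g x)}.
Proof. by move=> cf cg x; apply: continuousD; [exact: cf | exact: cg]. Qed.

Lemma within_mul f g : {within A, continuous f} -> {within A, continuous g} ->
  {within A, continuous (fun x => f x * g x)}.
Proof. by move=> cf cg x; apply: continuousM; [exact: cf | exact: cg]. Qed.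

Lemma within_opp f : {within A, continuous f} ->
  {within A, continuous (fun x => - f x)}.
Proof. by move=> cf x; apply: continuousN; exact: cf. Qed.

Lemma within_sub f g : {within A, continuous f} -> {within A, continuous g} ->
  {within A, continuous (fun x => f x - g x)}.
Proof. by move=> cf cg; apply: within_add => //; exact: within_opp. Qed.

Lemma within_sum (I : Type) (r : seq I) (P : pred I) (F : I -> 'rV[R]_d -> R) :
  (forall i, P i -> {within A, continuous (F i)}) ->
  {within A, continuous (fun x => \sum_(i <- r | P i) F i x)}.
Proof.
move=> cF; elim: r => [|i r IH].
  by under eq_fun do rewrite big_nil; exact: within_cst.
under eq_fun do rewrite big_cons.
have [Pi|nPi] := boolP (P i); rewrite ?(negbTE nPi)//=.
by apply: within_add => //; exact: cF.
Qed.

Lemma within_dot (b : 'rV[R]_d -> 'rV[R]_d) (u : 'rV[R]_d) :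
  {within A, continuous b} -> {within A, continuous (fun x => dot (b x) u)}.
Proof.
move=> cb; rewrite (_ : (fun x => _) = (fun x => dot u x) \o b).
  by move=> x; apply: (continuous_comp (cb x)); exact: dot_continuous.
by apply/funext => x /=; rewrite dotC.
Qed.

Lemma within_enorm (b : 'rV[R]_d -> 'rV[R]_d) :
  {within A, continuous b} -> {within A, continuous (fun x => enorm (b x))}.
Proof.
move=> cb.
have cq : {within A, continuous (fun x => dot (b x) (b x))}.
  apply: within_sum => k _.
  have ck : {within A, continuous (fun x => b x 0 k)}.
    by move=> x; exact: (@continuous_comp (subspace A) _ _ b (fun M : 'rV[R]_d => M 0 k) x (cb x)
      (@coord_continuous _ _ _ _ _ _)).
  exact: within_mul.
by move=> x; exact: (@continuous_comp (subspace A) _ _ (fun x => dot (b x) (b x))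
  Num.sqrt x (cq x) (@sqrt_continuous _ _)).
Qed.

End continuity.

Section compact_integral.
Context {R : realType} {d : nat}.
Local Notation T n := (n.-tuple (measurableTypeR R)).
Local Notation mu := (lebesgue_tuple d).
Variable A : set 'rV[R]_d.
Hypothesis cA : compact A.
Implicit Types f g : 'rV[R]_d -> R.

Let clA : closed A.
Proof. by apply: compact_closed => //; exact: norm_hausdorff. Qed.

Lemma measurable_compact : measurable (point_of_tuple @^-1` A : set (T d)).
Proof.
rewrite -[X in measurable X]setCK; apply: measurableC.
by rewrite preimage_setC; apply: measurable_preimage_open; exact: closed_openC.
Qed.

Lemma lebesgue_tuple_compact : (mu (point_of_tuple @^-1` A) < +oo)%E.
Proof.
have [M [_ hM]] := compact_bounded cA.
apply: (@lebesgue_tuple_bounded _ _ _ (M + 1)); last exact: measurable_compact.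
by move=> x Ax; apply: hM => //; rewrite ltrDl.
Qed.

Lemma compact_measurable_fun f : {within A, continuous f} ->
  measurable_fun (point_of_tuple @^-1` A : set (T d)) (f \o point_of_tuple).
Proof.
move=> /continuousP cf.
apply: (measurability _ (RGenOInfty.measurableE R)) => //.
move=> /= _ [_ [a ->] <-].
have /open_subspaceP[V oV VA] : open (f @^-1` `]a, +oo[%classic : set (subspace A)).
  by apply: cf; exact: interval_open.
rewrite (_ : _ `&` _ = point_of_tuple @^-1` A `&` point_of_tuple @^-1` V).
  by apply: measurableI; [exact: measurable_compact | exact: measurable_preimage_open].
rewrite -preimage_setI setIC [X in _ = _ @^-1` X]setIC VA.
by [].
Qed.

Lemma compact_integrable f : {within A, continuous f} ->
  mu.-integrable (point_of_tuple @^-1` A) (EFin \o (f \o point_of_tuple)).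
Proof.
move=> cf; apply: measurable_bounded_integrable.
- exact: measurable_compact.
- exact: lebesgue_tuple_compact.
- exact: compact_measurable_fun.
have [M [Mr hM]] := compact_bounded (continuous_compact cf cA).
exists M; split => // y /hM {}hM t /= At; apply: hM.
by exists (point_of_tuple t).
Qed.

Lemma integral_onD f g : {within A, continuous f} -> {within A, continuous g} ->
  integral_on A (fun x => f x + g x) = integral_on A f + integral_on A g.
Proof.
move=> cf cg; apply: RintegralD; first exact: measurable_compact.
  exact: compact_integrable.
exact: compact_integrable.
Qed.

Lemma integral_onZ k f : {within A, continuous f} ->
  integral_on A (fun x => k * f x) = k * integral_on A f.
Proof.
by move=> cf; apply: RintegralZl; [exact: measurable_compact | exact: compact_integrable].
Qed.

Lemma integral_onB f g : {within A, continuous f} -> {within A, continuous g} ->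
  integral_on A (fun x => f x - g x) = integral_on A f - integral_on A g.
Proof.
move=> cf cg; apply: RintegralB; first exact: measurable_compact.
  exact: compact_integrable.
exact: compact_integrable.
Qed.

Lemma eq_integral_on f g : (forall x, A x -> f x = g x) ->
  integral_on A f = integral_on A g.
Proof.
move=> fg; apply: eq_Rintegral => t; rewrite inE => At; exact: fg.
Qed.

Lemma integral_on_cst k : integral_on A (fun=> k) = k * volume A.
Proof. by rewrite /integral_on Rintegral_cst//; exact: measurable_compact. Qed.

Lemma integral_on_sum (I : Type) (r : seq I) (P : pred I) (F : I -> 'rV[R]_d -> R) :
  (forall i, P i -> {within A, continuous (F i)}) ->
  integral_on A (fun x => \sum_(i <- r | P i) F i x) =
  \sum_(i <- r | P i) integral_on A (F i).
Proof.
move=> cF; elim: r => [|i r IH].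
  rewrite big_nil -[RHS](mul0r (volume A)) -integral_on_cst.
  by apply: eq_integral_on => x _; rewrite big_nil.
rewrite big_cons -IH; have [Pi|nPi] := boolP (P i).
  rewrite -integral_onD; [|exact: cF|exact: within_sum].
  by apply: eq_integral_on => x _; rewrite big_cons Pi.
by apply: eq_integral_on => x _; rewrite big_cons (negbTE nPi).
Qed.

Lemma le_integral_on f g : {within A, continuous f} -> {within A, continuous g} ->
  (forall x, A x -> f x <= g x) -> integral_on A f <= integral_on A g.
Proof.
move=> cf cg fg; apply: le_Rintegral; first exact: measurable_compact.
- exact: compact_integrable.
- exact: compact_integrable.
- by move=> t At; exact: fg.
Qed.

Lemma integral_on_ge0 f : (forall x, A x -> 0 <= f x) -> 0 <= integral_on A f.
Proof. by move=> f0; apply: Rintegral_ge0 => t At; exact: f0. Qed.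

Lemma EFin_integral_on f : {within A, continuous f} ->
  (integral_on A f)%:E =
  (\int[mu]_(t in point_of_tuple @^-1` A) (f (point_of_tuple t))%:E)%E.
Proof.
move=> cf; rewrite /integral_on /Rintegral fineK//.
by apply: integrable_fin_num; [exact: measurable_compact | exact: compact_integrable].
Qed.

(** A positive value persists on a ball, which has positive measure. *)
Lemma integral_on_eq0_interior f x : {within A, continuous f} ->
  (forall y, A y -> 0 <= f y) -> integral_on A f = 0 -> nbhs x A -> f x = 0.
Proof.
move=> cf f0 If nA; have Ax : A x by exact: nbhs_singleton.
apply/eqP/negPn/negP => fx.
have fx0 : 0 < f x by rewrite lt_neqAle eq_sym fx f0.
have : \forall y \near x, A y -> f x / 2 < f y.
  have cfx : f y @[y --> within A (nbhs x)] --> f x.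
    by move/subspace_continuousP : cf; exact.
  have : nbhs (f x) [set u | f x / 2 < u].
    apply: (@open_nbhs_nbhs _ (f x)); split; first exact: open_gt.
    by rewrite /= ltr_pdivrMr// mulr_natr mulr2n ltrDr.
  exact: cfx.
move=> h; have /(nbhs_ballP x)[r /= r0 rB] : nbhs x (A `&` [set y | A y -> f x / 2 < f y]) by exact: filterI.
pose B := point_of_tuple @^-1` (ball x r) : set (T d).
have mB : measurable B by exact: measurable_preimage_ball.
have B0 : (0 < mu B)%E by apply: (lebesgue_tuple_ball_gt0 r0 (@subset_refl _ _)).
have I0 := EFin_integral_on cf.
have : (\int[mu]_(t in B) (cst (f x / 2)%:E) t <= 0)%E.
  rewrite -[X in (_ <= X)%E]/(0%:E) -If I0.
  apply: (@le_trans _ _ (\int[mu]_(t in B) (f (point_of_tuple t))%:E)%E).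
    apply: ge0_le_integral => //.
    - by move=> t _; rewrite lee_fin divr_ge0// ltW.
    - apply/measurable_EFinP.
      apply: (measurable_funS _ _ (compact_measurable_fun cf)); first exact: measurable_compact.
      by move=> t /rB[].
    - by move=> t /rB[? /(_ _)]; rewrite lee_fin => /(_ _)/ltW; exact.
  apply: ge0_subset_integral => //; first exact: measurable_compact.
  - by apply/measurable_EFinP; exact: compact_measurable_fun.
  - by move=> t At; rewrite lee_fin f0.
  - by move=> t /rB[].
rewrite integral_cst// leNgt mule_gt0// lte_fin divr_gt0//.
Qed.

End compact_integral.

(** * Moments of the barycentric coordinates *)

Section simplex_map.
Context {R : realType} {d : nat}.
Local Notation T n := (n.-tuple (measurableTypeR R)).
Implicit Types p q : 'I_d.+1 -> 'rV[R]_d.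

(** If the vertices of a nondegenerate simplex are affine combinations of the
    points q, then the vertex matrix of q is a factor of an invertible one. *)
Lemma affinely_independent_span p q (A : 'M[R]_d.+1) : affinely_independent p ->
  (forall i, \sum_j A i j = 1) -> (forall i, p i = \sum_j A i j *: q j) ->
  affinely_independent q.
Proof.
move=> pU A1 pE.
suff E : vertex_mx p = A *m vertex_mx q.
  by move: pU; rewrite /affinely_independent E unitmx_mul => /andP[].
rewrite [RHS](mul_mx_row A (const_mx 1 : 'cV_d.+1)).
apply: (congr2 (@row_mx R d.+1 1 d)).
  apply/matrixP => i k; rewrite !mxE -[LHS](A1 i).
  by apply: eq_bigr => j _; rewrite !mxE mulr1.
apply/matrixP => i k; rewrite !mxE pE summxE.
by apply: eq_bigr => j _; rewrite !mxE.
Qed.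

(** The affine map that sends the vertices of p to those of q. *)
Definition simplex_map p q (x : 'rV[R]_d) : 'rV[R]_d := \sum_k bary p k x *: q k.

Lemma bary_simplex_map p q k x : affinely_independent p -> affinely_independent q ->
  bary q k (simplex_map p q x) = bary p k x.
Proof. by move=> pU qU; rewrite bary_convex_combination// sum_bary1. Qed.

Lemma simplex_map_simplex p q : affinely_independent p -> affinely_independent q ->
  simplex_map p q @^-1` simplex q = simplex p.
Proof.
move=> pU qU; apply/seteqP; split => x /=.
  by move=> /(simplexP qU) h; apply/simplexP => // i; rewrite -(bary_simplex_map i x pU qU).
by move=> /(simplexP pU) h; apply/simplexP => // i; rewrite bary_simplex_map.
Qed.

(** The linear part is injective because barycentric coordinates are transported
    unchanged. *)
Lemma simplex_map_affine p q : affinely_independent p -> affinely_independent q ->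
  exists2 M : 'M[R]_d, M \in unitmx &
  exists v, forall x, simplex_map p q x = x *m M + v.
Proof.
move=> pU qU; pose M := \sum_k (bary_grad p k)^T *m q k.
have ME x y : simplex_map p q x - simplex_map p q y = (x - y) *m M.
  rewrite /simplex_map -sumrB /M mulmx_sumr; apply: eq_bigr => k _.
  rewrite -scalerBl bary_sub dotC dotE mulmxA.
  by rewrite [X in _ = X *m _]mx11_scalar mul_scalar_mx.
exists M; last first.
  by exists (simplex_map p q 0) => x; rewrite -{2}(subr0 x) -ME subrK.
rewrite -row_free_unit; apply: inj_row_free => v vM.
have : simplex_map p q v = simplex_map p q 0.
  by apply/eqP; rewrite -subr_eq0 ME subr0 vM.
move=> h; apply: (bary_inj pU) => i.
by rewrite -!(bary_simplex_map i _ pU qU) h.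
Qed.

Lemma simplex_volume_gt0 p : affinely_independent p -> 0 < volume (simplex p).
Proof.
move=> pU; have mK := measurable_compact (simplex_compact pU).
have fK := lebesgue_tuple_compact (simplex_compact pU).
apply: fine_gt0; rewrite fK andbT.
have /nbhs_ballP[r /= r0 rK] : nbhs (centroid p) (simplex p).
  by apply: simplex_near => // i; rewrite bary_centroid// invr_gt0.
exact: (lebesgue_tuple_ball_gt0 r0 rK).
Qed.

Lemma simplex_change_of_variables p q :
  affinely_independent p -> affinely_independent q ->
  exists2 c : R, 0 < c & forall G : 'rV[R]_d -> R,
    {within simplex q, continuous G} -> (forall x, simplex q x -> 0 <= G x) ->
    integral_on (simplex p) (G \o simplex_map p q) = c * integral_on (simplex q) G.
Proof.
move=> pU qU; have [M Mu [v ME]] := simplex_map_affine pU qU.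
have [c c0 cE] := scaling_unitmx Mu; exists c => // G cG G0.
have mq := measurable_compact (simplex_compact qU).
have mG := compact_measurable_fun (simplex_compact qU) cG.
have mf := measurable_affine_map M v.
have vE t : point_of_tuple (affine_map M v t) = simplex_map p q (point_of_tuple t).
  by rewrite /affine_map tuple_of_pointK ME.
rewrite /integral_on /Rintegral.
rewrite -[X in X * _]/(fine c%:E) -fineM//; last first.
  apply: integrable_fin_num => //.
  exact: (compact_integrable (simplex_compact qU) cG).
congr fine.
rewrite -(ge0_integral_mscale _ _ (NngNum (ltW c0)))//; last 2 first.
- exact/measurable_EFinP.
- by move=> t At; rewrite lee_fin G0.
transitivity (\int[pushforward (lebesgue_tuple d) (affine_map M v)]_(t in
    point_of_tuple @^-1` simplex q) (G (point_of_tuple t))%:E)%E.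
  rewrite ge0_integral_pushforward//; last 2 first.
  - exact/measurable_EFinP.
  - by move=> t; rewrite inE => At; rewrite lee_fin G0.
  rewrite -(simplex_map_simplex pU qU) -comp_preimage.
  rewrite [X in (\int[_]_(_ in X) _)%E](_ : _ =
     affine_map M v @^-1` (point_of_tuple @^-1` simplex q)).
    by apply: eq_integral => t _ /=; rewrite vE.
  by apply/seteqP; split => t /=; rewrite vE.
apply: eq_measure_integral => B mB _.
exact: cE.
Qed.

End simplex_map.

Section moments.
Context {R : realType} {d : nat}.
Variable p : 'I_d.+1 -> 'rV[R]_d.
Hypothesis pU : affinely_independent p.
Local Notation K := (simplex p).
Local Notation I := (integral_on K).
Local Notation T n := (n.-tuple (measurableTypeR R)).

Let cb i : {within K, continuous (bary p i)}.
Proof. by apply: continuous_subspaceT; exact: bary_continuous. Qed.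

(** Exchanging two vertices preserves the simplex, hence the volume. *)
Lemma integral_on_swap i j (G : 'rV[R]_d -> R) (G' : 'rV[R]_d -> R) :
  {within K, continuous G} -> (forall x, K x -> 0 <= G x) ->
  (forall x, G' x = G (simplex_map p (p \o tperm i j) x)) ->
  I G' = I G.
Proof.
move=> cG G0 G'E; set q := p \o tperm i j.
have qU : affinely_independent q.
  apply: (@affinely_independent_span _ _ p q (\matrix_(k, l) (l == tperm i j k)%:R)) => //.
    move=> k; rewrite (bigD1 (tperm i j k))//= mxE eqxx big1 ?addr0// => l /negbTE h.
    by rewrite mxE h.
  move=> k; rewrite (bigD1 (tperm i j k))//= mxE eqxx scale1r big1 ?addr0.
    by rewrite /q /= tpermK.
  by move=> l /negbTE h; rewrite mxE h scale0r.
have bq k x : bary q k x = bary p (tperm i j k) x.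
  rewrite {1}(bary_combination pU x) (reindex_inj (@perm_inj _ (tperm i j))) /=.
  rewrite (bary_convex_combination (w := fun l => bary p (tperm i j l) x))//.
  by rewrite -[RHS](sum_bary1 pU x) [RHS](reindex_perm (tperm i j)).
have qK : simplex q = K.
  apply/seteqP; split => x.
    by move=> /(simplexP qU) h; apply/simplexP => // k; have := h (tperm i j k); rewrite bq tpermK.
  by move=> /(simplexP pU) h; apply/simplexP => // k; rewrite bq.
have [c c0 cE] := simplex_change_of_variables pU qU.
have c1 : c = 1.
  have := cE (fun=> 1) (@within_cst _ _ _ _) (fun _ _ => ler01).
  rewrite qK /comp (integral_on_cst (simplex_compact pU)) => /eqP.
  by rewrite -subr_eq0 -{1}[_ * volume _]mul1r -mulrBl mulf_eq0 mul1r (gt_eqF (simplex_volume_gt0 pU)) orbF subr_eq0 => /eqP.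
have := cE G; rewrite qK c1 mul1r => <-//.
by apply: eq_integral_on => x _; rewrite G'E.
Qed.

Section bisection.
Variables (i j : 'I_d.+1).
Hypothesis ij : i != j.

(** The half of the simplex on the side of the vertex i of the hyperplane that
    bisects the edge from i to j. *)
Definition half_simplex k : 'rV[R]_d :=
  if k == j then 2^-1 *: (p i + p j) else p k.

Lemma half_simplex_indep : affinely_independent half_simplex.
Proof.
pose A : 'M[R]_d.+1 :=
  \matrix_(k, l) if k == j then 2 * (l == j)%:R - (l == i)%:R else (l == k)%:R.
have S (V : lmodType R) (F : 'I_d.+1 -> V) l : \sum_k (k == l)%:R *: F k = F l.
  rewrite (bigD1 l)//= eqxx scale1r big1 ?addr0// => k /negbTE ->.
  by rewrite scale0r.
have S1 l : \sum_k (k == l)%:R = 1 :> R.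
  by rewrite (bigD1 l)//= eqxx big1 ?addr0// => k /negbTE ->.
apply: (@affinely_independent_span _ _ p _ A) => // k.
  under eq_bigr do rewrite mxE; have [_|_] := eqVneq k j; last exact: S1.
  by rewrite sumrB -mulr_sumr !S1; ring.
under eq_bigr do rewrite mxE; have [->|kj] := eqVneq k j.
  under eq_bigr do rewrite scalerBl -scalerA.
  rewrite sumrB -scaler_sumr !S /half_simplex eqxx (negbTE ij).
  by rewrite scalerA mulfV ?pnatr_eq0// scale1r addrAC subrr add0r.
by rewrite S /half_simplex (negbTE kj).
Qed.

Lemma sum_pick (V : zmodType) (F : 'I_d.+1 -> V) :
  \sum_k F k = F i + F j + \sum_(k | (k != i) && (k != j)) F k.
Proof.
rewrite (bigD1 i)//= (bigD1 j) /=; last by rewrite eq_sym.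
by rewrite addrA.
Qed.

Lemma bary_half k x : bary half_simplex k x =
  if k == j then 2 * bary p j x else
  if k == i then bary p i x - bary p j x else bary p k x.
Proof.
pose w k := if k == j then 2 * bary p j x else
  if k == i then bary p i x - bary p j x else bary p k x.
have ji : (j == i) = false by rewrite eq_sym (negbTE ij).
have wi : w i = bary p i x - bary p j x by rewrite /w eqxx (negbTE ij).
have wj : w j = 2 * bary p j x by rewrite /w eqxx.
have wk l : (l != i) && (l != j) -> w l = bary p l x.
  by rewrite /w => /andP[/negbTE -> /negbTE ->].
have w1 : \sum_k w k = 1.
  rewrite -[RHS](sum_bary1 pU x) !sum_pick wi wj (eq_bigr _ wk).
  by congr (_ + _); ring.
rewrite -[RHS]/(w k) -(bary_convex_combination k half_simplex_indep w1).
congr bary; rewrite {1}(bary_combination pU x) !sum_pick wi wj.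
rewrite [in RHS](eq_bigr (fun k => bary p k x *: p k)); last first.
  by move=> l lij; rewrite wk// /half_simplex; case/andP: lij => _ /negbTE ->.
congr (_ + _); rewrite /half_simplex eqxx (negbTE ij).
rewrite scalerA -mulrA mulrC -mulrA mulVf ?pnatr_eq0// mulr1 scalerDr scalerBl.
by rewrite addrA subrK.
Qed.

Lemma half_simplexE :
  simplex half_simplex = K `&` [set x | bary p j x <= bary p i x].
Proof.
have ji : (j == i) = false by rewrite eq_sym (negbTE ij).
apply/seteqP; split => x.
  move=> /(simplexP half_simplex_indep) h.
  have := h j; rewrite bary_half eqxx => hj.
  have := h i; rewrite bary_half eqxx (negbTE ij) => hi.
  split; last by rewrite /= -subr_ge0.
  apply/simplexP => // k; have := h k; rewrite bary_half.
  by have [->|kj] := eqVneq k j; [|have [->|ki] := eqVneq k i => //]; lra.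
move=> [/(simplexP pU) h /= hij]; apply/simplexP; first exact: half_simplex_indep.
move=> k; rewrite bary_half; case: ifPn => _; first by rewrite mulr_ge0.
by case: ifPn => _ //; rewrite subr_ge0.
Qed.

End bisection.

Lemma half_simplex_map i j x : i != j ->
  (bary p i (simplex_map p (half_simplex i j) x) = bary p i x + bary p j x / 2) *
  (bary p j (simplex_map p (half_simplex i j) x) = bary p j x / 2).
Proof.
move=> ij; have hU := half_simplex_indep ij.
set y := simplex_map _ _ x.
have hj : bary p j x = 2 * bary p j y.
  by rewrite -(bary_simplex_map j x pU hU) bary_half// eqxx.
have hi : bary p i x = bary p i y - bary p j y.
  by rewrite -(bary_simplex_map i x pU hU) bary_half// eqxx (negbTE ij).
by rewrite hi hj; split; field.
Qed.

(** The two halves only meet in the hyperplane where the coordinates of i and j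
    agree. *)
Lemma bisector_null i j : i != j ->
  lebesgue_tuple d (point_of_tuple @^-1`
    (simplex (half_simplex i j) `&` simplex (half_simplex j i))) = 0%E.
Proof.
move=> ij; have ji : j != i by rewrite eq_sym.
pose w := bary_grad p i - bary_grad p j.
have w0 : w^T != 0.
  apply: contra_neq (oner_neq0 R) => w0.
  have : dot w (p i - p j) = 0.
    by rewrite dotC dotE w0 mulmx0 mxE.
  rewrite dotBl -!bary_sub !bary_vertex// !eqxx (negbTE ij) (negbTE ji) => h.
  by move: h; rewrite /=; lra.
pose s := (bary p j 0 - bary p i 0) : R.
have mA : measurable (point_of_tuple @^-1`
    (simplex (half_simplex i j) `&` simplex (half_simplex j i)) : set (T d)).
  rewrite preimage_setI; apply: measurableI; apply: measurable_compact;
  exact: (simplex_compact (half_simplex_indep _)).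
apply/eqP; rewrite eq_le measure_ge0 andbT -(hyperplane_null s w0).
apply: le_measure; rewrite ?inE//; first exact: hyperplane_measurable.
move=> t [/=]; rewrite !half_simplexE// => -[_ /= h1] [_ /= h2].
have := bary_sub p i (point_of_tuple t) 0.
have := bary_sub p j (point_of_tuple t) 0.
rewrite !subr0 => ej ei; rewrite /= -dotE dotC dotBl -ei -ej /s.
lra.
Qed.

Lemma bisection i j G : i != j -> {within K, continuous G} ->
  I G = integral_on (simplex (half_simplex i j)) G +
        integral_on (simplex (half_simplex j i)) G.
Proof.
move=> ij cG; have ji : j != i by rewrite eq_sym.
set A := simplex (half_simplex i j); set B := simplex (half_simplex j i).
have hi := half_simplex_indep ij; have hj := half_simplex_indep ji.
have KE : K = A `|` B.
  rewrite /A /B !half_simplexE// -setIUr.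
  apply/seteqP; split => x; last by case.
  by move=> Kx; split => //=; case: (leP (bary p j x) (bary p i x)) => [|/ltW]; [left|right].
have mA := measurable_compact (simplex_compact hi).
have mB := measurable_compact (simplex_compact hj).
rewrite -/A -/B in mA mB.
have iG := compact_integrable (simplex_compact pU) cG.
pose A' : set (T d) := point_of_tuple @^-1` A.
pose B' : set (T d) := point_of_tuple @^-1` B.
have KE' : point_of_tuple @^-1` K = A' `|` B' :> set (T d).
  by rewrite KE preimage_setU.
have BE : B' = (B' `\` A') `|` (A' `&` B').
  apply/seteqP; split => t; last by case => -[].
  by move=> Bt; have [At|nAt] := pselect (A' t); [right|left].
have mN : measurable (A' `&` B') by exact: measurableI.
have mD : measurable (B' `\` A') by exact: measurableD.
have IN : Rintegral (lebesgue_tuple d) (A' `&` B') (G \o point_of_tuple) = 0.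
  rewrite /Rintegral null_set_integral//; last exact: (bisector_null ij).
  apply: measurable_funS (measurable_int _ iG) => //.
    exact: measurable_compact (simplex_compact pU).
  by rewrite KE' => t [? ?]; left.
have IB : Rintegral (lebesgue_tuple d) B' (G \o point_of_tuple) =
          Rintegral (lebesgue_tuple d) (B' `\` A') (G \o point_of_tuple).
  rewrite {1}BE Rintegral_setU ?IN ?addr0//.
    rewrite -BE; apply: integrableS iG => //.
      exact: measurable_compact (simplex_compact pU).
    by rewrite KE' => t ?; right.
  by apply/disj_setPS => t [[_ nA] [At _]]; exact: nA.
have AE : A' `|` B' = A' `|` (B' `\` A').
  by rewrite setDE setUIr setUv setIT.
rewrite [X in _ = _ + X]IB /integral_on KE' AE Rintegral_setU//.
  by rewrite -AE -KE'.
by apply/disj_setPS => t [At [_ nA]]; exact: nA.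
Qed.

Let cbb i j : {within K, continuous (fun x => bary p i x * bary p j x)}.
Proof. by apply: within_mul. Qed.

Let bary_swap i j k x : bary p k (simplex_map p (p \o tperm i j) x) =
  bary p (tperm i j k) x.
Proof.
rewrite /simplex_map (reindex_inj (@perm_inj _ (tperm i j))) /=.
under eq_bigr do rewrite tpermK.
by rewrite bary_convex_combination// -[RHS](sum_bary1 pU x) [RHS](reindex_perm (tperm i j)).
Qed.

(** All the coordinates have the same integral by symmetry, and they add up
    to 1. *)
Lemma integral_bary i : I (bary p i) = volume K / d.+1%:R.
Proof.
have E j : I (bary p j) = I (bary p i).
  apply: (@integral_on_swap i j) => //; first by move=> x /(simplexP pU).
  by move=> x; rewrite bary_swap tpermL.
have : \sum_j I (bary p j) = volume K.
  rewrite -integral_on_sum//; last exact: simplex_compact.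
  rewrite -[RHS]mul1r -(integral_on_cst (simplex_compact pU)).
  by apply: eq_integral_on => x _; rewrite sum_bary1.
under eq_bigr do rewrite E.
by rewrite sumr_const card_ord => <-; rewrite -[X in X / _]mulr_natr mulfK// pnatr_eq0.
Qed.

(** Bisecting an edge expresses the mixed moment X through itself and the pure
    moment Y: X = X / 2 + Y / 4, hence Y = 2 X. *)
Lemma integral_bary_sqr i j : i != j ->
  I (fun x => bary p i x * bary p i x) = 2 * I (fun x => bary p i x * bary p j x).
Proof.
move=> ij; have ji : j != i by rewrite eq_sym.
pose X := I (fun x => bary p i x * bary p j x).
pose Y := I (fun x => bary p i x * bary p i x).
have b0 k x : K x -> 0 <= bary p k x by move/(simplexP pU).
have Yj : I (fun x => bary p j x * bary p j x) = Y.
  apply: (@integral_on_swap i j) => //; first by move=> x Kx; rewrite mulr_ge0// b0.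
  by move=> x; rewrite !bary_swap tpermL.
have half k l : k != l -> exists2 c : R, 0 < c &
    volume K = c * volume (simplex (half_simplex k l)) /\
    I (fun x => bary p k x * bary p l x) / 2 + I (fun x => bary p l x * bary p l x) / 4 =
    c * integral_on (simplex (half_simplex k l)) (fun x => bary p k x * bary p l x).
  move=> kl; have hU := half_simplex_indep kl.
  have hK x : simplex (half_simplex k l) x -> K x by rewrite half_simplexE// => -[].
  have [c c0 cE] := simplex_change_of_variables pU hU.
  exists c => //; split.
    have := cE (fun=> 1) (@within_cst _ _ _ _) (fun _ _ => ler01).
    rewrite /comp (integral_on_cst (simplex_compact pU)).
    by rewrite (integral_on_cst (simplex_compact hU)) !mul1r.
  rewrite -cE; first last.
  - by move=> x /hK Kx; rewrite mulr_ge0// b0.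
  - by apply: (@continuous_subspaceW _ _ _ K); [exact: hK | exact: cbb].
  transitivity (I (fun x => 2^-1 * (bary p k x * bary p l x) +
                           4^-1 * (bary p l x * bary p l x))).
    have cK := simplex_compact pU.
    rewrite integral_onD// ?integral_onZ//; first by congr (_ + _); rewrite mulrC.
      by apply: within_mul => //; exact: within_cst.
    by apply: within_mul => //; exact: within_cst.
  apply: eq_integral_on => x _ /=; have h := half_simplex_map x kl.
  by rewrite (h.1) (h.2); field.
have [c c0 [cV cE]] := half i j ij.
have [e e0 [eV eE]] := half j i ji.
have V1 := bisection ij (@within_cst R d K 1).
rewrite !(integral_on_cst (simplex_compact _)) ?mul1r in V1; try by [exact: half_simplex_indep | exact: pU].
have X1 := bisection ij (@cbb i j).
have EC A : integral_on A (fun x => bary p j x * bary p i x) =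
            integral_on A (fun x => bary p i x * bary p j x).
  by apply: eq_integral_on => x _; rewrite mulrC.
rewrite Yj !EC -/X -/Y in cE eE X1.
have V0 := simplex_volume_gt0 pU.
move: V1 X1 cV cE eV eE.
set v1 := volume (simplex (half_simplex i j)).
set v2 := volume (simplex (half_simplex j i)).
set x1 := integral_on _ _; set x2 := integral_on _ _.
set V := volume K in V0 *; set W := X / 2 + Y / 4.
move=> V1 X1 cV cE eV eE.
have : X * V = W * V.
  have e1 : x1 * V = W * v1 by rewrite cE cV; ring.
  have e2 : x2 * V = W * v2 by rewrite eE eV; ring.
  by rewrite {1}X1 mulrDl e1 e2 -mulrDr -V1.
move/(mulIf (lt0r_neq0 V0)) => h; rewrite -/X -/Y; rewrite /W in h; lra.
Qed.

(** The pure moment is twice the mixed ones, and together they add up to the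
    integral of the coordinate of i. *)
Lemma integral_bary_mul i j : i != j ->
  I (fun x => bary p i x * bary p j x) = volume K / (d.+1%:R * d.+2%:R).
Proof.
move=> ij; pose Y := I (fun x => bary p i x * bary p i x).
have h k : k != i -> I (fun x => bary p i x * bary p k x) = Y / 2.
  by rewrite eq_sym => ik; rewrite /Y (integral_bary_sqr ik) mulrC mulKf ?pnatr_eq0.
have : \sum_k I (fun x => bary p i x * bary p k x) = volume K / d.+1%:R.
  rewrite -integral_on_sum//; last exact: simplex_compact.
  rewrite -(integral_bary i); apply: eq_integral_on => x _.
  by rewrite -mulr_sumr sum_bary1// mulr1.
rewrite (bigD1 i)//= -/Y (eq_bigr _ h) sumr_const.
have -> : #|[pred k | k != i]| = d.
  by rewrite (eq_card (B := predC1 i))// cardC1 card_ord.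
move=> E; have {}E : Y / 2 * d.+2%:R = volume K / d.+1%:R.
  rewrite -E -[X in _ = _ + X]mulr_natr -(addn2 d) natrD mulrDr addrC; congr (_ + _).
  by rewrite divfK// pnatr_eq0.
rewrite h 1?eq_sym// -[LHS](mulfK (_ : d.+2%:R != 0)) ?pnatr_eq0// E.
by rewrite -mulrA invfM.
Qed.

End moments.

(** * Symmetric positive definite matrices *)

Section rayleigh.
Context {R : realType}.

Lemma unit_sphere_compact n : compact [set x : 'rV[R]_n | dot x x = 1].
Proof.
apply: bounded_closed_compact.
  exists 1; split; first exact: num_real.
  move=> M M1 x /= x1; apply: (le_trans _ (ltW M1)); apply/rV_norm_leP => // i.
  rewrite -[X in _ <= X](sqrtr1 R) -x1 -sqrtr_sqr ler_sqrt ?dot_ge0//.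
  rewrite /dot (bigD1 i)//= -expr2 lerDl.
  by apply: sumr_ge0 => k _; rewrite -expr2 sqr_ge0.
have cf : {within setT, continuous (fun x : 'rV[R]_n => enorm x)}.
  by apply: within_enorm; apply: continuous_subspaceT => x; exact: cvg_id.
have cg : continuous (fun x : 'rV[R]_n => enorm x) by apply/continuous_subspace_setT.
rewrite (_ : mkset _ = (fun x => enorm x) @^-1` [set 1]).
  by apply: preimage_closed => [x _|]; [exact: cg | exact: closed_eq].
apply/seteqP; split => x /=; first by rewrite /enorm => ->; rewrite sqrtr1.
by move=> x1; rewrite -sqr_enorm x1 expr1n.
Qed.

Lemma quadratic_continuous n (A : 'M[R]_n) (K : set 'rV[R]_n) :
  {within K, continuous (fun x => dot (x *m A) x)}.
Proof.
apply: continuous_subspaceT.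
rewrite (_ : (fun x => _) = fun x => \sum_k dot (col k A)^T x * dot (delta_mx 0 k) x).
  apply/continuous_subspace_setT; apply: within_sum => k _.
  by apply: within_mul; apply: continuous_subspaceT; exact: dot_continuous.
apply/funext => x; apply: eq_bigr => k _; congr (_ * _).
  by rewrite dotC dotE trmxK !mxE; apply: eq_bigr => j _; rewrite !mxE.
by rewrite dotE -rowE !mxE.
Qed.

(** A minimum of the quadratic form on the unit sphere is an eigenvector. *)
Lemma rayleigh n (A : 'M[R]_n) : (0 < n)%N -> A^T = A ->
  exists u (m : R), [/\ dot u u = 1, u *m A = m *: u &
    forall x, m * dot x x <= dot (x *m A) x].
Proof.
case: n A => // n A _ As.
have S0 : [set x : 'rV[R]_n.+1 | dot x x = 1] !=set0.
  exists (delta_mx 0 0); rewrite /= /dot (bigD1 0)//= !mxE !eqxx mulr1.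
  by rewrite big1 ?addr0// => i /negbTE i0; rewrite !mxE i0 andbF mulr0.
have [u + umin] := EVT_min_rV S0 (@unit_sphere_compact _) (@quadratic_continuous _ A _).
rewrite inE /= => u1; exists u, (dot (u *m A) u).
set m := dot (u *m A) u.
have mle x : m * dot x x <= dot (x *m A) x.
  have [->|x0] := eqVneq x 0; first by rewrite dot0r mulr0 dot0r.
  have e0 : 0 < enorm x by rewrite enorm_gt0.
  have := umin ((enorm x)^-1 *: x).
  rewrite inE /= dotZl dotZr -sqr_enorm -scalemxAl dotZl dotZr.
  have -> : (enorm x)^-1 * ((enorm x)^-1 * enorm x ^+ 2) = 1.
    by rewrite expr2; field; exact: lt0r_neq0.
  move=> /(_ erefl); rewrite mulrA -expr2 exprVn => h.
  by rewrite -ler_pdivlMr ?exprn_gt0// mulrC.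
split => //.
pose B := A - m%:M.
have BE x : dot (x *m B) x = dot (x *m A) x - m * dot x x.
  by rewrite /B mulmxBr mul_mx_scalar dotBl dotZl.
have B0 x : 0 <= dot (x *m B) x by rewrite BE subr_ge0.
have Bu : dot (u *m B) u = 0 by rewrite BE u1 mulr1 subrr.
have BT : B^T = B by rewrite /B linearB/= As tr_scalar_mx.
pose y := u *m B.
suff : y = 0.
  by rewrite /y /B mulmxBr mul_mx_scalar => /eqP; rewrite subr_eq0 => /eqP.
apply/eqP; rewrite -dot_eq0.
(* the form B is nonnegative along the line u + t y and vanishes at u, so its
   derivative 2 |y|^2 there is zero *)
have h t : 0 <= t * (2 * dot y y) + t ^+ 2 * dot (y *m B) y.
  have := B0 (u + t *: y).
  rewrite mulmxDl -scalemxAl !dotDl !dotDr !dotZl !dotZr Bu add0r.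
  rewrite -/y [dot (y *m B) u]dot_mulmx BT -/y => H.
  by apply: (le_trans H); rewrite le_eqVlt; apply/orP; left; apply/eqP; ring.
set a := dot y y in h *; set b := dot (y *m B) y in h.
have b0 : 0 <= b by exact: B0.
have a0 : 0 <= a by exact: dot_ge0.
rewrite eq_le a0 andbT leNgt; apply/negP => ap.
(* b + 1 in place of the optimal b, which may be zero *)
have := h (- (a / (b + 1))).
have b1 : 0 < b + 1 by rewrite ltr_wpDl.
rewrite (_ : _ + _ = - (a ^+ 2 * (b + 2) / (b + 1) ^+ 2)); last by field; exact: lt0r_neq0.
rewrite oppr_ge0 leNgt => /negP; apply.
by rewrite divr_gt0 ?exprn_gt0// mulr_gt0 ?exprn_gt0// ltr_wpDl.
Qed.

(** The minimum of the Rayleigh quotient is an eigenvalue and a lower bound of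
    all the eigenvalues, hence it is the least one. *)
Lemma lambda_min_le n (A : 'M[R]_n) x : (0 < n)%N -> A^T = A ->
  lambda_min A * dot x x <= dot (x *m A) x.
Proof.
move=> n0 As; have [u [m [u1 uA mle]]] := rayleigh n0 As.
apply: (le_trans _ (mle x)); apply: ler_wpM2r; first exact: dot_ge0.
apply: ge_inf; last first.
  apply/eigenvalueP; exists u => //; apply: contra_eqN u1 => /eqP ->.
  by rewrite dot0l eq_sym oner_eq0.
exists m => l /eigenvalueP[v vA v0]; have := mle v.
by rewrite vA dotZl ler_pM2r// dot_gt0.
Qed.

Lemma lambda_min_gt0 n (A : 'M[R]_n) : (0 < n)%N -> spd A -> 0 < lambda_min A.
Proof.
move=> n0 [As A0]; have [u [m [u1 uA mle]]] := rayleigh n0 As.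
have u0 : u != 0.
  by apply: contra_eqN u1 => /eqP ->; rewrite dot0l eq_sym oner_eq0.
apply: (@lt_le_trans _ _ m).
  by have := A0 u u0; rewrite uA dotZl u1 mulr1.
apply: lb_le_inf; first by exists m; apply/eigenvalueP; exists u.
move=> l /eigenvalueP[v vA v0]; have := mle v.
by rewrite vA dotZl ler_pM2r// dot_gt0.
Qed.

Lemma spd_unit n (A : 'M[R]_n) : spd A -> A \in unitmx.
Proof.
move=> [_ A0]; rewrite -row_free_unit; apply: inj_row_free => v vA.
by apply/eqP/negPn/negP => /A0; rewrite vA dot0l ltxx.
Qed.

Lemma spd_invmx n (A : 'M[R]_n) : spd A -> spd (invmx A).
Proof.
move=> hA; have Au := spd_unit hA; case: hA => As A0.
have iT : (invmx A)^T = invmx A by rewrite trmx_inv As.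
split => // x x0.
have y0 : x *m invmx A != 0.
  by apply: contra_neq x0 => h; rewrite -[x](mulmxKV Au) h mul0mx.
by have := A0 _ y0; rewrite mulmxKV// dotC.
Qed.

(** The Householder reflection in the hyperplane orthogonal to v - u. *)
Lemma reflection_exists n (u v : 'rV[R]_n) : dot u u = dot v v ->
  exists H : 'M[R]_n, [/\ H^T = H, H *m H = 1%:M & v *m H = u].
Proof.
move=> uv; have [->|vu] := eqVneq v u.
  by exists 1%:M; rewrite trmx1 mulmx1 mulmx1.
have [w wE] : exists w, w = v - u by exists (v - u).
have w0 : dot w w != 0 by rewrite dot_eq0 wE subr_eq0.
pose H : 'M[R]_n := 1%:M - (2 / dot w w) *: (w^T *m w).
have HE x : x *m H = x - (2 * dot x w / dot w w) *: w.
  rewrite /H mulmxBr mulmx1 -scalemxAr mulmxA.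
  rewrite [X in X *m w]mx11_scalar mul_scalar_mx scalerA -dotE.
  by congr (_ - _ *: _); rewrite mulrAC.
exists H; split.
- by rewrite /H linearB/= trmx1 linearZ/= trmx_mul trmxK.
- apply/row_matrixP => i; rewrite rowE mulmxA HE HE row1.
  set x := delta_mx 0 i; rewrite dotBl dotZl divfK//.
  by rewrite -addrA -opprD -scalerDl [X in X *: w](_ : _ = 0) ?scale0r ?subr0//; field.
- rewrite HE (_ : _ / _ = 1); first by rewrite scale1r wE subKr.
  apply: (canLR (mulfK w0)); rewrite mul1r wE !dotBl !dotBr uv (dotC v u); ring.
Qed.

(** A reflection that sends the first basis vector to an eigenvector makes the
    matrix block diagonal, which allows an induction on the dimension. *)
Lemma spd_sqrt_exists n (A : 'M[R]_n) : spd A -> exists S, spd S /\ S *m S = A.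
Proof.
elim: n A => [|n IH] A hA.
  by exists A; split => //; apply/matrixP => -[].
have [As A0] := hA.
have [u [m [u1 uA mle]]] := rayleigh (ltn0Sn n) As.
pose e : 'rV[R]_n.+1 := delta_mx 0 0.
have e1 : dot e e = 1.
  rewrite /dot (bigD1 0)//= !mxE !eqxx mulr1.
  by rewrite big1 ?addr0// => i /negbTE i0; rewrite !mxE i0 andbF mulr0.
have [H [HT HH eH]] : exists H : 'M[R]_n.+1, [/\ H^T = H, H *m H = 1%:M & e *m H = u].
  by apply: reflection_exists; rewrite u1 e1.
have uH : u *m H = e by rewrite -eH -mulmxA HH mulmx1.
have u0 : u != 0.
  by apply: contra_eqN u1 => /eqP ->; rewrite dot0l eq_sym oner_eq0.
have m0 : 0 < m by have := A0 u u0; rewrite uA dotZl u1 mulr1.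
have [B defB] : exists B : 'M[R]_(1 + n), B = H *m A *m H by eexists.
have BT : B^T = B by rewrite defB !trmx_mul HT As mulmxA.
have eB : e *m B = m *: e by rewrite defB !mulmxA eH uA -scalemxAl uH.
have B0 x : x != 0 -> 0 < dot (x *m B) x.
  move=> x0; rewrite defB !mulmxA dot_mulmx HT; apply: A0.
  by apply: contra_neq x0 => h; rewrite -[x]mulmx1 -HH mulmxA h mul0mx.
pose C := drsubmx B.
have r0 : row 0 B = m *: e by rewrite rowE eB.
have BE : B = block_mx m%:M 0 0 C.
  have ur : ursubmx B = 0.
    apply/matrixP => i j; rewrite ord1 !mxE.
    have /rowP/(_ (rshift 1 j)) := r0; rewrite mxE.
    by rewrite lshift0 => ->; rewrite !mxE /= mulr0.
  rewrite -[LHS]submxK -/C ur; congr block_mx.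
    apply/matrixP => i j; rewrite !ord1 !mxE lshift0.
    by have /rowP/(_ 0) := r0; rewrite !mxE => ->; rewrite !eqxx mulr1.
  by rewrite -[LHS]trmxK trmx_dlsub BT ur trmx0.
have hC : spd C.
  split; first by rewrite /C trmx_drsub BT.
  move=> x x0; have := B0 (row_mx 0 x).
  rewrite BE mul_row_block !mul0mx !mulmx0 !add0r !dotE tr_row_mx mul_row_col.
  rewrite mul0mx add0r; apply.
  by apply: contra_neq x0 => h; have := congr1 (@rsubmx _ 1 1 n) h; rewrite row_mxKr linear0.
have [S [[ST S0] SS]] := IH C hC.
pose Q : 'M[R]_(1 + n) := block_mx (Num.sqrt m)%:M 0 0 S.
have QT : Q^T = Q by rewrite /Q tr_block_mx !trmx0 tr_scalar_mx ST.
have QQ : Q *m Q = B.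
  rewrite BE /Q mulmx_block !mul0mx !mulmx0 !add0r !addr0 SS -scalar_mxM.
  by rewrite -expr2 sqr_sqrtr// ltW.
have Q0 x : x != 0 -> 0 < dot (x *m Q) x.
  have [y [z ->]] : exists (y : 'rV[R]_1) (z : 'rV[R]_n), x = row_mx y z.
    by exists (lsubmx x), (rsubmx x); rewrite hsubmxK.
  move=> x0; rewrite mul_row_block !mulmx0 addr0 add0r dotE tr_row_mx mul_row_col mxE -!dotE.
  rewrite mul_mx_scalar dotZl.
  have [z0|z0] := eqVneq z 0; last first.
    apply: ltr_wpDl; last exact: S0.
    by apply: mulr_ge0; [exact: sqrtr_ge0 | exact: dot_ge0].
  rewrite z0 dot0r addr0 mulr_gt0 ?sqrtr_gt0// dot_gt0.
  by apply: contra_neq x0 => ->; rewrite z0 row_mx0.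
exists (H *m Q *m H); split; first split.
- by rewrite !trmx_mul HT QT mulmxA.
- move=> x x0; rewrite !mulmxA dot_mulmx HT; apply: Q0.
  by apply: contra_neq x0 => h; rewrite -[x]mulmx1 -HH mulmxA h mul0mx.
- rewrite !mulmxA -[_ *m H *m H]mulmxA HH mulmx1 -[_ *m Q *m Q]mulmxA QQ defB.
  by rewrite !mulmxA HH mul1mx -mulmxA HH mulmx1.
Qed.

Lemma sqrt_spdP n (A : 'M[R]_n) : spd A ->
  spd (sqrt_spd A) /\ sqrt_spd A *m sqrt_spd A = A.
Proof. by move=> /spd_sqrt_exists h; exact: (getPex h). Qed.

End rayleigh.

(** * Heights and dihedral angles *)

Section angles.
Context {R : realType} {d : nat}.
Variable p : 'I_d.+1 -> 'rV[R]_d.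
Hypothesis pU : affinely_independent p.
Hypothesis d0 : (0 < d)%N.
Local Notation q := (bary_grad p).

Lemma bary_grad_edge i j k : dot (q i) (p j - p k) = (i == j)%:R - (i == k)%:R.
Proof. by rewrite -bary_sub !bary_vertex. Qed.

Lemma other_vertex (i : 'I_d.+1) : exists j, j != i.
Proof.
have : (1 < #|'I_d.+1|)%N by rewrite card_ord.
by move/card_gt1P => [j [k [_ _ jk]]]; have [ji|] := eqVneq j i; [exists k; rewrite -ji eq_sym | exists j].
Qed.

Lemma bary_grad_neq0 i : q i != 0.
Proof.
have [j ji] := other_vertex i.
apply: contra_neq (oner_neq0 R) => q0.
by have := bary_grad_edge i i j; rewrite q0 dot0l eqxx eq_sym (negbTE ji) subr0.
Qed.

Let face_distances_nonempty i :
  [set enorm (p i - y) | y in affine_hull p [set~ i]] !=set0.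
Proof.
have [j ji] := other_vertex i.
exists (enorm (p i - p j)); exists (p j) => //.
exists (fun k => (k == j)%:R); split.
- by move=> k; rewrite !inE negbK => /eqP ->; rewrite eq_sym (negbTE ji).
- by rewrite (bigD1 j)//= eqxx big1 ?addr0// => k /negbTE ->.
- rewrite (bigD1 j)//= eqxx scale1r big1 ?addr0// => k /negbTE ->.
  by rewrite scale0r.
Qed.

Lemma height_ge0 i : 0 <= height p i.
Proof. by apply: lb_le_inf => // _ [y _ <-]; exact: enorm_ge0. Qed.

(** The barycentric coordinate drops from 1 to 0 between the vertex and the
    opposite face, at a rate of at most the norm of its gradient. *)
Lemma height_grad_ge1 i : 1 <= height p i * enorm (q i).
Proof.
have q0 : 0 < enorm (q i) by rewrite enorm_gt0 bary_grad_neq0.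
rewrite -ler_pdivrMr// div1r.
apply: lb_le_inf => // _ [y [w [w0 w1 ->]] <-].
rewrite -div1r ler_pdivrMr// mulrC.
apply: le_trans (dot_le_enorm _ _).
rewrite -bary_sub bary_vertex// eqxx bary_convex_combination//.
by rewrite w0 ?subr0// !inE eqxx.
Qed.

(** In the coordinates y = x S, the gradient of the i-th barycentric coordinate
    becomes q_i S^-1; it is orthogonal to the face opposite to i, and the edges
    determine the inward unit normal. *)
Lemma inward_normal_image (S : 'M[R]_d) i : S^T = S -> S \in unitmx ->
  let n := q i *m invmx S in
  inward_normal (fun k => p k *m S) i = (enorm n)^-1 *: n.
Proof.
move=> ST SU n.
have n0 : n != 0.
  apply: contra_neq (bary_grad_neq0 i) => h.
  by rewrite -[q i](mulmxKV SU) -/n h mul0mx.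
have e0 : 0 < enorm n by rewrite enorm_gt0.
have iT : (invmx S)^T = invmx S by rewrite trmx_inv ST.
have nE j k : dot n (p j *m S - p k *m S) = (i == j)%:R - (i == k)%:R.
  by rewrite -mulmxBl /n dot_mulmx iT mulmxK// bary_grad_edge.
rewrite /inward_normal; set P := mkset _.
have Pn : P ((enorm n)^-1 *: n).
  split.
  - by rewrite enormZ normfV (ger0_norm (ltW e0)) mulVf// gt_eqF.
  - move=> j k ji ki; rewrite dotZl nE.
    by rewrite eq_sym (negbTE ji) eq_sym (negbTE ki) subrr mulr0.
  - move=> j ji; rewrite dotZl nE eqxx eq_sym (negbTE ji) subr0 mulr1.
    by rewrite invr_gt0.
have [g1 gjk gij] : P (get P) by exact: (getPex (ex_intro _ _ Pn)).
set g := get P in g1 gjk gij *.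
have [j ji] := other_vertex i.
pose t := dot g (p i *m S - p j *m S).
have t0 : 0 < t by exact: gij.
(* both sides have the same products with all the edges *)
have gS : g *m S = t *: q i.
  apply/eqP; rewrite -subr_eq0 -dot_eq0; set v := g *m S - t *: q i.
  have vE k : dot v (p k - p j) = 0.
    rewrite /v dotBl dotZl bary_grad_edge dot_mulmx ST mulmxBl.
    have [<-|ki] := eqVneq i k.
      by rewrite eq_sym (negbTE ji) subr0 mulr1 /t subrr.
    rewrite gjk//; last by rewrite eq_sym.
    by rewrite [i == j]eq_sym (negbTE ji) ?(negbTE ki) subrr mulr0 subrr.
  have -> : dot v v = dot v (\sum_k bary p k v *: (p k - p j)) -
      dot v (\sum_k bary p k 0 *: (p k - p j)).
    rewrite -dotBr -sumrB; congr dot.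
    under eq_bigr do rewrite -scalerBl scalerBr.
    rewrite sumrB -scaler_suml sumrB !sum_bary1// subrr scale0r subr0.
    under eq_bigr do rewrite scalerBl.
    by rewrite sumrB -!bary_combination// subr0.
  rewrite !dot_sumr !big1 ?subrr// => k _; by rewrite dotZr vE mulr0.
have gE : g = t *: n by rewrite /n scalemxAl -gS mulmxK.
have : enorm g = 1 by [].
rewrite gE enormZ (gtr0_norm t0) => h.
by congr (_ *: _); rewrite -[LHS](mulfK (lt0r_neq0 e0)) h mul1r.
Qed.

Lemma cos_pi_sub_acos (x : R) : -1 <= x <= 1 -> cos (pi - acos x) = - x.
Proof.
by move=> x1; rewrite cosB cospi sinpi mul0r addr0 acosK ?mulN1r// in_itv.
Qed.

(** With S the square root of A^-1, the scalar product of q_i S^-1 and q_j S^-1 is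
    q_i A q_j. *)
Lemma cos_dihedral (A : 'M[R]_d) i j : spd A ->
  cos (dihedral_angle_metric (invmx A) p i j) =
  - (dot (q i *m A) (q j) /
     (Num.sqrt (dot (q i *m A) (q i)) * Num.sqrt (dot (q j *m A) (q j)))).
Proof.
move=> hA; have [hS SS] := sqrt_spdP (spd_invmx hA).
set S := sqrt_spd _ in hS SS *.
have SU := spd_unit hS; have [ST _] := hS; have AU := spd_unit hA.
have iT : (invmx S)^T = invmx S by rewrite trmx_inv ST.
have ii : invmx S *m invmx S = A.
  rewrite -[LHS](mulmxKV AU) -SS mulmxA.
  by rewrite (mulmxKV SU) mulVmx// mul1mx.
have nn k l : dot (q k *m invmx S) (q l *m invmx S) = dot (q k *m A) (q l).
  by rewrite -ii mulmxA [RHS]dot_mulmx iT.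
rewrite /dihedral_angle_metric -/S ST /dihedral_angle !inward_normal_image//.
set x := dot _ _.
have xE : x = dot (q i *m A) (q j) /
     (Num.sqrt (dot (q i *m A) (q i)) * Num.sqrt (dot (q j *m A) (q j))).
  rewrite /x dotZl dotZr /enorm !nn mulrA mulrC; congr (_ * _).
  by rewrite invfM.
rewrite -xE cos_pi_sub_acos// -ler_norml.
apply: (le_trans (normr_dot_le _ _)).
have e1 k : enorm ((enorm (q k *m invmx S))^-1 *: (q k *m invmx S)) = 1.
  have e0 : 0 < enorm (q k *m invmx S).
    rewrite enorm_gt0; apply: contra_neq (bary_grad_neq0 k) => h.
    by rewrite -[q k](mulmxKV SU) h mul0mx.
  by rewrite enormZ normfV (ger0_norm (ltW e0)) mulVf// gt_eqF.
by rewrite !e1 mulr1.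
Qed.

End angles.

(** * The element stiffness matrix *)

Section suprema.
Context {R : realType} {d : nat}.
Variables (K : set 'rV[R]_d).
Hypothesis cK : compact K.

Lemma le_sup_on (c : 'rV[R]_d -> R) x : {within K, continuous c} -> K x -> c x <= sup_on c K.
Proof.
move=> cc Kx; apply: ub_le_sup; last by exists x.
have [M [_ hM]] := compact_bounded (continuous_compact cc cK).
exists (M + 1) => _ [y Ky <-]; apply: (le_trans (ler_norm _)).
by apply: (hM (M + 1)); [rewrite ltrDl | exists y].
Qed.

Lemma le_sup_enorm (b : 'rV[R]_d -> 'rV[R]_d) x : {within K, continuous b} ->
  K x -> enorm (b x) <= sup_enorm b K.
Proof. by move=> /within_enorm cb Kx; exact: le_sup_on cb Kx. Qed.

End suprema.

Section element.
Context {R : realType} {d : nat}.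
Variables (p : 'I_d.+1 -> 'rV[R]_d) (A : 'M[R]_d).
Variables (b : 'rV[R]_d -> 'rV[R]_d) (c : 'rV[R]_d -> R).
Hypothesis pU : affinely_independent p.
Hypothesis d0 : (0 < d)%N.
Hypothesis hA : spd A.
Local Notation K := (simplex p).
Local Notation I := (integral_on K).
Local Notation q := (bary_grad p).
Local Notation B := (sup_enorm b K).
Local Notation C := (sup_on c K).
Hypothesis cb : {within K, continuous b}.
Hypothesis cc : {within K, continuous c}.
Hypothesis c0 : forall x, K x -> 0 <= c x.
Hypothesis hmesh : forall i j, i != j ->
  height p i / lambda_min A * (B / d.+1%:R)
  + height p i * height p j / lambda_min A * (C / (d.+1%:R * d.+2%:R))
  <= cos (dihedral_angle_metric (invmx A) p i j).

Let cK : compact K. Proof. exact: simplex_compact. Qed.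

Let cbary i : {within K, continuous (bary p i)}.
Proof. by apply: continuous_subspaceT; exact: bary_continuous. Qed.

Let bary0 i x : K x -> 0 <= bary p i x.
Proof. by move/(simplexP pU). Qed.

Definition stiffness i j : R := volume K * dot (q i *m A) (q j) +
  I (fun x => bary p i x * dot (b x) (q j)) +
  I (fun x => c x * bary p j x * bary p i x).

Let cbq j : {within K, continuous (fun x => dot (b x) (q j))}.
Proof. exact: within_dot. Qed.

Let cbi i j : {within K, continuous (fun x => bary p i x * dot (b x) (q j))}.
Proof. exact: within_mul. Qed.

Let cci i : {within K, continuous (fun x => c x * bary p i x)}.
Proof. exact: within_mul. Qed.

Let ccij i j : {within K, continuous (fun x => c x * bary p j x * bary p i x)}.
Proof. exact: within_mul. Qed.

Let B0 : 0 <= B.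
Proof. exact: (le_trans (enorm_ge0 _) (le_sup_enorm cK cb (simplex_vertex pU ord0))). Qed.

Let C0 : 0 <= C.
Proof. exact: (le_trans (c0 (simplex_vertex pU ord0)) (le_sup_on cK cc (simplex_vertex pU ord0))). Qed.

Lemma stiffness_row_sum i : \sum_j stiffness i j = I (fun x => c x * bary p i x).
Proof.
rewrite /stiffness !big_split /= -mulr_sumr -dot_sumr sum_bary_grad// dot0r mulr0 add0r.
rewrite -!integral_on_sum// [X in X + _](_ : _ = 0).
  rewrite add0r; apply: eq_integral_on => x _.
  by rewrite -mulr_suml -mulr_sumr sum_bary1// mulr1.
rewrite -[RHS](mul0r (volume K)) -(integral_on_cst cK).
apply: eq_integral_on => x _.
by rewrite -mulr_sumr -dot_sumr sum_bary_grad// dot0r mulr0.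
Qed.

(** The mesh condition, multiplied by the product of the A-norms of the two
    gradients: lambda_min bounds these from below, and a height times the
    Euclidean norm of its gradient is at least 1. *)
Lemma diffusion_bound i j : i != j ->
  enorm (q j) * B / d.+1%:R + C / (d.+1%:R * d.+2%:R) <= - dot (q i *m A) (q j).
Proof.
move=> ij; have := hmesh ij; rewrite cos_dihedral//.
have l0 := lambda_min_gt0 d0 hA; set l := lambda_min A in l0 *.
have Al x : l * dot x x <= dot (x *m A) x.
  by apply: lambda_min_le => //; case: hA.
set s := dot (q i *m A) (q j).
set X := Num.sqrt _; set Y := Num.sqrt _.
have n0 k : 0 < enorm (q k) by rewrite enorm_gt0 bary_grad_neq0.
have Xl k : Num.sqrt l * enorm (q k) <= Num.sqrt (dot (q k *m A) (q k)).
  rewrite -[X in _ * X]ger0_norm ?enorm_ge0// -sqrtr_sqr -sqrtrM ?(ltW l0)//.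
  by rewrite sqr_enorm ler_sqrt// (le_trans _ (Al _))// mulr_ge0 ?dot_ge0// ltW.
have XY : l * (enorm (q i) * enorm (q j)) <= X * Y.
  have := ler_pM (mulr_ge0 (sqrtr_ge0 l) (enorm_ge0 (q i)))
                 (mulr_ge0 (sqrtr_ge0 l) (enorm_ge0 (q j))) (Xl i) (Xl j).
  by rewrite mulrACA -expr2 sqr_sqrtr// ltW.
have XY0 : 0 < X * Y by apply: lt_le_trans XY; rewrite !mulr_gt0.
set ei := enorm (q i) in XY *; set ej := enorm (q j) in XY *.
have ei0 : 0 < ei by exact: n0.
have ej0 : 0 < ej by exact: n0.
have hi := height_grad_ge1 pU d0 i; have hj := height_grad_ge1 pU d0 j.
have hi0 := height_ge0 p d0 i; have hj0 := height_ge0 p d0 j.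
rewrite -/ei -/ej in hi hj.
set h := height p i in hi hi0 *; set k := height p j in hj hj0 *.
set u := B / d.+1%:R; set v := C / _.
have u0 : 0 <= u by rewrite divr_ge0.
have v0 : 0 <= v by rewrite divr_ge0// mulr_ge0.
move=> H.
have {}H : (h / l * u + h * k / l * v) * (X * Y) <= - s.
  rewrite -[X in _ <= X](divfK (lt0r_neq0 XY0)) [X in _ <= X * _]mulNr.
  by rewrite ler_pM2r.
apply: (le_trans _ H).
apply: (@le_trans _ _ ((h / l * u + h * k / l * v) * (l * (ei * ej)))); last first.
  apply: ler_wpM2l => //.
  by rewrite addr_ge0// !mulr_ge0// invr_ge0 ltW.
rewrite (_ : (_ + _) * _ = (h * ei) * (ej * u) + (h * ei) * (k * ej) * v); last first.
  by field; exact: lt0r_neq0.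
rewrite -mulrA lerD//.
  by rewrite ler_peMl// mulr_ge0// ltW.
rewrite ler_peMl//.
by rewrite -[X in X <= _]mulr1 ler_pM.
Qed.

(** The reaction is replaced by its maximum.  For the drift, the gap to its maximum
    is kept, as it has to vanish in the case of equality. *)
Lemma stiffness_bound i j : i != j ->
  stiffness i j <= - I (fun x => bary p i x * (enorm (q j) * B - dot (b x) (q j))).
Proof.
move=> ij; have := diffusion_bound ij.
have V0 := simplex_volume_gt0 pU.
move/(ler_wpM2l (ltW V0)); rewrite mulrDr mulrN => h.
have -> : (fun x => bary p i x * (enorm (q j) * B - dot (b x) (q j))) =
    (fun x => enorm (q j) * B * bary p i x - bary p i x * dot (b x) (q j)).
  by apply/funext => x; ring.
rewrite integral_onB//; last by apply: within_mul => //; exact: within_cst.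
rewrite integral_onZ// integral_bary//.
have : I (fun x => c x * bary p j x * bary p i x) <=
    C * I (fun x => bary p j x * bary p i x).
  rewrite -integral_onZ//; last exact: within_mul.
  apply: le_integral_on => //; first by apply: within_mul; [exact: within_cst | exact: within_mul].
  move=> x Kx; rewrite -mulrA ler_wpM2r ?mulr_ge0 ?bary0//.
  exact: le_sup_on.
rewrite integral_bary_mul 1?eq_sym// /stiffness => h2.
have e1 : enorm (q j) * B * (volume K / d.+1%:R) = volume K * (enorm (q j) * B / d.+1%:R).
  by ring.
have e2 : C * (volume K / (d.+1%:R * d.+2%:R)) = volume K * (C / (d.+1%:R * d.+2%:R)).
  by ring.
move: h h2; rewrite e1 e2; move: (enorm _ * _ / _) (C / _) => u v; lra.
Qed.

Let drift_gap_ge0 j x : K x -> 0 <= enorm (q j) * B - dot (b x) (q j).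
Proof.
move=> Kx; rewrite subr_ge0; apply: (le_trans (dot_le_enorm _ _)).
by rewrite mulrC ler_wpM2l ?enorm_ge0//; exact: le_sup_enorm.
Qed.

Lemma stiffness_le0 i j : i != j -> stiffness i j <= 0.
Proof.
move/stiffness_bound/le_trans; apply; rewrite oppr_le0.
by apply: integral_on_ge0 => x Kx; rewrite mulr_ge0// ?bary0// drift_gap_ge0.
Qed.

(** The integrand vanishes inside the simplex, where the coordinate is positive,
    and then everywhere by density. *)
Lemma integral_bary_eq0 i (G : 'rV[R]_d -> R) : {within K, continuous G} ->
  (forall x, K x -> 0 <= G x) -> I (fun x => bary p i x * G x) = 0 ->
  forall x, K x -> G x = 0.
Proof.
move=> cG G0 I0 x Kx; apply: (simplex_dense pU cG Kx) => y y0.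
have := @integral_on_eq0_interior _ _ K cK _ y (within_mul (@cbary i) cG) _ I0 (simplex_near pU y0).
move=> /(_ (fun z Kz => mulr_ge0 (bary0 i Kz) (G0 z Kz)))/eqP.
by rewrite mulf_eq0 (gt_eqF (y0 i)) => /eqP.
Qed.

(** Equality in the bound forces the drift to point along the gradient. *)
Lemma stiffness_eq0 i j x : i != j -> stiffness i j = 0 -> K x ->
  dot (b x) (q j) = enorm (q j) * B.
Proof.
move=> ij aij Kx.
have cG : {within K, continuous (fun x => enorm (q j) * B - dot (b x) (q j))}.
  by apply: within_sub => //; exact: within_cst.
have G0 : forall y, K y -> 0 <= enorm (q j) * B - dot (b y) (q j).
  by move=> y; exact: drift_gap_ge0.
apply/eqP; rewrite eq_sym -subr_eq0; apply/eqP.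
apply: (integral_bary_eq0 (i := i) cG G0) => //.
apply/eqP; rewrite eq_le; apply/andP; split.
  by have := stiffness_bound ij; rewrite aij oppr_ge0.
by apply: integral_on_ge0 => y Ky; rewrite mulr_ge0// ?bary0// G0.
Qed.

Section mixed.
Variable J : {set 'I_d.+1}.
Variables (i0 j0 : 'I_d.+1).
Hypothesis (i0J : i0 \in J) (j0J : j0 \notin J).
Hypothesis aJ : forall i j, i \in J -> j \notin J -> stiffness i j = 0.
Hypothesis cJ : I (fun x => c x * bary p i0 x) = 0.

Lemma mixed_reaction0 x : K x -> c x = 0.
Proof.
apply: (integral_bary_eq0 (i := i0)) => //.
by rewrite -[RHS]cJ; apply: eq_integral_on => y _; rewrite mulrC.
Qed.

Let ij_neq i j : i \in J -> j \notin J -> i != j.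
Proof. by move=> iJ; apply: contraNneq => <-. Qed.

(** Without drift, the diffusion alone would have to vanish on the gradient of
    the sum of the coordinates in J. *)
Lemma mixed_drift_gt0 : 0 < B.
Proof.
rewrite lt_neqAle B0 andbT eq_sym; apply/negP => /eqP BE.
have b_0 x : K x -> b x = 0.
  move=> Kx; apply/eqP; rewrite -enorm_eq0 eq_le enorm_ge0 andbT -BE.
  exact: le_sup_enorm.
have qA i j : i \in J -> j \notin J -> dot (q i *m A) (q j) = 0.
  move=> iJ jJ; have := aJ iJ jJ; rewrite /stiffness.
  have z G : (forall x, K x -> G x = 0) -> I G = 0.
    by move=> h; rewrite -[RHS](mul0r (volume K)) -(integral_on_cst cK); exact: eq_integral_on.
  rewrite z; last by move=> x Kx; rewrite b_0// dot0l mulr0.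
  rewrite z; last by move=> x Kx; rewrite mixed_reaction0// !mul0r.
  rewrite !addr0 => /eqP; rewrite mulf_eq0 (gt_eqF (simplex_volume_gt0 pU)).
  by move/eqP.
pose qJ := \sum_(i in J) q i.
have qJN : \sum_(j | j \notin J) q j = - qJ.
  apply/eqP; rewrite -subr_eq0 opprK addrC /qJ.
  by rewrite -(bigID (mem J) xpredT)/= sum_bary_grad.
have qJ0 : qJ = 0.
  apply/eqP/negPn/negP => /hA.2.
  rewrite -[X in dot _ X]opprK -qJN dotNr /qJ mulmx_suml dot_suml big1 ?oppr0 ?ltxx//.
  by move=> i iJ; rewrite dot_sumr big1// => j jJ; exact: qA.
have : dot qJ (p i0 - p j0) = 1.
  rewrite /qJ dot_suml (bigD1 i0)//= bary_grad_edge// eqxx (negbTE (ij_neq i0J j0J)) subr0.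
  rewrite big1 ?addr0// => i /andP[iJ ii0].
  by rewrite bary_grad_edge// (negbTE ii0) (negbTE (ij_neq iJ j0J)) subrr.
by rewrite qJ0 dot0l => /eqP; rewrite eq_sym oner_eq0.
Qed.

Let drift_direction j x : j \notin J -> K x -> b x = (B / enorm (q j)) *: q j.
Proof.
move=> jJ Kx; have bq := stiffness_eq0 (ij_neq i0J jJ) (aJ i0J jJ) Kx.
have e0 : 0 < enorm (q j) by rewrite enorm_gt0 bary_grad_neq0.
apply/eqP; rewrite -subr_eq0 -dot_eq0 eq_le dot_ge0 andbT.
rewrite dotBl !dotBr !dotZl !dotZr [dot (q j) (b x)]dotC bq -!sqr_enorm.
have : enorm (b x) ^+ 2 <= B ^+ 2.
  by rewrite ler_sqr ?nnegrE ?enorm_ge0//; exact: le_sup_enorm.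
rewrite -subr_ge0 => h; rewrite -oppr_ge0.
by apply: (le_trans h); rewrite le_eqVlt; apply/orP; left; apply/eqP; field; exact: lt0r_neq0.
Qed.

(** The drift is parallel to the gradient of every coordinate outside J.  Two such
    gradients are never positively proportional, so there is only one. *)
Lemma mixed_element : exists2 s : R, 0 < s &
  (forall j, j \notin J -> j = j0) /\ forall x, K x -> b x = s *: q j0.
Proof.
have e0 j : 0 < enorm (q j) by rewrite enorm_gt0 bary_grad_neq0.
exists (B / enorm (q j0)); first by rewrite divr_gt0// mixed_drift_gt0.
split; last by move=> x; exact: drift_direction.
move=> j jJ; apply/eqP/negPn/negP => jj0.
have := drift_direction j0J (simplex_vertex pU i0).
rewrite (drift_direction jJ (simplex_vertex pU i0)) => /(congr1 (dot^~ (p j - p i0))).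
rewrite !dotZl !bary_grad_edge// eqxx [j0 == j]eq_sym (negbTE jj0).
rewrite ![_ == i0]eq_sym (negbTE (ij_neq i0J jJ)) (negbTE (ij_neq i0J j0J)).
rewrite !subr0 mulr1 mulr0 => /eqP; rewrite gt_eqF//.
by rewrite divr_gt0// mixed_drift_gt0.
Qed.

End mixed.
End element.

(** * The energy of the test function *)

Section element_energy.
Context {R : realType} {d : nat}.
Variables (p : 'I_d.+1 -> 'rV[R]_d) (A : 'M[R]_d).
Variables (b : 'rV[R]_d -> 'rV[R]_d) (c : 'rV[R]_d -> R).
Hypothesis pU : affinely_independent p.
Local Notation K := (simplex p).
Local Notation I := (integral_on K).
Local Notation q := (bary_grad p).
Hypothesis cb : {within K, continuous b}.
Hypothesis cc : {within K, continuous c}.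
Local Notation a := (stiffness p A b c).

Let cK : compact K. Proof. exact: simplex_compact. Qed.

Let cbary i : {within K, continuous (bary p i)}.
Proof. by apply: continuous_subspaceT; exact: bary_continuous. Qed.

Lemma stiffness_bilinear (u v : 'I_d.+1 -> R) :
  volume K * dot ((\sum_i v i *: q i) *m A) (\sum_j u j *: q j) +
  I (fun x => (\sum_i v i * bary p i x) * dot (b x) (\sum_j u j *: q j)) +
  I (fun x => c x * (\sum_j u j * bary p j x) * (\sum_i v i * bary p i x)) =
  \sum_i v i * \sum_j u j * a i j.
Proof.
have cvb i : {within K, continuous (fun x => v i * bary p i x)}.
  by apply: within_mul => //; exact: within_cst.
have e1 : volume K * dot ((\sum_i v i *: q i) *m A) (\sum_j u j *: q j) =
    \sum_i v i * \sum_j u j * (volume K * dot (q i *m A) (q j)).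
  rewrite mulmx_suml dot_suml mulr_sumr; apply: eq_bigr => i _.
  rewrite dot_sumr !mulr_sumr; apply: eq_bigr => j _.
  by rewrite -scalemxAl dotZl dotZr; ring.
have e2 : I (fun x => (\sum_i v i * bary p i x) * dot (b x) (\sum_j u j *: q j)) =
    \sum_i v i * \sum_j u j * I (fun x => bary p i x * dot (b x) (q j)).
  transitivity (I (fun x => \sum_i v i * \sum_j u j * (bary p i x * dot (b x) (q j)))).
    apply: eq_integral_on => x _; rewrite mulr_suml; apply: eq_bigr => i _.
    rewrite dot_sumr !mulr_sumr; apply: eq_bigr => j _.
    by rewrite dotZr; ring.
  have cij i j : {within K, continuous (fun x => u j * (bary p i x * dot (b x) (q j)))}.
    apply: within_mul; first exact: within_cst.
    by apply: within_mul => //; exact: within_dot.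
  rewrite integral_on_sum//; last first.
    by move=> i _; apply: within_mul; [exact: within_cst | apply: within_sum => j _; exact: cij].
  apply: eq_bigr => i _; rewrite integral_onZ//; last by apply: within_sum => j _; exact: cij.
  congr (_ * _); rewrite integral_on_sum//; apply: eq_bigr => j _.
  by rewrite integral_onZ//; apply: within_mul => //; exact: within_dot.
have e3 : I (fun x => c x * (\sum_j u j * bary p j x) * (\sum_i v i * bary p i x)) =
    \sum_i v i * \sum_j u j * I (fun x => c x * bary p j x * bary p i x).
  transitivity (I (fun x => \sum_i v i * \sum_j u j * (c x * bary p j x * bary p i x))).
    apply: eq_integral_on => x _; rewrite mulr_sumr; apply: eq_bigr => i _.
    rewrite !mulr_sumr mulr_suml; apply: eq_bigr => j _; ring.
  have cij i j : {within K, continuous (fun x => u j * (c x * bary p j x * bary p i x))}.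
    apply: within_mul; first exact: within_cst.
    by apply: within_mul => //; exact: within_mul.
  rewrite integral_on_sum//; last first.
    by move=> i _; apply: within_mul; [exact: within_cst | apply: within_sum => j _; exact: cij].
  apply: eq_bigr => i _; rewrite integral_onZ//; last by apply: within_sum => j _; exact: cij.
  congr (_ * _); rewrite integral_on_sum//; apply: eq_bigr => j _.
  by rewrite integral_onZ//; apply: within_mul => //; exact: within_mul.
rewrite e1 e2 e3 -!big_split /=; apply: eq_bigr => i _.
rewrite -!mulrDr -!big_split /=; congr (_ * _); apply: eq_bigr => j _.
by rewrite /stiffness; ring.
Qed.

Hypothesis c0 : forall x, K x -> 0 <= c x.
Hypothesis a0 : forall i j, i != j -> a i j <= 0.
Variables (u : 'I_d.+1 -> R) (m : R).
Hypotheses (m0 : 0 < m) (um : forall i, u i <= m).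

Let bary0 i x : K x -> 0 <= bary p i x.
Proof. by move/(simplexP pU). Qed.

Let energy_termE i : \sum_j u j * a i j =
  m * I (fun x => c x * bary p i x) + \sum_j (m - u j) * - a i j.
Proof.
rewrite -(stiffness_row_sum A pU cb cc i) mulr_sumr -big_split /=.
by apply: eq_bigr => j _; ring.
Qed.

Let reaction_ge0 i : 0 <= I (fun x => c x * bary p i x).
Proof. by apply: integral_on_ge0 => x Kx; rewrite mulr_ge0// ?c0// bary0. Qed.

Let energy_term_ge0 i j : u i = m -> 0 <= (m - u j) * - a i j.
Proof.
move=> ui; have [<-|ij] := eqVneq i j; first by rewrite ui subrr mul0r.
by rewrite mulr_ge0 ?subr_ge0// oppr_ge0 a0.
Qed.

Lemma energy_ge0 i : u i = m -> 0 <= \sum_j u j * a i j.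
Proof.
move=> ui; rewrite energy_termE addr_ge0 ?mulr_ge0 ?(ltW m0)//.
by apply: sumr_ge0 => j _; exact: energy_term_ge0.
Qed.

(** With w = m - u, a row applied to u is m times the integral of c against the
    i-th coordinate, plus the sum of the -a_ij w_j; all these terms are
    nonnegative. *)
Lemma energy_eq0 i : u i = m -> \sum_j u j * a i j = 0 ->
  I (fun x => c x * bary p i x) = 0 /\ forall j, u j != m -> a i j = 0.
Proof.
move=> ui; rewrite energy_termE.
have s0 : 0 <= \sum_j (m - u j) * - a i j.
  by apply: sumr_ge0 => j _; exact: energy_term_ge0.
have r0 := reaction_ge0 i.
move=> /eqP; rewrite paddr_eq0 ?mulr_ge0 ?(ltW m0)// => /andP[/eqP h1 /eqP h2]; split.
  by move/eqP: h1; rewrite mulf_eq0 gt_eqF//= => /eqP.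
move=> j uj.
have /psumr_eq0P/(_ h2 j isT)/eqP : forall j, true -> 0 <= (m - u j) * - a i j.
  by move=> k _; exact: energy_term_ge0.
by rewrite mulf_eq0 subr_eq0 eq_sym (negbTE uj) oppr_eq0 => /eqP.
Qed.

End element_energy.

(** * The domain and the mean diffusion *)

Section domain.
Context {R : realType} {d : nat}.
Variable Omega : set 'rV[R]_d.

Lemma closure_ge0 (G : 'rV[R]_d -> R) : {within closure Omega, continuous G} ->
  (forall x, Omega x -> 0 <= G x) -> forall x, closure Omega x -> 0 <= G x.
Proof.
move=> cG G0 x Ox; rewrite leNgt; apply/negP => Gx.
have cGx : G y @[y --> within (closure Omega) (nbhs x)] --> G x.
  by move/subspace_continuousP : cG; exact.
have : \forall y \near x, closure Omega y -> G y < 0.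
  have : nbhs (G x) [set z | z < 0].
    by apply: (@open_nbhs_nbhs _ (G x)); split => //; exact: open_lt.
  exact: cGx.
move=> /Ox[y [Oy]]; move=> /(_ (subset_closure Oy)).
by rewrite ltNge G0.
Qed.

Hypothesis Oint : Omega = interior (closure Omega).

Lemma simplex_interior_subset (p : 'I_d.+1 -> 'rV[R]_d) x : affinely_independent p ->
  simplex p `<=` closure Omega -> (forall i, 0 < bary p i x) -> Omega x.
Proof.
by move=> pU pO x0; rewrite Oint; exact: (filterS pO (simplex_near pU x0)).
Qed.

(** The diffusion is only definite inside the domain, and an element may touch
    its boundary; the integral of the quadratic form is positive because the
    centroid of the element is an interior point. *)
Lemma spd_mean_diffusion (Th : mesh R d) (D : 'rV[R]_d -> 'M[R]_d) (K : 'I_(nb_elements Th)) :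
  simplicial_mesh Th Omega -> {within closure Omega, continuous D} ->
  (forall x, Omega x -> spd (D x)) -> spd (mean_diffusion D K).
Proof.
move=> hT cD Dspd; have pU := element_nondegenerate hT K.
set p := element_vertices K in pU *.
have cK : compact (element K) by exact: simplex_compact.
have V0 : 0 < volume (element K) by exact: simplex_volume_gt0.
have KO : element K `<=` closure Omega by rewrite (mesh_cover hT); exact: bigcup_sup.
have cDO k l : {within closure Omega, continuous (fun x => D x k l)}.
  move=> x; exact: (@continuous_comp (subspace (closure Omega)) _ _ D
    (fun M : 'M[R]_d => M k l) x (cD x) (@coord_continuous _ _ _ _ _ _)).
have cqO v : {within closure Omega, continuous (fun x => dot (v *m D x) v)}.
  rewrite (_ : (fun x => _) = fun x => \sum_k (\sum_j v 0 j * D x j k) * v 0 k).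
    apply: within_sum => k _; apply: within_mul; last exact: within_cst.
    by apply: within_sum => j _; apply: within_mul => //; exact: within_cst.
  by apply/funext => x; apply: eq_bigr => k _; rewrite mxE.
have cDkl k l := continuous_subspaceW KO (@cDO k l).
have cquad v := continuous_subspaceW KO (@cqO v).
split.
  apply/matrixP => k l; rewrite !mxE; congr (_ * _); apply: eq_integral_on => x Kx.
  apply/eqP; rewrite -subr_eq0; apply/eqP.
  apply: (@simplex_dense _ _ p pU (fun x => D x l k - D x k l)) => //.
    by apply: within_sub; exact: cDkl.
  move=> y y0; have [Ds _] := Dspd _ (simplex_interior_subset pU KO y0).
  by rewrite -[in X in X - _]Ds mxE subrr.
move=> v v0.
have -> : dot (v *m mean_diffusion D K) v =
    (volume (element K))^-1 * integral_on (element K) (fun x => dot (v *m D x) v).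
  have -> : (fun x => dot (v *m D x) v) = fun x => \sum_k v 0 k * \sum_j v 0 j * D x j k.
    by apply/funext => x; apply: eq_bigr => k _; rewrite mxE mulrC.
  have cj k j : {within element K, continuous (fun x => v 0 j * D x j k)}.
    by apply: within_mul => //; exact: within_cst.
  rewrite integral_on_sum//; last first.
    by move=> k _; apply: within_mul; [exact: within_cst | exact: within_sum].
  rewrite mulr_sumr; apply: eq_bigr => k _; rewrite integral_onZ//; last exact: within_sum.
  rewrite mxE integral_on_sum// !mulr_sumr mulr_suml; apply: eq_bigr => j _.
  by rewrite mxE integral_onZ//; ring.
have q0 x : element K x -> 0 <= dot (v *m D x) v.
  move=> Kx; apply: (@closure_ge0 (fun x => dot (v *m D x) v)); last exact: KO.
    exact: cqO.
  by move=> y Oy; apply: ltW; exact: (Dspd _ Oy).2.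
rewrite mulr_gt0 ?invr_gt0// lt_neqAle integral_on_ge0// andbT eq_sym.
apply/negP => /eqP I0.
have c0 i : 0 < bary p i (centroid p) by rewrite bary_centroid// invr_gt0.
have := integral_on_eq0_interior cK (cquad v) q0 I0 (simplex_near pU c0).
have [_ /(_ v v0)] := Dspd _ (simplex_interior_subset pU KO c0).
by move=> /lt0r_neq0/eqP.
Qed.

End domain.

(** * The topology of the mesh *)

Section mesh_topology.
Context {R : realType} {d : nat}.
Variables (Omega : set 'rV[R]_d) (Th : mesh R d).
Hypothesis hT : simplicial_mesh Th Omega.
Hypothesis Oint : Omega = interior (closure Omega).
Local Notation node := 'I_(nb_vertices Th).
Local Notation elt := 'I_(nb_elements Th).
Local Notation p := element_vertices.
Local Notation g := (@vertex_of _ _ Th).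
Implicit Types (K L : elt) (i j : 'I_d.+1) (k : node).

Let pU K : affinely_independent (p K).
Proof. exact: (element_nondegenerate hT). Qed.

Lemma element_subset K : element K `<=` closure Omega.
Proof. by rewrite (mesh_cover hT); exact: bigcup_sup. Qed.

Lemma element_cover x : closure Omega x -> exists K, element K x.
Proof. by rewrite (mesh_cover hT) => -[K _ Kx]; exists K. Qed.

Lemma element_closed K : closed (element K).
Proof. exact: simplex_closed. Qed.

Lemma phi_local K i x : element K x -> phi (g K i) x = bary (p K) i x.
Proof.
move=> Kx; rewrite (phi_element _ hT Kx) (big_pred1 i)// => j /=.
by rewrite (inj_eq (vertex_of_inj (pU K))).
Qed.

Lemma phi_sum (V : lmodType R) (F : node -> V) K x : element K x ->
  \sum_k phi k x *: F k = \sum_i bary (p K) i x *: F (g K i).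
Proof.
move=> Kx; rewrite [RHS](partition_big (g K) xpredT)//=; apply: eq_bigr => k _.
rewrite (phi_element k hT Kx) scaler_suml; apply: eq_bigr => i /eqP gi.
by rewrite gi.
Qed.

Lemma phi_gt0_vertex K k x : element K x -> 0 < phi k x ->
  exists2 i, g K i = k & bary (p K) i x = phi k x.
Proof.
move=> Kx; have [/existsP[i /eqP gi] _|] := boolP [exists i, g K i == k].
  by exists i => //; rewrite -gi phi_local.
move=> /existsPn h; rewrite (phi_element _ hT Kx) big_pred0 ?ltxx// => i.
exact/negbTE/h.
Qed.

(** The union of the elements that avoid y is closed. *)
Lemma element_star y : Omega y -> exists2 r : R, 0 < r &
  forall z, ball y r z -> exists L, element L y /\ element L z.
Proof.
move=> Oy.
have h1 : \forall z \near y, closure Omega z.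
  by move: Oy; rewrite {1}Oint => h; exact: h.
have h2 : \forall z \near y, forall L, ~ element L y -> ~ element L z.
  apply: (@filter_forall _ _ (fun L z => ~ element L y -> ~ element L z) (nbhs y)) => L.
  have [Ly|nLy] := pselect (element L y).
    by apply: filterS filterT => z _ /(_ Ly).
  have : nbhs y (~` element L).
    by apply: open_nbhs_nbhs; split => //; exact/closed_openC/element_closed.
  by apply: filterS => z nz _.
have /nbhs_ballP[r r0 rP] : nbhs y (closure Omega `&` [set z | forall L, ~ element L y -> ~ element L z]).
  exact: filterI.
exists r => // z /rP[/element_cover[L Lz] hz]; exists L; split => //.
by apply: contrapT => /hz.
Qed.

Lemma vertex_interior K i : ~ bdry Omega (vertex Th (g K i)) -> Omega (p K i).
Proof.
move=> nb; apply: contrapT => nO; apply: nb; split.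
  exact: (element_subset (simplex_vertex (pU K) i)).
by move=> /interior_subset.
Qed.

(** Near a point x of a face with an interior vertex a, the domain is the
    image, under a homothety of centre a, of its part near a. *)
Lemma interior_vertex_face K i x : element K x -> 0 < bary (p K) i x ->
  ~ bdry Omega (vertex Th (g K i)) -> Omega x.
Proof.
move=> Kx xi /vertex_interior; set a := p K i => Oa.
have [t /andP[t0 t1] Oy] : exists2 t : R, 0 < t <= 1 & Omega (a + t *: (x - a)).
  have /nbhs_ballP[r /= r0 rO] : nbhs a Omega.
    by move: Oa; rewrite {1}Oint => h; apply: open_nbhs_nbhs; split; [rewrite Oint; exact: open_interior|rewrite Oint].
  have rc : 0 < r + `|x - a| by rewrite ltr_wpDr.
  exists (r / (r + `|x - a|)).
    by rewrite divr_gt0// ler_pdivrMr// mul1r lerDl normr_ge0.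
  apply: rO; rewrite mx_norm_ball /ball_/= opprD addrA subrr sub0r normrN normrZ.
  by rewrite gtr0_norm ?divr_gt0// mulrAC ltr_pdivrMr// ltr_pM2l// ltrDr.
set h := (fun z => a + t *: (z - a)) in Oy *.
have Ka : element K a by exact: simplex_vertex.
have Ky : element K (h x) by apply: simplex_segment; rewrite ?(ltW t0) ?t1.
have hb L l z : bary (p L) l (h z) = (1 - t) * bary (p L) l a + t * bary (p L) l z.
  by rewrite /h bary_lin; ring.
(* the elements through h x contain the vertex a and the point x *)
have star L : element L (h x) -> exists2 l, p L l = a & element L x /\ 0 < bary (p L) l x.
  move=> Ly.
  have yi : 0 < bary (p K) i (h x).
    by rewrite hb ltr_wpDl// ?mulr_gt0// mulr_ge0 ?subr_ge0//; move/simplexP : Ka; exact.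
  have [l gl bl] : exists2 l, g L l = g K i & bary (p L) l (h x) = phi (g K i) (h x).
    by apply: (@phi_gt0_vertex L (g K i) (h x) Ly); rewrite (phi_local i Ky).
  have Lx : element L x.
    have : (element K `&` element L) (h x) by [].
    rewrite (mesh_conforming hT) => -[w [w0 wN w1 yw]].
    have : (convex_hull (vertex Th) (vertex_set K :&: vertex_set L)) x.
      exists (fun k => phi k x); split.
      - move=> k; rewrite (phi_element k hT Kx); apply: sumr_ge0 => m _.
        by move/simplexP: Kx; exact.
      - move=> k kN; rewrite (phi_element k hT Kx); apply: big1 => m /eqP gm.
        have mi : m != i.
          apply: contraNneq kN => mi; rewrite inE -gm mi; apply/andP; split.
            by apply/imsetP; exists i.
          by rewrite -gl; apply/imsetP; exists l.
        have : bary (p K) m (h x) = 0.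
          rewrite -(phi_local m Ky) gm (phi_element k hT Ky) yw sum_bary//; first exact: wN.
          by move=> n nK; apply: wN; rewrite inE (negbTE nK).
        rewrite hb [a]/(p K i) bary_vertex// (negbTE mi) mulr0 add0r => /eqP.
        by rewrite mulf_eq0 gt_eqF//= => /eqP.
      - rewrite -[RHS](sum_bary1 (pU K) x).
        transitivity (\sum_(k : node) phi k x *: (1 : R^o)).
          by apply: eq_bigr => k _; rewrite /GRing.scale/= mulr1.
        rewrite (@phi_sum R^o _ K x Kx).
        by apply: eq_bigr => k _; rewrite /GRing.scale/= mulr1.
      - by rewrite (phi_sum _ Kx); exact: (bary_combination (pU K)).
    by rewrite -(mesh_conforming hT) => -[].
  exists l; first by rewrite /a /p gl.
  split=> //.
  by rewrite -(phi_local l Lx) gl phi_local.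
have : \forall z \near x, closure Omega z.
  have n1 : \forall z \near x, exists L, element L (h x) /\ element L (h z).
    have [r r0 hr] := element_star Oy.
    apply/nbhs_ballP; exists r => // z xz; apply: hr; move: xz.
    rewrite mx_norm_ball /ball_/= => xz; apply: le_lt_trans xz.
    rewrite /h opprD addrACA subrr add0r -scalerBr opprB addrA subrK.
    by rewrite normrZ gtr0_norm// ler_piMl.
  have n2 : \forall z \near x, forall L l, 0 < bary (p L) l x -> 0 < bary (p L) l z.
    apply: (@filter_forall _ _ (fun L z => forall l, 0 < bary (p L) l x -> 0 < bary (p L) l z) (nbhs x)) => L.
    apply: (@filter_forall _ _ (fun l z => 0 < bary (p L) l x -> 0 < bary (p L) l z) (nbhs x)) => l.
    have [lx|nlx] := boolP (0 < bary (p L) l x); last by apply: filterS filterT.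
    by apply: filterS (near_bary_gt0 lx) => z lz _.
  near=> z.
  have [L [Ly Lz]] : exists L, element L (h x) /\ element L (h z) by near: z.
  have [l la [Lx lx]] := star L Ly.
  have lz : 0 < bary (p L) l z.
    have : forall L l, 0 < bary (p L) l x -> 0 < bary (p L) l z by near: z.
    exact.
  apply: (@element_subset L); apply/simplexP => // m.
  have [->|ml] := eqVneq m l; first exact: ltW.
  move/simplexP : Lz => /(_ (pU L) m); rewrite hb -la bary_vertex// (negbTE ml).
  by rewrite mulr0 add0r pmulr_rge0.
by move=> nx; rewrite Oint; exact: nx.
Unshelve. all: by end_near. Qed.

Lemma fe_fun_local (U : node -> R) K x : element K x ->
  fe_fun U x = \sum_i U (g K i) * bary (p K) i x.
Proof.
move=> Kx; transitivity (\sum_(k : node) phi k x *: (U k : R^o)).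
  by apply: eq_bigr => k _; rewrite mulrC.
by rewrite (@phi_sum R^o _ K x Kx); apply: eq_bigr => i _; rewrite mulrC.
Qed.

Lemma fe_fun_vertex (U : node -> R) k : fe_fun U (vertex Th k) = U k.
Proof.
rewrite /fe_fun (bigD1 k)//= (phi_vertex _ _ hT) eqxx mulr1 big1 ?addr0// => j jk.
by rewrite (phi_vertex _ _ hT) (negbTE jk) mulr0.
Qed.

Lemma fe_fun_out (U : node -> R) x : ~ closure Omega x -> fe_fun U x = 0.
Proof.
move=> nO; apply: big1 => k _; rewrite /phi; case: pickP => [K /asboolP Kx|]; last by rewrite mulr0.
by case: nO; exact: element_subset Kx.
Qed.

Lemma fe_fun_continuous (U : node -> R) : {within closure Omega, continuous (fe_fun U)}.
Proof.
rewrite (mesh_cover hT).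
have h (s : seq elt) : {within [set x | exists2 K, K \in s & element K x], continuous (fe_fun U)} /\
    closed [set x | exists2 K, K \in s & element K x].
  elim: s => [|K s [IHc IHcl]].
    rewrite (_ : mkset _ = set0).
      by split; [exact: continuous_subspace0 | exact: closed0].
    by apply/seteqP; split => x // -[].
  have -> : [set x | exists2 L, L \in K :: s & element L x] =
      element K `|` [set x | exists2 L, L \in s & element L x].
    apply/seteqP; split => x /=.
      by move=> [L]; rewrite inE => /orP[/eqP ->|]; [left | right; exists L].
    move=> [Kx|[L Ls Lx]]; first by exists K; rewrite // inE eqxx.
    by exists L; rewrite // inE Ls orbT.
  split; last by apply: closedU => //; exact: element_closed.
  apply: withinU_continuous => //; first exact: element_closed.
  apply: (@subspace_eq_continuous _ (element K) _ (fun x => \sum_i U (g K i) * bary (p K) i x)).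
    by move=> x; rewrite inE => Kx; apply/esym; exact: fe_fun_local.
  apply: within_sum => i _; apply: within_mul; first exact: within_cst.
  by apply: continuous_subspaceT; exact: bary_continuous.
have [hc _] := h (enum 'I_(nb_elements Th)).
apply: continuous_subspaceW hc => x [K _ Kx].
by exists K; rewrite // mem_enum.
Qed.

Lemma domain_bounded : exists M : R, forall x, closure Omega x -> `|x| <= M.
Proof.
exists (\sum_(K : elt) \sum_i `|p K i|) => x /element_cover[K Kx].
apply: (le_trans (simplex_norm_le (pU K) Kx)).
by rewrite [leRHS](bigD1 K)//= lerDl; apply: sumr_ge0 => L _; exact: sumr_ge0.
Qed.

Section plateau.
Variable J : pred node.
Hypothesis Jint : forall k, J k -> ~ bdry Omega (vertex Th k).

Definition plateau : 'rV[R]_d -> R := fe_fun (fun k => (J k)%:R).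

Lemma plateau_local K x : element K x ->
  plateau x = \sum_(i | J (g K i)) bary (p K) i x.
Proof.
move=> Kx; rewrite /plateau (fe_fun_local _ Kx) [RHS]big_mkcond /=.
by apply: eq_bigr => i _; case: (J _); rewrite ?mul1r ?mul0r.
Qed.

(** In particular the plateau function vanishes on the boundary: a boundary point
    has positive coordinates at boundary nodes only. *)
Lemma plateau_gt0 x : plateau x != 0 -> Omega x /\
  exists K i, [/\ element K x, J (g K i) & 0 < bary (p K) i x].
Proof.
move=> V0; have [K Kx] : exists K, element K x.
  by apply: element_cover; apply: contrapT => /fe_fun_out h; move: V0; rewrite /plateau h eqxx.
have [i Ji bi] : exists2 i, J (g K i) & 0 < bary (p K) i x.
  apply: contrapT => h; move: V0; rewrite (plateau_local Kx) big1 ?eqxx// => i Ji.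
  apply/eqP; move/simplexP : (Kx) => /(_ (pU K) i) b0.
  rewrite eq_le b0 andbT leNgt; apply/negP => bi; apply: h; by exists i.
by split; [exact: interior_vertex_face Kx bi (Jint Ji) | exists K, i].
Qed.

(** The domain and its complement are glued along the boundary, where the
    function vanishes. *)
Lemma plateau_continuous : continuous plateau.
Proof.
apply/continuous_subspace_setT.
have -> : [set: 'rV[R]_d] = closure Omega `|` ~` Omega.
  apply/seteqP; split => x // _.
  have [Ox|nOx] := pselect (Omega x); last by right.
  by left; exact: subset_closure.
apply: withinU_continuous; first exact: closed_closure.
- by apply: open_closedC; rewrite Oint; exact: open_interior.
- exact: fe_fun_continuous.
apply: (@subspace_eq_continuous _ (~` Omega) _ (fun=> 0)); last exact: within_cst.
move=> x; rewrite inE => nO; apply/eqP/negPn/negP; rewrite eq_sym => V0.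
by case: (plateau_gt0 V0).
Qed.

(** The function vanishes far away, because the domain is bounded; the exit time
    is the least time at which it takes the value 1/2. *)
Lemma plateau_exit x e : plateau x = 1 -> e != 0 -> exists2 t : R, 0 <= t &
  plateau (x + t *: e) = 1/2 /\
  forall s, 0 <= s <= t -> 1/2 <= plateau (x + s *: e).
Proof.
move=> Vx e0; pose f (t : R) := plateau (x + t *: e).
have cf : continuous f.
  move=> t; apply: (@continuous_comp _ _ _ (fun s : R => x + s *: e) plateau).
    apply: continuousD; first exact: cst_continuous.
    by apply: continuousZr_tmp; exact: cvg_id.
  exact: plateau_continuous.
have f0 : f 0 = 1 by rewrite /f scale0r addr0.
have [M hM] := domain_bounded.
have ne0 : 0 < `|e| by rewrite normr_gt0.
pose T := (`|M| + 1 + `|x|) / `|e|.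
have T0 : 0 <= T by rewrite divr_ge0// !addr_ge0.
have fT : f T = 0.
  apply: fe_fun_out => /hM; apply/negP; rewrite -ltNge.
  have : `|T *: e| - `|x| <= `|x + T *: e| by rewrite [in leRHS]addrC lerB_normD.
  rewrite normrZ (ger0_norm T0) /T divfK ?gt_eqF// addrK.
  by apply: lt_le_trans; rewrite (le_lt_trans (ler_norm M))// ltrDl.
have root a : 0 <= a -> f a <= 1/2 -> exists2 t, t \in `[0, a] & f t = 1/2.
  move=> a0 fa; apply: IVT => //; first by apply: continuous_subspaceT.
  rewrite f0 ge_min le_max fa orbT /=; apply/orP; left; lra.
pose A : set R := `[0, T] `&` f @^-1` [set 1/2].
have A0 : A !=set0.
  have [|t tT ft] := root T T0; first by rewrite fT; lra.
  by exists t; split.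
have cA : compact A.
  apply: compact_closedI; first exact: segment_compact.
  by apply: preimage_closed => [t _|]; [exact: cf | exact: closed_eq].
have [t] := @compact_EVT_min _ R id A A0 cA (continuous_subspaceT (fun x => cvg_id)).
rewrite inE => -[]; rewrite /= in_itv/= => /andP[t0 tT] ft tmin.
exists t => //; split => // s /andP[s0 st]; rewrite leNgt; apply/negP => fs.
have [|r] := root s s0; first exact: ltW.
rewrite in_itv/= => /andP[r0 rs] fr.
have rA : r \in A.
  by rewrite inE; split => //=; rewrite in_itv/= r0 (le_trans rs)// (le_trans st).
have := tmin r rA => tr.
have ts : t = s by apply/eqP; rewrite eq_le st andbT (le_trans tr rs).
by move: fs; rewrite -ts -/(f t) ft ltxx.
Qed.

End plateau.
End mesh_topology.

(** * Drift out of a plateau *)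

Section drift_out_of_plateau.
Context {R : realType} {d : nat}.
Variables (Omega : set 'rV[R]_d) (Th : mesh R d) (b : 'rV[R]_d -> 'rV[R]_d).
Hypothesis hT : simplicial_mesh Th Omega.
Hypothesis Oint : Omega = interior (closure Omega).
Hypothesis d0 : (0 < d)%N.
Local Notation node := 'I_(nb_vertices Th).
Local Notation elt := 'I_(nb_elements Th).
Local Notation p := element_vertices.
Local Notation g := (@vertex_of _ _ Th).
Variable J : pred node.
Hypothesis Jint : forall k, J k -> ~ bdry Omega (vertex Th k).
Hypothesis J0 : exists k, J k.
Hypothesis mixed : forall (K : elt) (i0 j0 : 'I_d.+1), J (g K i0) -> ~~ J (g K j0) ->
  exists2 s : R, 0 < s & (forall j, ~~ J (g K j) -> j = j0) /\
    forall x, element K x -> b x = s *: bary_grad (p K) j0.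
Local Notation v := (plateau J).
Implicit Types (K L : elt) (i j : 'I_d.+1) (k : node).

Let pU K : affinely_independent (p K).
Proof. exact: (element_nondegenerate hT). Qed.

Lemma half_plateau_mixed x : v x = 1/2 ->
  exists K i j, [/\ element K x, J (g K i) & ~~ J (g K j)].
Proof.
move=> vx; have [|Ox [K [i [Kx Ji bi]]]] := plateau_gt0 hT Oint Jint (x := x).
  by rewrite vx; apply/eqP; lra.
exists K, i; suff [j Jj] : exists j, ~~ J (g K j) by exists j.
apply: contrapT => h.
move: vx; rewrite (plateau_local hT _ Kx) (eq_bigl xpredT); last first.
  by move=> j; apply/negPn/negP => Jj; apply: h; exists j.
by rewrite sum_bary1// => h1; lra.
Qed.

Let plateau_vertex k : J k -> v (vertex Th k) = 1.
Proof. by move=> Jk; rewrite /plateau (fe_fun_vertex hT) Jk. Qed.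

Lemma mixed_exists : exists K i j, J (g K i) /\ ~~ J (g K j).
Proof.
have [k Jk] := J0.
have e0 : delta_mx 0 (Ordinal d0) != 0 :> 'rV[R]_d.
  by apply/rV0Pn; exists (Ordinal d0); rewrite mxE !eqxx oner_eq0.
have [t _ [vt _]] := plateau_exit hT Oint Jint (plateau_vertex Jk) e0.
by have [K [i [j [_ Ji Jj]]]] := half_plateau_mixed vt; exists K, i, j.
Qed.

(** In dimension at least two, consider a node a outside J of a mixed element.
    In all mixed elements at a, the drift is normal to the face opposite to a.
    Let z be reached by moving a little in a direction orthogonal to the drift,
    from the middle of the edge from a to its farthest neighbour in J.  The
    coordinate of a remains 1/2 at z, so z - a is a combination of total weight
    1/2 of edges from a to nodes of J; yet z is farther from a than half of the
    longest such edge. *)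
Lemma no_drift_out_of_plateau : d != 1 -> False.
Proof.
move=> d1; have [K0 [i0 [j0 [Ji0 Jj0]]]] := mixed_exists.
set ka := g K0 j0 in Jj0; set a := vertex Th ka.
pose N k := J k && [exists K : elt, (k \in vertex_set K) && (ka \in vertex_set K)].
have N0 : N (g K0 i0).
  rewrite /N Ji0; apply/existsP; exists K0.
  by apply/andP; split; apply/imsetP; [exists i0 | exists j0].
have [km /andP[Jm /existsP[Km /andP[/imsetP[im _ kmE] /imsetP[jm _ kaE]]]] kmax] :=
  arg_maxP (fun k => enorm (vertex Th k - a)) N0.
set w := vertex Th km - a.
(* a tangent direction exists because d > 1; its sign is chosen so that it does
   not lead towards a *)
have [tau [tau0 taun tauw]] : exists tau : 'rV[R]_d,
    [/\ tau != 0, dot (b a) tau = 0 & 0 <= dot tau w].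
  have [tau tau0 taun] : exists2 tau : 'rV[R]_d, tau != 0 & dot (b a) tau = 0.
    have : kermx (b a)^T != 0.
      rewrite -mxrank_eq0 mxrank_ker -lt0n subn_gt0.
      apply: leq_ltn_trans (rank_leq_col _) _.
      by rewrite ltn_neqAle eq_sym d1.
    move=> /rowV0Pn[tau /sub_kermxP h t0]; exists tau => //.
    by rewrite dotC dotE h mxE.
  have [h|h] := leP 0 (dot tau w); first by exists tau.
  exists (- tau); split; first by rewrite oppr_eq0.
    by rewrite dotNr taun oppr0.
  by rewrite dotNl oppr_ge0 ltW.
have pa : p Km jm = a by rewrite /p -kaE.
have pm : p Km im = vertex Th km by rewrite /p -kmE.
have imjm : im != jm.
  by apply: contraTneq Jm => h; rewrite kmE h -kaE.
pose y := a + 2^-1 *: w.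
have yE : y = p Km jm + 2^-1 *: (p Km im - p Km jm) by rewrite pa pm.
have Ky : element Km y.
  rewrite yE; apply: simplex_segment => //; try exact: simplex_vertex.
  by apply/andP; split; lra.
have ym : phi km y = 2^-1.
  by rewrite kmE (phi_local hT _ Ky) yE bary_lin !bary_vertex// eqxx (negbTE imjm) mulr0n mulr1n; field.
have ya : phi ka y = 2^-1.
  by rewrite kaE (phi_local hT _ Ky) yE bary_lin !bary_vertex// eqxx eq_sym (negbTE imjm) mulr0n mulr1n; field.
have h0 : 0 < 2^-1 :> R by lra.
have Oy : Omega y.
  apply: (interior_vertex_face hT Oint Ky (i := im)).
    by rewrite -(phi_local hT im Ky) -kmE ym.
  by rewrite -kmE; exact: Jint.
have [r r0 hr] := element_star hT Oint Oy.
pose eps := r / (1 + `|tau|).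
have nt : 0 < 1 + `|tau| by rewrite ltr_wpDr.
have eps0 : 0 < eps by rewrite divr_gt0.
pose z := y + eps *: tau.
have [L [Ly Lz]] : exists L, element L y /\ element L z.
  apply: hr; rewrite mx_norm_ball /ball_/= opprD addrA subrr sub0r normrN normrZ.
  rewrite (gtr0_norm eps0) /eps mulrAC ltr_pdivrMr// ltr_pM2l// ltrDr//.
have [l lm bl] : exists2 l, g L l = km & bary (p L) l y = phi km y.
  by apply: (phi_gt0_vertex hT Ly); rewrite ym.
have [m ma bm] : exists2 m, g L m = ka & bary (p L) m y = phi ka y.
  by apply: (phi_gt0_vertex hT Ly); rewrite ya.
have pLm : p L m = a by rewrite /p ma.
have [s s0 [sJ bs]] := @mixed L l m (eq_ind_r (fun k => J k) Jm lm) (eq_ind_r (fun k => ~~ J k) Jj0 ma).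
(* L is mixed, so the gradient of its coordinate at a is parallel to b a *)
have bz : bary (p L) m z = 2^-1.
  rewrite -[LHS](subrK (bary (p L) m y)) bary_sub /z addrAC subrr add0r dotZr.
  have : s * dot (bary_grad (p L) m) tau = 0.
    rewrite -dotZl -(bs a); last by rewrite -pLm; exact: simplex_vertex.
    exact: taun.
  move/eqP; rewrite mulf_eq0 gt_eqF//= => /eqP ->.
  by rewrite mulr0 add0r bm ya.
pose u := z - a.
have uE : u = \sum_(n | n != m) bary (p L) n z *: (p L n - a).
  rewrite /u {1}(bary_combination (pU L) z).
  rewrite -[X in _ - X]scale1r -(sum_bary1 (pU L) z) scaler_suml -sumrB.
  rewrite (bigD1 m)//= -scalerBr pLm subrr scaler0 add0r.
  by apply: eq_bigr => n _; rewrite scalerBr.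
have le_w n : n != m -> enorm (p L n - a) <= enorm w.
  move=> nm; apply: kmax; rewrite /N; apply/andP; split.
    by apply/negPn/negP => /sJ nE; rewrite nE eqxx in nm.
  apply/existsP; exists L; rewrite -ma; apply/andP; split.
    by apply/imsetP; exists n.
  by apply/imsetP; exists m.
(* z - a is a combination, of total weight 1/2, of edges at a to nodes of J *)
have uu : dot u u <= enorm u * (2^-1 * enorm w).
  rewrite {2}uE dot_sumr.
  have -> : 2^-1 = \sum_(n | n != m) bary (p L) n z.
    by have := sum_bary1 (pU L) z; rewrite (bigD1 m)//= bz => h; lra.
  rewrite mulr_suml mulr_sumr; apply: ler_sum => n nm; rewrite dotZr mulrCA.
  apply: ler_wpM2l; first by move/simplexP : Lz => /(_ (pU L)); exact.
  apply: (le_trans (dot_le_enorm _ _)).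
  by apply: ler_wpM2l; [exact: enorm_ge0 | exact: le_w].
have u1 : enorm u <= 2^-1 * enorm w.
  have [->|un] := eqVneq (enorm u) 0.
    by rewrite mulr_ge0 ?enorm_ge0// ltW.
  have un0 : 0 < enorm u by rewrite lt_neqAle eq_sym un enorm_ge0.
  by move: uu; rewrite -sqr_enorm expr2 ler_pM2l.
have u2 : dot u u <= 4^-1 * dot w w.
  rewrite -!sqr_enorm (_ : 4^-1 * _ = (2^-1 * enorm w) ^+ 2); last by field.
  by rewrite ler_sqr ?nnegrE ?mulr_ge0 ?enorm_ge0// ltW.
have sq (x x' : 'rV[R]_d) (e : R) : dot (2^-1 *: x + e *: x') (2^-1 *: x + e *: x') =
    4^-1 * dot x x + (e * dot x' x + e ^+ 2 * dot x' x').
  by rewrite !dotDl !dotDr !dotZl !dotZr (dotC x x'); field.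
have u3 : dot u u = 4^-1 * dot w w + (eps * dot tau w + eps ^+ 2 * dot tau tau).
  have -> : u = 2^-1 *: w + eps *: tau.
    by rewrite /u /z /y -[X in X - _]addrA [LHS]addrC addKr.
  exact: sq.
have : 0 < eps * dot tau w + eps ^+ 2 * dot tau tau.
  rewrite ltr_wpDl//; first by rewrite mulr_ge0// ltW.
  by rewrite mulr_gt0 ?exprn_gt0// dot_gt0.
by move: u2; rewrite u3; lra.
Qed.

End drift_out_of_plateau.

Section drift_dim1.
Context {R : realType}.
Variables (Omega : set 'rV[R]_1) (Th : mesh R 1) (b : 'rV[R]_1 -> 'rV[R]_1).
Hypothesis hT : simplicial_mesh Th Omega.
Hypothesis Oint : Omega = interior (closure Omega).
Local Notation node := 'I_(nb_vertices Th).
Local Notation elt := 'I_(nb_elements Th).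
Local Notation p := element_vertices.
Local Notation g := (@vertex_of _ _ Th).
Variable J : pred node.
Hypothesis Jint : forall k, J k -> ~ bdry Omega (vertex Th k).
Hypothesis J0 : exists k, J k.
Hypothesis mixed : forall (K : elt) (i0 j0 : 'I_2), J (g K i0) -> ~~ J (g K j0) ->
  exists2 s : R, 0 < s & (forall j, ~~ J (g K j) -> j = j0) /\
    forall x, element K x -> b x = s *: bary_grad (p K) j0.
Hypothesis db : forall x, Omega x -> differentiable b x.
Local Notation v := (plateau J).
Hypothesis divb : forall x, v x != 0 -> divergence b x <= 0.
Implicit Types (K L : elt) (i j : 'I_2) (k : node).

Let pU K : affinely_independent (p K).
Proof. exact: (element_nondegenerate hT). Qed.

(** At the exit point only one vertex of the element is outside J; its coordinate
    increases along f, and so the drift has the direction of f. *)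
Lemma dim1_exit_drift x f t : f != 0 -> v x = 1 -> 0 <= t ->
  v (x + t *: f) = 1/2 -> (forall s, 0 <= s <= t -> 1/2 <= v (x + s *: f)) ->
  0 < dot (b (x + t *: f)) f.
Proof.
move=> f0 vx t_ge0 vt vs; set y := x + t *: f.
have t0 : 0 < t.
  rewrite lt_neqAle t_ge0 andbT; apply/eqP => t0.
  by move: vt; rewrite -t0 scale0r addr0 vx; lra.
have [K [i [j [Ky Ji Jj]]]] := half_plateau_mixed hT Oint Jint vt.
have [s s0 [sJ bs]] := mixed Ji Jj.
have vK z : element K z -> v z = 1 - bary (p K) j z.
  move=> Kz; rewrite (plateau_local hT _ Kz) -(sum_bary1 (pU K) z).
  rewrite [in RHS](bigD1 j)//= addrC addrK; apply: eq_bigl => l.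
  by have [->|lj] := eqVneq l j; [exact: negbTE | apply/negPn/negP => /sJ /eqP; rewrite (negbTE lj)].
have bj : bary (p K) j y = 2^-1 by move: vt; rewrite vK// => h; lra.
have bpos l : 0 < bary (p K) l y.
  have [->|lj] := eqVneq l j; first by rewrite bj; lra.
  have := sum_bary1 (pU K) y; rewrite (bigD1 j)//= bj (big_pred1 l); last first.
    move=> m /=; case: j l m lj {bj sJ bs vK Jj} => [[|[|//]] ?] [[|[|//]] ?] [[|[|//]] ?] //.
  by move=> h; lra.
have /nbhs_ballP[r /= r0 rK] := simplex_near (pU K) bpos.
pose e := t * r / (r + t * `|f|).
have rt : 0 < r + t * `|f| by rewrite ltr_wpDr// mulr_ge0.
have e0 : 0 < e by rewrite divr_gt0// mulr_gt0.
have et : e <= t by rewrite ler_pdivrMr// ler_wpM2l// lerDl mulr_ge0.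
have Kz : element K (x + (t - e) *: f).
  apply: rK; rewrite mx_norm_ball /ball_/= /y opprD addrACA subrr add0r -scalerBl subKr.
  rewrite normrZ (gtr0_norm e0) /e mulrAC ltr_pdivrMr// (mulrC t) -mulrA ltr_pM2l//.
  by rewrite ltrDr.
have q0 : 0 <= dot (bary_grad (p K) j) f.
  have := vs (t - e); rewrite (vK _ Kz) subr_ge0 et lerBlDr lerDl (ltW e0) => /(_ isT).
  have := bary_sub (p K) j (x + (t - e) *: f) y.
  rewrite bj /y opprD addrACA subrr add0r -scalerBl addrAC subrr add0r scaleNr dotNr dotZr.
  move=> h1 h2; rewrite -(pmulr_rge0 _ e0); lra.
rewrite bs// dotZl mulr_gt0// lt_neqAle q0 andbT eq_sym.
rewrite /dot big_ord1 mulf_neq0//.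
  apply: contra_neq (bary_grad_neq0 (pU K) isT j) => h.
  by apply/rowP => l; rewrite ord1 h mxE.
apply: contra_neq f0 => h.
by apply/rowP => l; rewrite ord1 h mxE.
Qed.

(** The drift would be negative at the left exit, positive at the right one and
    nonincreasing in between. *)
Lemma no_drift_out_of_plateau_dim1 : False.
Proof.
have [k Jk] := J0; set x := vertex Th k.
have vx : v x = 1 by rewrite /plateau (fe_fun_vertex hT) Jk.
pose e : 'rV[R]_1 := delta_mx 0 0.
have e0 : e != 0 by apply/rV0Pn; exists 0; rewrite mxE !eqxx oner_eq0.
have eN0 : - e != 0 by rewrite oppr_eq0.
have [t1 t10 [vt1 vs1]] := plateau_exit hT Oint Jint vx e0.
have [t2 t20 [vt2 vs2]] := plateau_exit hT Oint Jint vx eN0.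
have b1 := dim1_exit_drift e0 vx t10 vt1 vs1.
have b2 := dim1_exit_drift eN0 vx t20 vt2 vs2.
have dote u : dot u e = u 0 0 by rewrite /dot big_ord1 mxE !eqxx mulr1.
pose F (s : R) := b (x + s *: e) 0 0.
have F1 : 0 < F t1 by rewrite /F -dote.
have F2 : F (- t2) < 0.
  by rewrite /F -dote -oppr_gt0 -dotNr scaleNr -scalerN.
have vs s : - t2 <= s <= t1 -> 1/2 <= v (x + s *: e).
  move=> /andP[s2 s1]; have [s0|s0] := leP 0 s; first by apply: vs1; rewrite s0.
  rewrite -[s]opprK scaleNr -scalerN; apply: vs2; rewrite oppr_ge0 (ltW s0) /=.
  by rewrite lerNl.
have vs0 s : - t2 <= s <= t1 -> v (x + s *: e) != 0.
  by move=> /vs h; apply/eqP => h0; move: h; rewrite h0; lra.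
have Os s : - t2 <= s <= t1 -> Omega (x + s *: e).
  by move=> /vs0 h; case: (plateau_gt0 hT Oint Jint h).
pose G (y : 'rV[R]_1) : R := b y 0 0.
(* the difference quotients of F are those of the first component of b along e *)
have FG s : (fun h : R => h^-1 *: ((F \o shift s) (h *: 1) - F s)) =
            (fun h : R => h^-1 *: ((G \o shift (x + s *: e)) (h *: e) - G (x + s *: e))).
  apply/funext => h; rewrite /F /G /=; congr (_ *: (b _ 0 0 - _)).
  by rewrite [h *: 1]mulr1 scalerDl addrCA.
have dG y : Omega y -> differentiable G y.
  move=> Oy; apply: (@differentiable_comp _ _ _ _ b (fun M : 'rV[R]_1 => M 0 0)); first exact: db.
  exact: differentiable_coord.
have dF s : - t2 <= s <= t1 -> derivable F s 1.
  by move=> hs; rewrite /derivable FG; apply: diff_derivable; exact/dG/Os.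
have DF s : - t2 <= s <= t1 -> F^`()%classic s <= 0.
  move=> hs; rewrite derive1E /derive FG.
  by have := divb (vs0 s hs); rewrite /divergence big_ord1.
have := @ler0_derive1_nincr R F (- t2) t1.
move=> /(_ _ _ _ (- t2) t1 (lexx _) _ (lexx _)).
have itvo s : s \in `]- t2, t1[ -> - t2 <= s <= t1.
  by rewrite in_itv/= => /andP[/ltW -> /ltW ->].
move=> /(_ (fun s hs => dF s (itvo s hs)) (fun s hs => DF s (itvo s hs))).
have cF : {within `[- t2, t1], continuous F}.
  by apply: derivable_within_continuous => s; rewrite in_itv/=; exact: dF.
have tt : - t2 <= t1 by rewrite (le_trans _ t10)// oppr_le0.
move=> /(_ cF tt); lra.
Qed.

End drift_dim1.

(** * The discrete maximum principle *)

Lemma fem_lhs_stiffness (R : realType) (d : nat) (Omega : set 'rV[R]_d)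
    (Th : mesh R d) (D : 'rV[R]_d -> 'M[R]_d) (b : 'rV[R]_d -> 'rV[R]_d)
    (c : 'rV[R]_d -> R) (U V : 'I_(nb_vertices Th) -> R) :
  simplicial_mesh Th Omega ->
  {within closure Omega, continuous b} -> {within closure Omega, continuous c} ->
  fem_lhs D b c U V = \sum_K \sum_i V (vertex_of Th K i) *
    \sum_j U (vertex_of Th K j) *
      stiffness (element_vertices K) (mean_diffusion D K) b c i j.
Proof.
move=> hT cb cc; rewrite /fem_lhs -!big_split /=; apply: eq_bigr => K _.
have pU := element_nondegenerate hT K.
have KO := element_subset hT (K := K).
rewrite -stiffness_bilinear//; last 2 first.
- exact: (continuous_subspaceW KO cb).
- exact: (continuous_subspaceW KO cc).
congr (_ + _ + _); apply: eq_integral_on => x Kx.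
  by rewrite (fe_fun_local hT _ Kx).
by rewrite !(fe_fun_local hT _ Kx).
Qed.

Theorem theorem4p1 (R : realType) (d : nat) (hd : (0 < d)%N)
  (Omega : set 'rV[R]_d) (hOmega : polyhedral_domain Omega)
  (D : 'rV[R]_d -> 'M[R]_d) (b : 'rV[R]_d -> 'rV[R]_d)
  (c f g : 'rV[R]_d -> R)
  (hD : {within closure Omega, continuous D})
  (hb : C1_up_to_bdry Omega b)
  (hc : {within closure Omega, continuous c})
  (hf : {within closure Omega, continuous f})
  (hg : {within bdry Omega, continuous g})
  (hDspd : forall x, Omega x -> spd (D x))
  (hcb : forall x, Omega x -> 0 <= c x - divergence b x / 2)
  (hc0 : forall x, Omega x -> 0 <= c x)
  (Th : mesh R d) (hTh : simplicial_mesh Th Omega)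
  (hmesh : forall (K : 'I_(nb_elements Th)) (i j : 'I_d.+1), i != j ->
    let p := element_vertices K in
    let DK := mean_diffusion D K in
    height p i / lambda_min DK * (sup_enorm b (element K) / d.+1%:R)
    + height p i * height p j / lambda_min DK
      * (sup_on c (element K) / (d.+1%:R * d.+2%:R))
    <= cos (dihedral_angle_metric (invmx DK) p i j)) :
  discrete_maximum_principle Th D b c f g Omega.
Proof.
move=> U [_ hU] hf0; have [[x0 Ox0] _ Oint _] := hOmega; have [cb db _] := hb.
pose p := @element_vertices _ _ Th.
have pU K : affinely_independent (p K) by exact: (element_nondegenerate hTh).
have KO (K : 'I_(nb_elements Th)) : element K `<=` closure Omega by exact: (element_subset hTh).
have cK (K : 'I_(nb_elements Th)) : compact (element K) by exact: simplex_compact.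
have cbK (K : 'I_(nb_elements Th)) : {within element K, continuous b} by exact: (continuous_subspaceW (KO K) cb).
have ccK (K : 'I_(nb_elements Th)) : {within element K, continuous c} by exact: (continuous_subspaceW (KO K) hc).
have c0 x : closure Omega x -> 0 <= c x by exact: (closure_ge0 hc hc0).
have c0K (K : 'I_(nb_elements Th)) x : element K x -> 0 <= c x by move=> /KO; exact: c0.
have f0 x : closure Omega x -> f x <= 0.
  move=> Ox; rewrite -oppr_ge0; apply: (closure_ge0 (within_opp hf)) => //.
  by move=> y Oy; rewrite oppr_ge0 hf0.
have DKspd (K : 'I_(nb_elements Th)) : spd (mean_diffusion D K) by exact: (spd_mean_diffusion Oint).
pose a (K : 'I_(nb_elements Th)) := stiffness (p K) (mean_diffusion D K) b c.
have a0 K i j : i != j -> a K i j <= 0.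
  move=> ij; exact: (stiffness_le0 (pU K) hd (DKspd K) (cbK K) (ccK K) (@c0K K) (@hmesh K) ij).
pose M := Num.max 0 (sup (fe_fun U @` bdry Omega)).
have M0 : 0 <= M by rewrite le_max lexx.
suff UM k : U k <= M.
  apply: ge_sup.
    exists (fe_fun U x0); exists x0 => //; exact: subset_closure.
  move=> _ [x /(element_cover hTh)[K Kx] <-]; rewrite (fe_fun_local hTh _ Kx).
  rewrite -[leRHS]mulr1 -(sum_bary1 (pU K) x) mulr_sumr; apply: ler_sum => i _.
  apply: ler_wpM2r; last exact: UM.
  by move/simplexP : Kx => /(_ (pU K)); exact.
have [k0 _ kmax] := @arg_maxP _ _ _ k predT U isT.
set m := U k0 in kmax.
have {}kmax n : U n <= m by exact: kmax.
apply: (le_trans (kmax k)); rewrite leNgt; apply/negP => Mm.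
have m0 : 0 < m by exact: le_lt_trans Mm.
pose J n := U n == m.
have Jint n : J n -> ~ bdry Omega (vertex Th n).
  move=> /eqP Un nb; move: Mm; rewrite ltNge => /negP; apply.
  rewrite /M le_max; apply/orP; right; rewrite -Un -(fe_fun_vertex hTh U n).
  apply: ub_le_sup; last by exists (vertex Th n).
  exists m => _ [x [/(element_cover hTh)[K Kx] _] <-]; rewrite (fe_fun_local hTh _ Kx).
  rewrite -[leRHS]mulr1 -(sum_bary1 (pU K) x) mulr_sumr; apply: ler_sum => i _.
  apply: ler_wpM2r; last exact: kmax.
  by move/simplexP : Kx => /(_ (pU K)); exact.
have J0 : exists n, J n by exists k0; rewrite /J.
(* the test function; its energy is a sum of the nonnegative terms E K i *)
pose V n : R := (J n)%:R.
have V0 : vanishes_on_bdry_nodes V.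
  move=> n; rewrite leqNgt => nn; rewrite /V; have [Jn|//] := boolP (J n).
  by move: nn; rewrite ((interior_first hTh n).2 (Jint n Jn)).
pose E K i := V (vertex_of Th K i) * \sum_j U (vertex_of Th K j) * a K i j.
have E0 K i : 0 <= E K i.
  rewrite /E /V; have [Ji|nJi] := boolP (J _); last by rewrite mul0r.
  rewrite mul1r; apply: (energy_ge0 (pU K) (cbK K) (ccK K) (@c0K K) (@a0 K) m0).
    by move=> j; exact: kmax.
  exact/eqP.
have sumE : \sum_K \sum_i E K i = 0.
  apply/eqP; rewrite eq_le; apply/andP; split; last first.
    by apply: sumr_ge0 => K _; exact: sumr_ge0.
  rewrite -(fem_lhs_stiffness _ _ _ hTh cb hc) (hU V V0).
  apply: sumr_le0 => K _.
  have cV : {within element K, continuous (fun x => f x * fe_fun V x)}.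
    apply: (continuous_subspaceW (KO K)); apply: within_mul => //.
    exact: (fe_fun_continuous hTh).
  rewrite -[leRHS](mul0r (volume (element K))) -(integral_on_cst (cK K)).
  apply: le_integral_on => //; first exact: within_cst.
  move=> x Kx; apply: mulr_le0_ge0; first exact/f0/(KO K).
  rewrite -[fe_fun V]/(plateau J) (plateau_local hTh _ Kx); apply: sumr_ge0 => i _.
  by move/simplexP : Kx => /(_ (pU K)); exact.
have EK0 K i : E K i = 0.
  have /psumr_eq0P/(_ sumE K isT) hK : forall K, true -> 0 <= \sum_i E K i.
    by move=> L _; exact: sumr_ge0.
  by have /psumr_eq0P/(_ hK i isT) : forall i, true -> 0 <= E K i by move=> j _.
have eq0 K i : J (vertex_of Th K i) ->
    integral_on (element K) (fun x => c x * bary (p K) i x) = 0 /\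
    forall j, ~~ J (vertex_of Th K j) -> a K i j = 0.
  move=> Ji; apply: (energy_eq0 (u := fun i => U (vertex_of Th K i))
    (pU K) (cbK K) (ccK K) (@c0K K) (@a0 K) m0).
  - by move=> j; exact: kmax.
  - exact/eqP.
  - by have := EK0 K i; rewrite /E /V Ji mul1r.
have mixed (K : 'I_(nb_elements Th)) i0 j0 : J (vertex_of Th K i0) -> ~~ J (vertex_of Th K j0) ->
    exists2 s : R, 0 < s & (forall j, ~~ J (vertex_of Th K j) -> j = j0) /\
    forall x, element K x -> b x = s *: bary_grad (p K) j0.
  move=> Ji Jj; pose JK : {set 'I_d.+1} := [set i | J (vertex_of Th K i)]%SET.
  have [||||s s0 [sJ sb]] := @mixed_element R d (p K) (mean_diffusion D K) b c (pU K) hd (DKspd K)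
    (cbK K) (ccK K) (@c0K K) (@hmesh K) JK i0 j0.
  - by rewrite inE.
  - by rewrite inE.
  - move=> i j; rewrite !inE => Ji' Jj'; exact: (eq0 K i Ji').2.
  - exact: (eq0 K i0 Ji).1.
  exists s => //; split => // j Jj'; apply: sJ; by rewrite inE.
have [d1|d1] := eqVneq d 1%N; last first.
  exact: (no_drift_out_of_plateau hTh Oint hd Jint J0 mixed d1).
have divb x : plateau J x != 0 -> divergence b x <= 0.
  move=> vx; have [Ox [K [i [Kx Ji _]]]] := plateau_gt0 hTh Oint Jint vx.
  have cx : c x = 0 by apply: (mixed_reaction0 (pU K) (ccK K) (@c0K K) (eq0 K i Ji).1).
  by have := hcb x Ox; rewrite cx; lra.
clear -hTh Oint Jint J0 mixed db divb d1.
subst d.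
exact: (no_drift_out_of_plateau_dim1 hTh Oint Jint J0 mixed db divb).
Qed.
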